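(* Let $r\ge 1$, let $a$, $b_1,\dots,b_r$, $c$, $e_1,\dots,e_r$, $f$, $g$, and $z_1,\dots,z_r$ be indeterminate (complex parameters), let $B= b_1\cdots b_r$ and $E= e_1\cdots e_r$, and suppose that none of the denominators in the following identity vanishes. Then \begin{multline*} \sum_{k_1,\dots,k_r=-\infty}^{\infty} \Bigg(\prod_{1\le i<j\le r} \left(\frac{z_iq^{k_i}-z_jq^{k_j}}{z_i-z_j}\right) \prod_{i=1}^r\left(\frac{1-az_iq^{k_i+|\mathbf k|}}{1-az_i}\right)\\ \times \prod_{i,j=1}^r\frac{(e_jz_i/z_j;q)_{k_i}}{(az_iq/b_jz_j;q)_{k_i}} \prod_{i=1}^r\frac{(b_iz_i;q)_{|\mathbf k|}\,(fz_i;q)_{k_i}} {(az_iq/e_i;q)_{|\mathbf k|}\,(az_iq/g;q)_{k_i}}\cdot \frac{(g;q)_{|\mathbf k|}}{(aq/f;q)_{|\mathbf k|}}\\ \times \frac{(1-cq^{|\mathbf k|-1})}{(1-c/q)} \prod_{i=1}^r\frac{(1-az_iq^{k_i+1}/c)}{(1-az_iq/c)}\cdot \left(\frac{a^{r+1}}{BEfg}\right)^{|\mathbf k|}\Bigg)\\ =\left(1-\frac{(1-a^r/Bg)(1-cf/aq)}{(1-c/gq)(1-Ef/a)} \prod_{i=1}^r\frac{(1-ce_i/az_iq)}{(1-c/b_iz_iq)}\right) \prod_{i=1}^r\frac{(1-c/b_iz_iq)}{(1-c/az_iq)}\\ \times \frac{(1-c/gq)}{(1-c/q)}\, \frac{(a/Ef,\,aq/fg,\,a^rq/Bg;q)_{\infty}}{(a^{r+1}/BEfg,\,aq/f,\,q/g;q)_{\infty}}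 \prod_{i,j=1}^r\frac{(qz_i/z_j,\,az_iq/b_je_iz_j;q)_{\infty}} {(az_iq/b_jz_j,\,z_iq/e_iz_j;q)_{\infty}}\\ \times \prod_{i=1}^r\frac{(az_iq,\,q/az_i,\,az_iq/e_ig,\,aq/b_ifz_i;q)_{\infty}} {(az_iq/e_i,\,az_iq/g,\,q/b_iz_i,\,q/fz_i;q)_{\infty}}, \end{multline*} provided $|q|<1$ and $|a^{r+1}/BEfg|<1$.
   Context: Here $q$ is a complex number with $|q|<1$. The $q$-shifted factorials are $(x;q)_\infty:=\prod_{j=0}^\infty(1-xq^j)$ and, for any integer $k$ (positive, zero or negative), $(x;q)_k:=\dfrac{(x;q)_\infty}{(xq^k;q)_\infty}$. In particular $1/(q^{1+m};q)_k=0$ for integers $m\ge 0$ and $k\le -m-1$. For $k$ an integer or $\infty$, $(x_1,\dots,x_m;q)_k:=(x_1;q)_k\cdots(x_m;q)_k$. For integers $k_1,\dots,k_r$, write $\mathbf k=(k_1,\dots,k_r)$ and $|\mathbf k|:=k_1+\cdots+k_r$. In inline fractions everything after the slash is in the denominator: e.g. $az_iq/b_jz_j$ means $\frac{az_iq}{b_jz_j}$, $a^r/Bg$ means $\frac{a^r}{Bg}$, $c/gq$ means $\frac{c}{gq}$, $az_iq/b_je_iz_j$ means $\frac{az_iq}{b_je_iz_j}$. The sum is over all $(k_1,\dots,k_r)\in\mathbb Z^r$. *)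

(* Defs.v *)
From HB Require Import structures.
From mathcomp Require Import all_boot all_order all_algebra finmap complex.
From mathcomp Require Import all_classical all_reals topology normedtype sequences.
From mathcomp Require summability.

Set Implicit Arguments.
Unset Strict Implicit.
Unset Printing Implicit Defensive.

Import Order.TTheory GRing.Theory Num.Theory.
Import numFieldNormedType.Exports.

Local Open Scope classical_set_scope.
Local Open Scope ring_scope.

(* The topology of [R[i]] is the one given by its norm; the library declares it
   only on [R[i]^o] and on abstract [numClosedFieldType]s. *)
HB.instance Definition _ (R : rcfType) := PseudoPointedMetric.copy R[i] R[i]^o.
HB.instance Definition _ (R : rcfType) := NormedModule.copy R[i] R[i]^o.

Section QPochhammer.
Variable R : realType.
Implicit Types (q x : R[i]) (k : int) (n m : nat).

Definition qprod q x n : R[i] := \prod_(0 <= j < n) (1 - x * q ^+ j).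

(* (x; q)_oo *)
Definition qpochinf q x : R[i] := lim (qprod q x @ \oo).

(* (x; q)_k for k in Z.  This is (x; q)_oo / (x q^k; q)_oo with the common
   factors cancelled, so that it keeps its usual value when the quotient reads
   0 / 0, e.g. for x = q^-n and 0 <= k <= n; see [qpochE].  For k < 0 it has a
   pole at x = q^m, 1 <= m <= -k; there it evaluates to 0, hence so does its
   inverse, as the convention 1 / (q^(1+m); q)_k = 0 requires. *)
Definition qpoch q x k : R[i] :=
  match k with
  | Posz n => qprod q x n
  | Negz n => (\prod_(0 <= j < n.+1) (1 - x / q ^+ j.+1))^-1
  end.

Lemma qprodD q x m n : qprod q x (m + n) = qprod q x m * qprod q (x * q ^+ m) n.
Proof.
rewrite /qprod (big_cat_nat (n := m)) ?leq_addr//=; congr (_ * _).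
rewrite -{1}[m]add0n big_addn addKn; apply: eq_bigr => j _.
by rewrite addnC exprD mulrA.
Qed.

Lemma qprod_cvg_shift q x m (l : R[i]) :
  qprod q (x * q ^+ m) @ \oo --> l ->
  qprod q x @ \oo --> (qprod q x m * l : R[i]).
Proof.
move=> h; rewrite -(cvg_shiftn m).
have -> : (fun n => qprod q x (n + m)) =
          (fun n => qprod q x m * qprod q (x * q ^+ m) n).
  by apply/funext => n; rewrite addnC qprodD.
exact: (cvgM (cvg_cst _) h).
Qed.

Lemma qprod_cvg_unshift q x m (l : R[i]) : qprod q x m != 0 ->
  qprod q x @ \oo --> l ->
  qprod q (x * q ^+ m) @ \oo --> ((qprod q x m)^-1 * l : R[i]).
Proof.
move=> nz; rewrite -(cvg_shiftn m) => h.
have -> : qprod q (x * q ^+ m) =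
          (fun n => (qprod q x m)^-1 * qprod q x (n + m)).
  by apply/funext => n; rewrite addnC qprodD mulKf.
exact: (cvgM (cvg_cst _) h).
Qed.

Lemma qpochE q x k : q != 0 -> cvg (qprod q (x * q ^ k) @ \oo) ->
  qpochinf q (x * q ^ k) != 0 ->
  qpoch q x k = qpochinf q x / qpochinf q (x * q ^ k).
Proof.
move=> q0; case: k => m cv nz.
  have -> : qpochinf q x = qprod q x m * qpochinf q (x * q ^ m).
    exact: (cvg_lim (@norm_hausdorff _ _) (qprod_cvg_shift cv)).
  by rewrite mulfK.
set y := x * q ^ Negz m in cv nz *.
have xE : x = y * q ^+ m.+1.
  by rewrite /y -[q ^ _]/((q ^+ m.+1)^-1) divfK// expf_neq0.
have pE : qprod q y m.+1 = \prod_(0 <= j < m.+1) (1 - x / q ^+ j.+1).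
  rewrite /qprod big_nat_rev/= [LHS]big_nat [RHS]big_nat.
  apply: eq_bigr => j /andP[_ jm]; congr (1 - _).
  rewrite subSS xE -mulrA; congr (_ * _).
  apply: (canRL (mulfK _)); first by rewrite expf_neq0.
  by rewrite -exprD addnS subnK.
have pn0 : qprod q y m.+1 != 0.
  apply: contra nz => /eqP p0; rewrite /qpochinf.
  apply/eqP/(cvg_lim (@norm_hausdorff _ _)); rewrite -(cvg_shiftn m.+1).
  have -> : (fun n => qprod q y (n + m.+1)) = (fun=> 0).
    by apply/funext => n; rewrite addnC qprodD p0 mul0r.
  exact: cvg_cst.
have := qprod_cvg_unshift pn0 cv; rewrite -xE => h.
have -> : qpochinf q x = (qprod q y m.+1)^-1 * qpochinf q y.
  exact: (cvg_lim (@norm_hausdorff _ _) h).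
by rewrite /= -pE mulfK.
Qed.

Lemma qpoch_pole q (m : nat) k : q != 0 -> k <= - (m.+1)%:Z ->
  (qpoch q (q ^+ m.+1) k)^-1 = 0.
Proof.
move=> q0; case: k => n; first by rewrite -NegzE.
rewrite NegzE lerN2 lez_nat ltnS => mn /=; rewrite invrK big_mkord.
rewrite (bigD1 (Ordinal (mn : (m < n.+1)%N)))//=.
by rewrite divff ?expf_neq0// subrr mul0r.
Qed.

End QPochhammer.

(* |k| *)
Definition wt (r : nat) (k : {ffun 'I_r -> int}) : int := \sum_i k i.

(* [F] is summable with sum [s]: convergence of the net of finite partial sums,
   i.e. in [R[i]] absolute convergence to [s]. *)
Definition has_sum (R : realType) (I : choiceType) (F : I -> R[i]) (s : R[i]) :=
  summability.partial_sum F @ summability.totally --> s.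

(* Main.v *)
(** Put [k_0 = - |k|], [x_0 = 1 / a] and [x_i = z_i].  The sum then runs over
    the integer points of the hyperplane [k_0 + ... + k_r = 0], and, with
    [u_i = x_i q^(k_i)], its summand is a Vandermonde product in the [u_i] times
    [prod_(i, j) (a_j x_i)_(k_i) / (b_j x_i)_(k_i)] times [prod_i (1 - C u_i)],
    where [C = a q / c]: Gustafson's A_r extension of the 6psi6 sum, with an
    additional linear factor.

    Let [F_n] and [W_n] be the sums over the hyperplane [sum k_i = n] without
    and with the factor [prod_i (1 - C u_i)].  Expanding the summand in partial
    fractions at the [u_i] and shifting one coordinate at a time gives linear
    relations between [F_0], [F_1], [W_0] and [W_1].  Eliminating [F_1] and
    [W_1] expresses [W_0] by [F_0], and the choice [C = b_j] relates [F_0] to the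
    same sum with [b_j] replaced by [b_j q].  Iterating, [F_0] reduces by
    dominated convergence to its value at [b = 0], which is found by applying
    the same reduction to [b_j = q / x_j], where the sum has only one nonzero
    term.  When some [x_i / x_j] is a power of [q] (with [i <> j]), this choice is
    not available, but then the summand is antisymmetric under a swap of two
    coordinates and both sides vanish. *)
Require Import Defs.
From HB Require Import structures.
From mathcomp Require Import all_boot all_order all_algebra all_fingroup finmap complex.
From mathcomp Require Import all_classical all_reals topology normedtype sequences.
From mathcomp Require Import ring lra zify.
From mathcomp Require summability.

Set Implicit Arguments.
Unset Strict Implicit.
Unset Printing Implicit Defensive.

Import Order.TTheory GRing.Theory Num.Theory.
Import numFieldNormedType.Exports.

Local Open Scope classical_set_scope.
Local Open Scope ring_scope.

(** * Complex modulus and completeness *)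

(** The expansion term at the pole [u_i] involves [u_i] neither in its Vandermonde minor nor in its
    factors [1 - C u_j]. Raising the i-th coordinate thus only trades [prod_j (1 - a_j u_i)] for
    [prod_j (1 - b_j u_i)], which is what links one slice to the next. Taking [u_i] to the powers -1
    and 0 gives two relations for each [C]; the third is the case [C = 0] of the former, where
    [W_n = F_n].

    Each expansion term is shifted in its own coordinate, so each must be summable by itself. A row
    factor, however, is merely bounded for [k >= 0] and decays only for [k < 0]. The constraint
    [sum k_j = n] repairs this: a geometric weight constant on the slice moves decay from one
    direction to the other.

    The sum at [b = 0] is never evaluated in isolation: the general and the terminating family reach
    it as a common limit, and it is eliminated between them. The terminating family need not satisfy
    the convergence condition, so its decay comes from vanishing rows instead. Relations before the
    closed form are cross-multiplied, so that no factor that could vanish is divided out. *)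

Section ComplexModulus.
Variable R : realType.
Implicit Types (x y : R[i]).

(** The norm of [R[i]] takes its values in [R[i]]; suprema and geometric bounds need them in the
    ordered field [R]. *)
Definition cabs x : R := complex.Re `|x|.

Lemma normE x : `|x| = (cabs x)%:C%C.
Proof. by []. Qed.

Lemma cabs_lt x (M : R) : (`|x| < M%:C%C) = (cabs x < M).
Proof. by rewrite normE ltcR. Qed.

Lemma cabs_ge0 x : 0 <= cabs x.
Proof. by rewrite -lecR -normE normr_ge0. Qed.

Lemma cabs0 : cabs 0 = 0.
Proof. by apply: complexI; rewrite -normE normr0. Qed.

Lemma cabs1 : cabs 1 = 1.
Proof. by apply: complexI; rewrite -normE normr1. Qed.

Lemma cabsM : {morph cabs : x y / x * y}.
Proof. by move=> x y; apply: complexI; rewrite rmorphM/= -!normE normrM. Qed.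

Lemma cabsD x y : cabs (x + y) <= cabs x + cabs y.
Proof. by rewrite -lecR rmorphD/= -!normE ler_normD. Qed.

Lemma cabsN x : cabs (- x) = cabs x.
Proof. by apply: complexI; rewrite -!normE normrN. Qed.

Lemma cabsB x y : cabs (x - y) <= cabs x + cabs y.
Proof. by rewrite -[cabs y]cabsN cabsD. Qed.

Lemma cabs_distC x y : cabs (x - y) = cabs (y - x).
Proof. by rewrite -cabsN opprB. Qed.

Lemma cabsV x : cabs x^-1 = (cabs x)^-1.
Proof. by apply: complexI; rewrite fmorphV/= -!normE normfV. Qed.

Lemma cabsX x n : cabs (x ^+ n) = cabs x ^+ n.
Proof. by apply: complexI; rewrite rmorphXn/= -!normE normrX. Qed.

Lemma cabsXz x (k : int) : cabs (x ^ k) = cabs x ^ k.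
Proof. by case: k => n; rewrite /exprz ?cabsV cabsX. Qed.

Lemma cabs_eq0 x : (cabs x == 0) = (x == 0).
Proof. by rewrite -(inj_eq (@complexI _)) -normE normr_eq0. Qed.

Lemma cabs_gt0 x : (0 < cabs x) = (x != 0).
Proof. by rewrite lt_neqAle cabs_ge0 andbT eq_sym cabs_eq0. Qed.

Lemma cabs_real (t : R) : cabs t%:C%C = `|t|.
Proof. by rewrite /cabs normc_def /= expr0n addr0 sqrtr_sqr. Qed.

Lemma cabs_prod I (s : seq I) (P : pred I) (f : I -> R[i]) :
  cabs (\prod_(i <- s | P i) f i) = \prod_(i <- s | P i) cabs (f i).
Proof. by rewrite (big_morph _ cabsM cabs1). Qed.

Lemma cabs_sum I (s : seq I) (P : pred I) (f : I -> R[i]) :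
  cabs (\sum_(i <- s | P i) f i) <= \sum_(i <- s | P i) cabs (f i).
Proof.
elim/big_rec2: _ => [|i y x _ h]; first by rewrite cabs0.
by rewrite (le_trans (cabsD _ _))// lerD2l.
Qed.

Lemma Re_le_cabs x : `|complex.Re x| <= cabs x.
Proof. by rewrite -lecR -normE normc_ge_Re. Qed.

Lemma Im_le_cabs x : `|complex.Im x| <= cabs x.
Proof.
have := Re_le_cabs (x * 'i%C); rewrite ReiNIm normrN cabsM.
suff -> : cabs ('i : R[i])%C = 1 by rewrite mulr1.
by rewrite /cabs normc_def/= expr0n/= add0r expr1n sqrtr1.
Qed.

Lemma cabs_le_ReIm x : cabs x <= `|complex.Re x| + `|complex.Im x|.
Proof.
rewrite {1}[x]complexE (le_trans (cabsD _ _))// cabsM !cabs_real.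
suff -> : cabs ('i : R[i])%C = 1 by rewrite mul1r.
by rewrite /cabs normc_def/= expr0n/= add0r expr1n sqrtr1.
Qed.

Lemma cvg_cabsP (T : Type) (F : set_system T) (FF : Filter F) (f : T -> R[i])
    (l : R[i]) :
  f @ F --> l <-> forall e : R, 0 < e -> \forall t \near F, cabs (l - f t) < e.
Proof.
split=> [/cvgrPdist_lt h e e0|h].
  have /h : 0 < e%:C%C :> R[i] by rewrite ltcR.
  by apply: filterS => t; rewrite cabs_lt.
apply/cvgrPdist_lt => e e0.
have eE : e = (complex.Re e)%:C%C by rewrite RRe_real// gtr0_real.
have /h : 0 < complex.Re e by rewrite -ltcR -eE.
by apply: filterS => t; rewrite -cabs_lt -eE.
Qed.

(** Real and imaginary parts are 1-Lipschitz for the modulus, so they send a Cauchy filter to Cauchy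
    filters of [R], and their two limits assemble to a limit in [R[i]]. *)
Lemma complex_complete (F : set_system R[i]) :
  ProperFilter F -> cauchy F -> cvg F.
Proof.
move=> FF /cauchyP Fc.
have aux (h : R[i] -> R) : (forall x y, `|h x - h y| <= cabs (x - y)) ->
    cvg (h @ F).
  move=> hh; apply/cauchy_cvgP; apply/cauchy_exP => e e0.
  have e0' : 0 < e%:C%C :> R[i] by rewrite ltcR.
  have [x Fx] := Fc _ e0'; exists (h x).
  rewrite /fmap/=; apply: filterS Fx => y; rewrite /ball/= cabs_lt => xy.
  exact: le_lt_trans (hh _ _) xy.
have /cvg_ex[/= a ca] : cvg ((@complex.Re R) @ F).
  apply: aux => x y; apply: le_trans (Re_le_cabs _).
  by case: x y => [? ?] [? ?].
have /cvg_ex[/= b cb] : cvg ((@complex.Im R) @ F).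
  apply: aux => x y; apply: le_trans (Im_le_cabs _).
  by case: x y => [? ?] [? ?].
apply/cvg_ex; exists (a +i* b)%C.
rewrite -[F]/(id @ F); apply/cvg_cabsP => e e0.
have e2 : 0 < e / 2 by rewrite divr_gt0.
move/cvgrPdist_lt : ca => /(_ _ e2) ca; move/cvgrPdist_lt : cb => /(_ _ e2) cb.
near=> t.
have h1 : `|a - complex.Re t| < e / 2 by near: t.
have h2 : `|b - complex.Im t| < e / 2 by near: t.
apply: le_lt_trans (cabs_le_ReIm _) _.
rewrite [ltRHS]splitr ltrD//; by case: (t) h1 h2.
Unshelve. all: by end_near. Qed.

HB.instance Definition _ := Uniform_isComplete.Build R[i] complex_complete.

End ComplexModulus.

(** * Unordered sums *)

#[local] Existing Instance summability.totally_filter.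

Section SummationCriterion.
Variables (R : realType) (I : choiceType).
Implicit Types (F : I -> R[i]) (A : {fset I}).

Lemma partial_sumE F A : summability.partial_sum F A = \sum_(i <- A) F i.
Proof. by rewrite /summability.partial_sum big_seq_fsetE. Qed.

Lemma has_sumP F s : has_sum F s <->
  forall e : R, 0 < e ->
    exists A, forall B, (A `<=` B)%fset -> cabs (s - \sum_(i <- B) F i) < e.
Proof.
rewrite /has_sum; split.
  move/cvg_cabsP => h e /h [A _ hA]; exists A => B AB.
  by rewrite -partial_sumE; exact: hA.
move=> h; apply/cvg_cabsP => e /h [A hA]; exists A => // B AB.
by rewrite /= partial_sumE; exact: hA.
Qed.

End SummationCriterion.

Section Summation.
Variables (R : realType) (I : choiceType).
Implicit Types (F G : I -> R[i]) (A B : {fset I}) (g : I -> R).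

Lemma has_sum_unique F s t : has_sum F s -> has_sum F t -> s = t.
Proof. by move=> hs ht; apply: (cvg_unique (@norm_hausdorff _ _) hs ht). Qed.

Lemma has_sum_eq F G s : F =1 G -> has_sum F s -> has_sum G s.
Proof. by move/funext => ->. Qed.

Lemma has_sumD F G s t :
  has_sum F s -> has_sum G t -> has_sum (fun i => F i + G i) (s + t).
Proof.
rewrite /has_sum => hF hG.
have -> : summability.partial_sum (fun i => F i + G i) =
  summability.partial_sum F \+ summability.partial_sum G.
  by apply/funext => A /=; rewrite /summability.partial_sum big_split.
exact: (cvgD hF hG).
Qed.

Lemma has_sumZ c F s : has_sum F s -> has_sum (fun i => c * F i) (c * s).
Proof.
rewrite /has_sum => hF.
have -> : summability.partial_sum (fun i => c * F i) =
  (fun A => c * summability.partial_sum F A).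
  by apply/funext => A; rewrite /summability.partial_sum mulr_sumr.
exact: (cvgM (cvg_cst _) hF).
Qed.

Lemma has_sum0 : has_sum (fun _ : I => 0 : R[i]) 0.
Proof.
apply/has_sumP => e e0; exists fset0 => B _.
by rewrite big1// subr0 cabs0.
Qed.

Lemma has_sum_sum (J : finType) (F : J -> I -> R[i]) (s : J -> R[i]) :
  (forall j, has_sum (F j) (s j)) ->
  has_sum (fun i => \sum_j F j i) (\sum_j s j).
Proof.
move=> h; elim: (index_enum J) => [|j r ih].
  rewrite big_nil; apply: has_sum_eq has_sum0 => i; by rewrite big_nil.
rewrite big_cons; apply: has_sum_eq (has_sumD (h j) ih) => i.
by rewrite big_cons.
Qed.

Lemma has_sum_reindex (J : choiceType) (h : J -> I) (h' : I -> J) F s :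
  cancel h h' -> cancel h' h -> has_sum F s ->
  has_sum (fun j => F (h j)) s.
Proof.
move=> hK h'K /has_sumP hs; apply/has_sumP => e /hs [A hA].
exists [fset h' i | i in A]%fset => B AB.
have := hA [fset h j | j in B]%fset; rewrite big_imfset/=; last first.
  by move=> x y _ _; exact: can_inj hK _ _.
apply; apply/fsubsetP => i iA; apply/imfsetP; exists (h' i) => //=.
by apply: (fsubsetP AB); apply/imfsetP; exists i.
Qed.

Lemma has_sum_single F i0 : (forall i, i != i0 -> F i = 0) -> has_sum F (F i0).
Proof.
move=> h; apply/has_sumP => e e0; exists [fset i0]%fset => B.
rewrite fsub1set => i0B.
rewrite (big_fsetD1 i0)//= big_seq big1 ?addr0 ?subrr ?cabs0// => i.
by rewrite !inE => /andP[/h].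
Qed.

Definition dominating g :=
  (forall i, 0 <= g i) /\ exists M, forall A, \sum_(i <- A) g i <= M.

(** A set whose partial sum is within [e] of the supremum of all partial sums leaves less than [e]
    outside it. *)
Lemma dominating_tail g : dominating g -> forall e : R, 0 < e ->
  exists A, forall B, (A `<=` B)%fset -> \sum_(i <- (B `\` A)%fset) g i < e.
Proof.
move=> [g0 [M gM]] e e0.
pose S := [set x | exists A, x = \sum_(i <- A) g i]%classic.
have hS : has_sup S.
  split; first by exists (\sum_(i <- fset0) g i); exists fset0.
  by exists M => _ [A ->].
have [_ [A ->] hA] := sup_adherent e0 hS.
exists A => B AB.
have : \sum_(i <- B) g i <= sup S by apply: ub_le_sup; [exact: hS.2|exists B].
rewrite (big_fsetID _ (mem A))/=.
have -> : [fset x in B | x \in A]%fset = A.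
  by apply/fsetP => x; rewrite !inE; apply/andb_idl; exact: (fsubsetP AB).
have -> : [fset x in B | x \notin A]%fset = (B `\` A)%fset.
  by apply/fsetP => x; rewrite !inE andbC.
by move=> h; lra.
Qed.

Lemma sum_fsetD F A B : (A `<=` B)%fset ->
  \sum_(i <- B) F i = \sum_(i <- A) F i + \sum_(i <- (B `\` A)%fset) F i.
Proof.
move=> AB; rewrite (big_fsetID _ (mem A))/=; congr (_ + _); apply: congr_big => //.
  by congr enum_fset; apply/fsetP => x; rewrite !inE; apply/andb_idl; exact: (fsubsetP AB).
by congr enum_fset; apply/fsetP => x; rewrite !inE andbC.
Qed.

Lemma dominated_has_sum g F : dominating g -> (forall i, cabs (F i) <= g i) ->
  exists s, has_sum F s.
Proof.
move=> dg Fg; apply/cvg_ex.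
apply: cauchy_cvg; apply/cauchyP => e e0.
have eE : e = (complex.Re e)%:C%C by rewrite RRe_real// gtr0_real.
have e0' : 0 < complex.Re e by rewrite -ltcR -eE.
have [A hA] := dominating_tail dg e0'.
exists (summability.partial_sum F A); exists A => // B AB.
rewrite /ball/= eE cabs_lt !partial_sumE (sum_fsetD _ AB).
rewrite opprD addrA subrr sub0r cabsN (le_lt_trans (cabs_sum _ _ _))//.
by apply: le_lt_trans (hA _ AB); apply: ler_sum.
Qed.

Lemma has_sum_tail_le g F s A (e : R) : has_sum F s ->
  (forall i, cabs (F i) <= g i) ->
  (forall B, (A `<=` B)%fset -> \sum_(i <- (B `\` A)%fset) g i < e) ->
  cabs (s - \sum_(i <- A) F i) <= e.
Proof.
move=> /has_sumP hs Fg hA; apply/ler_addgt0Pr => d d0.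
have [B hB] := hs _ d0.
have AAB : (A `<=` A `|` B)%fset by exact: fsubsetUl.
have := hB _ (fsubsetUr A B).
rewrite (sum_fsetD _ AAB) => h.
set u := \sum_(i <- A) F i in h *; set v := \sum_(i <- _) F i in h.
have hv : cabs v < e.
  rewrite (le_lt_trans (cabs_sum _ _ _))//.
  by apply: le_lt_trans (hA _ AAB); apply: ler_sum.
rewrite (_ : s - u = (s - (u + v)) + v); last by ring.
by rewrite (le_trans (cabsD _ _))// addrC lerD// ltW.
Qed.

(* Tannery's theorem *)
Lemma has_sum_cvg g (F : nat -> I -> R[i]) (s : nat -> R[i]) (F' : I -> R[i]) :
  dominating g -> (forall n i, cabs (F n i) <= g i) ->
  (forall i, (fun n => F n i) @ \oo --> F' i) ->
  (forall n, has_sum (F n) (s n)) ->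
  exists2 s', has_sum F' s' & s @ \oo --> s'.
Proof.
move=> dg Fg Fc Fs.
have F'g i : cabs (F' i) <= g i.
  apply/ler_addgt0Pr => d d0; have /cvg_cabsP/(_ _ d0)[N _ hN] := Fc i.
  have := hN _ (leqnn N) => /= /ltW h.
  rewrite (_ : F' i = (F' i - F N i) + F N i); last by ring.
  by rewrite (le_trans (cabsD _ _))// addrC lerD.
have [s' hs'] := dominated_has_sum dg F'g; exists s' => //.
apply/cvg_cabsP => e e0.
have e3 : 0 < e / 4 by rewrite divr_gt0.
have [A hA] := dominating_tail dg e3.
have /cvg_cabsP/(_ _ e3) h : (fun n => \sum_(i <- A) F n i) @ \oo -->
    (\sum_(i <- A) F' i : R[i]).
  elim: (enum_fset A) => [|i l ih].
    by rewrite big_nil; under eq_fun do rewrite big_nil; exact: cvg_cst.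
  by rewrite big_cons; under eq_fun do rewrite big_cons; exact: (cvgD (Fc i) ih).
near=> n.
have h1 : cabs (\sum_(i <- A) F' i - \sum_(i <- A) F n i) < e / 4 by near: n.
have h2 := has_sum_tail_le hs' F'g hA.
have h3 := has_sum_tail_le (Fs n) (Fg n) hA.
rewrite (_ : s' - s n = (s' - \sum_(i <- A) F' i)
  + (\sum_(i <- A) F' i - \sum_(i <- A) F n i)
  + - (s n - \sum_(i <- A) F n i)); last by ring.
have := cabsD (s' - \sum_(i <- A) F' i
  + (\sum_(i <- A) F' i - \sum_(i <- A) F n i)) (- (s n - \sum_(i <- A) F n i)).
have := cabsD (s' - \sum_(i <- A) F' i) (\sum_(i <- A) F' i - \sum_(i <- A) F n i).
rewrite cabsN.
move: h1 h2 h3; lra.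
Unshelve. all: by end_near. Qed.

End Summation.

Arguments has_sumZ {R I} c {F s}.

(** * Infinite products *)

Section InfiniteProduct.
Variables (R : realType) (q : R[i]).
Hypothesis q1 : cabs q < 1.
Implicit Types (x y : R[i]) (n : nat).

Let rho := cabs q.
Let rho0 : 0 <= rho. Proof. exact: cabs_ge0. Qed.
Let rho1 : 0 < 1 - rho. Proof. by rewrite subr_gt0. Qed.

Lemma qprodS x n : qprod q x n.+1 = qprod q x n * (1 - x * q ^+ n).
Proof. by rewrite /qprod big_nat_recr. Qed.

Lemma qprod0 x : qprod q x 0 = 1.
Proof. by rewrite /qprod big_geq. Qed.

Lemma cabs_pow_lt (C e : R) : 0 < e -> \forall n \near \oo, C * rho ^+ n < e.
Proof.
move=> e0; have h : (fun n => C * rho ^+ n) @ \oo --> (C * 0 : R).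
  by apply: (cvgM (cvg_cst _)); apply: cvg_expr; rewrite ger0_norm.
move/cvgrPdist_lt : h => /(_ _ e0); apply: filterS => n.
by rewrite mulr0 sub0r normrN; apply: le_lt_trans; exact: ler_norm.
Qed.

(** The sum of [cabs (y * q ^+ j)] for [j < n] is the quantity on the right without its factor 2,
    and it is at most 1/4. The partial products therefore stay below 3/2 in modulus, which keeps the
    factor 2 through the induction. *)
Lemma qprod_sub1 y n : cabs y <= (1 - rho) / 4 ->
  cabs (qprod q y n - 1) <= 2 * (cabs y * (1 - rho ^+ n) / (1 - rho)).
Proof.
move=> hy; elim: n => [|n ih].
  by rewrite qprod0 subrr cabs0 expr0 subrr mulr0 mul0r mulr0.
set S := fun n => cabs y * (1 - rho ^+ n) / (1 - rho) in ih *.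
have SS : S n.+1 = S n + cabs y * rho ^+ n.
  rewrite /S exprS; field; by rewrite gt_eqF.
have S4 : S n <= 1 / 4.
  rewrite /S ler_pdivrMr//.
  have : cabs y * (1 - rho ^+ n) <= cabs y.
    by rewrite ler_piMr ?cabs_ge0// lerBlDr lerDl exprn_ge0.
  by move: hy; lra.
rewrite -/(S n.+1) SS qprodS.
set P := qprod q y n in ih *.
rewrite (_ : P * _ - 1 = (P - 1) - P * (y * q ^+ n)); last by ring.
rewrite (le_trans (cabsB _ _))// mulrDr lerD//.
rewrite cabsM cabsM cabsX -/rho ler_wpM2r ?mulr_ge0 ?cabs_ge0 ?exprn_ge0//.
rewrite (_ : P = (P - 1) + 1); last by ring.
rewrite (le_trans (cabsD _ _))// cabs1; move: ih S4; rewrite /S; lra.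
Qed.

Lemma qprod_sub1_le y n : cabs y <= (1 - rho) / 4 ->
  cabs (qprod q y n - 1) <= 2 * cabs y / (1 - rho).
Proof.
move=> hy; rewrite (le_trans (qprod_sub1 n hy))// mulrA ler_pM2r ?invr_gt0//.
rewrite ler_wpM2l// ler_piMr ?cabs_ge0// lerBlDr lerDl exprn_ge0//.
Qed.

Lemma qprod_sub1_half y n : cabs y <= (1 - rho) / 4 ->
  cabs (qprod q y n - 1) <= 1 / 2.
Proof.
move=> hy; rewrite (le_trans (qprod_sub1_le n hy))// ler_pdivrMr//.
by move: hy; lra.
Qed.

Lemma qprod_small_cvg y : cabs y <= (1 - rho) / 4 ->
  exists2 l, qprod q y @ \oo --> l & l != 0.
Proof.
move=> hy; have /cvg_ex[/= l cl] : cvg (qprod q y @ \oo).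
  apply: cauchy_cvg; apply/cauchyP => e e0.
  have eE : e = (complex.Re e)%:C%C by rewrite RRe_real// gtr0_real.
  have e0' : 0 < complex.Re e by rewrite -ltcR -eE.
  have [N _ hN] := cabs_pow_lt (2 * (2 * cabs y / (1 - rho))) e0'.
  exists (qprod q y N).
  exists N => //= n /= Nn; rewrite /ball/= eE cabs_lt cabs_distC.
  rewrite -(subnKC Nn) qprodD -[X in _ - X]mulr1 -mulrBr cabsM.
  apply: le_lt_trans (hN _ (leqnn N)); rewrite -mulrA ler_pM ?cabs_ge0//.
    rewrite (_ : qprod q y N = (qprod q y N - 1) + 1); last by ring.
    rewrite (le_trans (cabsD _ _))// cabs1.
    by have := qprod_sub1_half N hy; lra.
  rewrite (le_trans (qprod_sub1_le _ _))//.
    rewrite cabsM cabsX -/rho (le_trans _ hy)// ler_piMr ?cabs_ge0//.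
    by rewrite exprn_ile1// ltW.
  rewrite cabsM cabsX -/rho le_eqVlt; apply/orP; left; apply/eqP; ring.
exists l => //; apply/eqP => l0; move/cvg_cabsP : cl.
have h2 : 0 < 1 / 2 :> R by lra.
move=> /(_ _ h2)[N _ /(_ _ (leqnn N))/=]; rewrite l0 sub0r cabsN.
have := qprod_sub1_half N hy; set P := qprod q y N.
have : cabs 1 <= cabs P + cabs (P - 1).
  by rewrite {1}(_ : 1 = P - (P - 1)) ?cabsB//; ring.
by rewrite cabs1; lra.
Qed.

(** For [n] large, [x * q ^+ n] is small enough for [qprod_small_cvg]. Hence a zero of the infinite
    product can only come from one of its first [n] factors. *)
Lemma qprod_shift_cvg x : exists n l,
  [/\ qprod q (x * q ^+ n) @ \oo --> l & l != 0].
Proof.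
have h4 : 0 < (1 - rho) / 4 by rewrite divr_gt0.
have [N _ /(_ _ (leqnn N))/= hN] := cabs_pow_lt (cabs x) h4.
exists N; have [|l] := @qprod_small_cvg (x * q ^+ N).
  by rewrite cabsM cabsX ltW.
by exists l.
Qed.

Lemma qpochinf_cvg x : qprod q x @ \oo --> qpochinf q x.
Proof.
have [n [l [cl _]]] := qprod_shift_cvg x.
have h := qprod_cvg_shift cl.
by rewrite /qpochinf (cvg_lim (@norm_hausdorff _ _) h).
Qed.

Lemma qpochinf_split x n : qpochinf q x = qprod q x n * qpochinf q (x * q ^+ n).
Proof.
by apply: (cvg_lim (@norm_hausdorff _ _)); apply: qprod_cvg_shift;
  exact: qpochinf_cvg.
Qed.

Lemma qprod_eq0P x n :
  reflect (exists2 j, (j < n)%N & x * q ^+ j = 1) (qprod q x n == 0).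
Proof.
rewrite /qprod big_mkord prodf_seq_eq0; apply: (iffP hasP) => [[j _]|[j jn xj]].
  by rewrite subr_eq0 => /eqP xj; exists j.
by exists (Ordinal jn); rewrite ?mem_index_enum//= xj subrr.
Qed.

Lemma qpochinf_eq0P x :
  reflect (exists j, x * q ^+ j = 1) (qpochinf q x == 0).
Proof.
apply: (iffP eqP) => [x0|[j xj]].
  have [n [l [cl l0]]] := qprod_shift_cvg x.
  have := qpochinf_split x n.
  rewrite x0 [in X in _ * X]/qpochinf (cvg_lim (@norm_hausdorff _ _) cl).
  move/esym/eqP; rewrite mulf_eq0 (negbTE l0) orbF => /qprod_eq0P[j _ xj].
  by exists j.
rewrite (qpochinf_split x j.+1); apply/eqP; rewrite mulf_eq0; apply/orP; left.
by apply/qprod_eq0P; exists j.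
Qed.

Lemma qpochinf_neq0 x : (forall j : nat, x * q ^+ j != 1) -> qpochinf q x != 0.
Proof. by move=> h; apply/qpochinf_eq0P => -[j /eqP]; rewrite (negbTE (h j)). Qed.

Lemma qpochinf_factor x : qpochinf q x != 0 -> forall j : nat, x * q ^+ j != 1.
Proof. by move=> /qpochinf_eq0P h j; apply/eqP => xj; apply: h; exists j. Qed.

Lemma qprod_neq0 x n : qpochinf q x != 0 -> qprod q x n != 0.
Proof.
by move=> /qpochinf_factor h; apply/qprod_eq0P => -[j _ /eqP]; rewrite (negbTE (h j)).
Qed.

Lemma qpochinf0 : qpochinf q 0 = 1.
Proof.
apply: (cvg_lim (@norm_hausdorff _ _)).
rewrite (_ : qprod q 0 = fun=> 1); first exact: cvg_cst.
by apply/funext => n; rewrite /qprod big1// => j _; rewrite mul0r subr0.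
Qed.

Lemma qpochinf_small_neq0 x : cabs x < 1 -> qpochinf q x != 0.
Proof.
move=> x1; apply: qpochinf_neq0 => j; apply/eqP => xj.
have : cabs (x * q ^+ j) < 1.
  rewrite cabsM cabsX -/rho (le_lt_trans _ x1)// ler_piMr ?cabs_ge0//.
  by rewrite exprn_ile1// ltW.
by rewrite xj cabs1 ltxx.
Qed.

Lemma seq_cabs_bounded (u : nat -> R[i]) (l : R[i]) : u @ \oo --> l ->
  exists M, forall n, cabs (u n) <= M.
Proof.
move/cvg_cabsP/(_ _ ltr01) => -[N _ hN].
exists (\sum_(i < N) cabs (u i) + (cabs l + 1)) => n.
have [nN|Nn] := ltnP n N.
  rewrite (bigD1 (Ordinal nN))//= -addrA lerDl addr_ge0//.
    by apply: sumr_ge0 => i _; exact: cabs_ge0.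
  by rewrite addr_ge0// cabs_ge0.
have := hN _ Nn => /= h.
apply: ler_wpDl; first by apply: sumr_ge0 => i _; exact: cabs_ge0.
rewrite (_ : u n = l - (l - u n)); last by ring.
by rewrite (le_trans (cabsB _ _))// lerD2l ltW.
Qed.

Lemma qprod_bounded x : exists M, forall n, cabs (qprod q x n) <= M.
Proof. exact: seq_cabs_bounded (@qpochinf_cvg x). Qed.

Lemma qprod_inv_bounded x : qpochinf q x != 0 ->
  exists M, forall n, cabs (qprod q x n)^-1 <= M.
Proof.
move=> x0; apply: (@seq_cabs_bounded (fun n => (qprod q x n)^-1)).
by apply: cvgV x0 _; exact: qpochinf_cvg.
Qed.

End InfiniteProduct.

(** * Partial fractions and the Vandermonde product *)

Section Interpolation.
Variables (K : fieldType) (m : nat).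
Implicit Types (u a : 'I_m -> K) (C : K).

(** Two monic polynomials of degree [m] differ by a polynomial of degree less than [m], which equals
    its Lagrange interpolant at the [w i], the zeros of the second one; both are evaluated at
    [C]. *)
Lemma lagrange_monic (w a : 'I_m -> K) C : injective w ->
  \sum_i (\prod_j (w i - a j) * \prod_(j | j != i) ((C - w j) / (w i - w j)))
  = \prod_j (C - a j) - \prod_j (C - w j).
Proof.
move=> wi.
pose p : {poly K} := \prod_j ('X - (a j)%:P) - \prod_j ('X - (w j)%:P).
pose L i : {poly K} := \prod_(j | j != i) ((w i - w j)^-1 *: ('X - (w j)%:P)).
pose s : {poly K} := \sum_i (\prod_j (w i - a j)) *: L i - p.
have sizeL i : (size (L i) <= m)%N.
  rewrite /L scaler_prod (leq_trans (size_scale_leq _ _))//.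
  rewrite -big_enum/= -(big_map w xpredT (fun z => 'X - z%:P)) size_prod_XsubC.
  by rewrite size_map -cardE cardC1 card_ord; case: (m) i => [[]|].
have size1 : size (\prod_j ('X - (w j)%:P)) = m.+1.
  by rewrite -(big_map w xpredT (fun z => 'X - z%:P)) size_prod_XsubC size_map
    /index_enum -enumT size_enum_ord.
have size2 : size (\prod_j ('X - (a j)%:P)) = m.+1.
  by rewrite -(big_map a xpredT (fun z => 'X - z%:P)) size_prod_XsubC size_map
    /index_enum -enumT size_enum_ord.
have sizep : (size p <= m)%N.
  apply/leq_sizeP => j mj; rewrite coefB.
  have [->|jm] := eqVneq j m.
    have /monicP := monic_prod_XsubC (index_enum 'I_m) xpredT a.
    have /monicP := monic_prod_XsubC (index_enum 'I_m) xpredT w.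
    by rewrite /lead_coef size1 size2 => -> ->; rewrite subrr.
  by rewrite !nth_default ?subrr// ?size1 ?size2 ltn_neqAle eq_sym jm.
have sizes : (size s <= m)%N.
  rewrite (leq_trans (size_polyD _ _))// size_polyN geq_max sizep andbT.
  rewrite (leq_trans (size_sum _ _ _))//; apply/bigmax_leqP => i _.
  by rewrite (leq_trans (size_scale_leq _ _)).
have Lw i k : (L i).[w k] = (k == i)%:R.
  rewrite /L horner_prod; have [->|ki] := eqVneq k i.
    rewrite big1// => j ji; rewrite hornerZ hornerXsubC mulVf// subr_eq0.
    by rewrite (inj_eq wi) eq_sym.
  by rewrite (bigD1 k)//= hornerZ hornerXsubC subrr mulr0 mul0r.
have s0 : s = 0.
  apply: (@roots_geq_poly_eq0 _ s (map w (enum 'I_m))).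
  - apply/allP => _ /mapP[k _ ->]; rewrite /root /s hornerD hornerN horner_sum.
    have -> : \sum_i (((\prod_j (w i - a j)) *: L i).[w k]) = \prod_j (w k - a j).
      rewrite (eq_bigr (fun i => if i == k then \prod_j (w i - a j) else 0)).
        by rewrite -big_mkcond (big_pred1 k).
      by move=> i _; rewrite hornerZ Lw eq_sym; case: eqP => _; rewrite ?mulr1 ?mulr0.
    rewrite /p hornerD hornerN !horner_prod.
    rewrite [X in _ - (_ - X)](bigD1 k)//= hornerXsubC subrr mul0r subr0.
    by rewrite subr_eq0; apply/eqP; apply: eq_bigr => j _; rewrite hornerXsubC.
  - by rewrite map_inj_uniq ?enum_uniq.
  - by rewrite size_map size_enum_ord.
have := congr1 (fun z => z.[C]) s0; rewrite horner0 /s hornerD hornerN horner_sum.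
move/eqP; rewrite subr_eq0 => /eqP; rewrite /p hornerD hornerN !horner_prod.
have -> : \prod_j (('X - (a j)%:P).[C]) = \prod_j (C - a j).
  by apply: eq_bigr => j _; rewrite hornerXsubC.
have -> : \prod_j (('X - (w j)%:P).[C]) = \prod_j (C - w j).
  by apply: eq_bigr => j _; rewrite hornerXsubC.
move=> <-; apply: eq_bigr => i _; rewrite hornerZ horner_prod; congr (_ * _).
by apply: eq_bigr => j _; rewrite hornerZ hornerXsubC mulrC.
Qed.

(** [lagrange_monic] at the nodes [1 / u i]. Clearing denominators gives [u i ^- m] from the product
    over [a] and [u i ^+ m.-1] from the interpolation basis, whence the single [/ u i]. *)
Lemma partial_fraction u a C : injective u -> (forall i, u i != 0) ->
  \sum_i (\prod_(j | j != i) ((1 - C * u j) / (u i - u j))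
          * \prod_j (1 - a j * u i) / u i)
  = \prod_j (C - a j) - (-1) ^+ m * \prod_j (1 - C * u j) / \prod_j u j.
Proof.
move=> ui u0; have wi : injective (fun i => (u i)^-1).
  by move=> i j /= /invr_inj /ui.
have -> : (-1) ^+ m * \prod_j (1 - C * u j) / \prod_j u j =
    \prod_j (C - (u j)^-1).
  rewrite -prodfV -mulrA -big_split/=.
  rewrite (_ : (-1) ^+ m = \prod_(j < m) (-1 : K)) -?big_split/=; last first.
    by rewrite prodr_const card_ord.
  by apply: eq_bigr => j _; rewrite mulrDl mulN1r mul1r mulNr mulfK// opprB.
rewrite -(lagrange_monic _ _ wi); apply: eq_bigr => i _.
have -> : \prod_j ((u i)^-1 - a j) = \prod_j (1 - a j * u i) / (u i) ^+ m.
  have -> : (u i) ^+ m = \prod_(j < m) u i by rewrite prodr_const card_ord.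
  rewrite -prodfV -big_split/=.
  by apply: eq_bigr => j _; field.
have -> : \prod_(j | j != i) ((C - (u j)^-1) / ((u i)^-1 - (u j)^-1)) =
    \prod_(j | j != i) ((1 - C * u j) / (u i - u j)) * (u i) ^+ m.-1.
  have -> : (u i) ^+ m.-1 = \prod_(j | j != i) u i.
    by rewrite prodr_const cardC1 card_ord.
  rewrite -big_split; apply: eq_bigr => j ji /=.
  have h : u i - u j != 0 by rewrite subr_eq0 (inj_eq ui) eq_sym.
  have h' : u j - u i != 0 by rewrite subr_eq0 (inj_eq ui).
  by field; rewrite mulN1r h h' !u0.
have -> : (u i) ^+ m = u i * (u i) ^+ m.-1.
  by rewrite -exprS prednK// (leq_ltn_trans (leq0n i)).
have h : (u i) ^+ m.-1 != 0 by rewrite expf_neq0.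
by field; rewrite u0 h.
Qed.

(** Since [C = (1 - (1 - C * u i)) / u i], the left side is the sum of [partial_fraction] at [C]
    minus [\prod_j (1 - C * u j)] times the same sum at 0. *)
Lemma partial_fraction1 u a C : injective u -> (forall i, u i != 0) ->
  C * \sum_i (\prod_(j | j != i) ((1 - C * u j) / (u i - u j))
              * \prod_j (1 - a j * u i))
  = \prod_j (C - a j) - (-1) ^+ m * \prod_j a j * \prod_j (1 - C * u j).
Proof.
move=> ui u0; pose k i := \prod_(j | j != i) (u i - u j)^-1 * \prod_j (1 - a j * u i) / u i.
have k0 : \sum_i k i = \prod_j (- a j) - (-1) ^+ m / \prod_j u j.
  have := partial_fraction a 0 ui u0.
  rewrite [X in _ = _ - _ * X / _]big1; last by move=> j _; rewrite mul0r subr0.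
  rewrite mulr1; under [X in _ = X - _]eq_bigr do rewrite sub0r; move=> <-.
  apply: eq_bigr => i _; congr (_ * _ / _); apply: eq_bigr => j _.
  by rewrite mul0r subr0 mul1r.
have := partial_fraction a C ui u0.
set S := \sum_i _ => SE; rewrite mulr_sumr.
have -> : \sum_i C * (\prod_(j | j != i) ((1 - C * u j) / (u i - u j))
              * \prod_j (1 - a j * u i)) = S - \prod_j (1 - C * u j) * \sum_i k i.
  rewrite mulr_sumr -sumrB; apply: eq_bigr => i _.
  rewrite /k (bigD1 (P := predT) (F := fun j => 1 - C * u j) i)//=.
  have -> : \prod_(j | j != i) ((1 - C * u j) / (u i - u j)) =
      \prod_(j | j != i) (1 - C * u j) * \prod_(j | j != i) (u i - u j)^-1.
    by rewrite -big_split.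
  by field; exact: u0.
rewrite SE k0 prodrN card_ord.
have : \prod_j u j != 0 by apply/prodf_neq0 => i _.
move=> h; field; exact: h.
Qed.

End Interpolation.

Section Vandermonde.
Variables (K : comUnitRingType) (m : nat).
Implicit Types (u v : 'I_m -> K) (i : 'I_m).

Definition vdm u : K := \prod_(i < m) \prod_(j < m | (i < j)%N) (u i - u j).

(* [vdm u] with the factors containing [u i] removed, up to sign *)
Definition vdm_minor i u : K :=
  (\prod_(j < m | (j < i)%N) -1) *
  \prod_(p : 'I_m * 'I_m | (p.1 < p.2)%N && ((p.1 != i) && (p.2 != i)))
    (u p.1 - u p.2).

Lemma vdm_pairs u : vdm u = \prod_(p : 'I_m * 'I_m | (p.1 < p.2)%N) (u p.1 - u p.2).
Proof. by rewrite /vdm pair_big_dep. Qed.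

Lemma vdm_minorE i u : vdm u = vdm_minor i u * \prod_(j | j != i) (u i - u j).
Proof.
rewrite vdm_pairs (bigID (fun p => (p.1 != i) && (p.2 != i)))/= /vdm_minor.
rewrite -mulrA mulrCA; congr (_ * _).
rewrite (bigID (fun p => p.1 == i))/=.
have -> : \prod_(p : 'I_m * 'I_m | ((p.1 < p.2)%N && ~~ ((p.1 != i) && (p.2 != i))) && (p.1 == i))
    (u p.1 - u p.2) = \prod_(j < m | (i < j)%N) (u i - u j).
  rewrite (reindex_onto (fun j => (i, j)) snd)/=; last first.
    by case=> a b /= /andP[_ /eqP->].
  by apply: eq_bigl => j; rewrite !eqxx/= !andbT.
have -> : \prod_(p : 'I_m * 'I_m | ((p.1 < p.2)%N && ~~ ((p.1 != i) && (p.2 != i))) && (p.1 != i))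
    (u p.1 - u p.2) = (\prod_(j < m | (j < i)%N) -1) * \prod_(j < m | (j < i)%N) (u i - u j).
  rewrite (reindex_onto (fun j => (j, i)) fst)/=; last first.
    by case=> a b /= /andP[/andP[_]]; rewrite negb_and !negbK => /orP[-> //|/eqP->].
  rewrite -big_split/=; apply: eq_big => [j|j _]; last by rewrite mulN1r opprB.
  rewrite !eqxx andbF/= andbT; case: (ltngtP j i) => //= h.
  by rewrite -(inj_eq val_inj) neq_ltn h.
rewrite mulrCA; congr (_ * _); rewrite [RHS](bigID (fun j : 'I_m => (i < j)%N))/=.
congr (_ * _); apply: eq_bigl => j; rewrite -(inj_eq val_inj)/=;
  by case: ltngtP.
Qed.

Lemma eq_vdm_minor i u v : (forall j, j != i -> u j = v j) ->
  vdm_minor i u = vdm_minor i v.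
Proof.
by move=> uv; congr (_ * _); apply: eq_bigr => -[a b]/= /andP[_ /andP[/uv-> /uv->]].
Qed.

End Vandermonde.

(** * Summation over slices of the lattice *)

Section IntegerPower.
Variable R : realFieldType.
Implicit Types (al be : R) (k : int).

(** A two-sided geometric weight with separate ratios per step upwards and downwards; [Negz n] is
    [-(n + 1)], hence the exponent [n.+1]. *)
Definition ipow al be k : R :=
  match k with Posz n => al ^+ n | Negz n => be ^+ n.+1 end.

Lemma ipowM al be al' be' k :
  ipow (al * al') (be * be') k = ipow al be k * ipow al' be' k.
Proof. by case: k => n; rewrite /= exprMn. Qed.

Lemma ipowX al be n k : ipow (al ^+ n) (be ^+ n) k = ipow al be k ^+ n.
Proof. by case: k => l; rewrite /= -!exprM mulnC. Qed.

Lemma ipow_ge0 al be k : 0 <= al -> 0 <= be -> 0 <= ipow al be k.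
Proof. by move=> ? ?; case: k => n; rewrite /= exprn_ge0. Qed.

Lemma ipow_le al be al' be' k : 0 <= al -> 0 <= be -> al <= al' -> be <= be' ->
  ipow al be k <= ipow al' be' k.
Proof.
move=> al0 be0 ha hb.
by case: k => n; rewrite /= lerXn2r ?nnegrE// (le_trans _ ha, le_trans _ hb).
Qed.

Lemma ipow_exprz al k : al ^ k = ipow al al^-1 k.
Proof. by case: k => n //=; rewrite exprVn. Qed.

Lemma ipow_le1 la k : 0 <= la -> la <= 1 -> ipow la la k <= 1.
Proof. by move=> ? ?; case: k => n; rewrite /= exprn_ile1. Qed.

End IntegerPower.

Section GeometricDomination.
Variables (R : realType) (r : nat).
Implicit Types (k : {ffun 'I_r -> int}) (la : R).

Lemma sum_ipow_bound la (S : {fset int}) : 0 < la -> la < 1 ->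
  \sum_(z <- S) ipow la la z <= 2 / (1 - la).
Proof.
move=> la0 la1; have l1 : 0 < 1 - la by rewrite subr_gt0.
have geo N : \sum_(i < N) la ^+ i <= 1 / (1 - la).
  have -> : \sum_(i < N) la ^+ i = (1 - la ^+ N) / (1 - la).
    elim: N => [|N ih]; first by rewrite big_ord0 expr0 subrr mul0r.
    by rewrite big_ord_recr/= ih exprS; field; rewrite gt_eqF.
  by rewrite ler_pM2r ?invr_gt0// lerBlDr lerDl exprn_ge0// ltW.
have [N hN] : exists N : nat, forall z, z \in S -> (absz z < N)%N.
  exists (\max_(z <- S) (absz z)).+1 => z kS; rewrite ltnS.
  exact: (@leq_bigmax_seq _ (enum_fset S) xpredT absz).
pose B := [seq Posz n | n <- iota 0 N] ++ [seq Negz n | n <- iota 0 N].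
have uB : uniq B.
  rewrite cat_uniq !map_inj_uniq ?iota_uniq/= ?andbT; [|by move=> x y []..].
  by apply/hasPn => _ /mapP[x _ ->]; apply/negP => /mapP[y _].
apply: (@le_trans _ _ (\sum_(z <- B) ipow la la z)).
  have sub : {subset enum_fset S <= B}.
    move=> z kS; have := hN _ kS; rewrite mem_cat; case: z kS => n _ /= nN.
      by rewrite map_f ?mem_iota.
    by rewrite [X in _ || X]map_f ?orbT// mem_iota/= add0n ltnW.
  rewrite [leRHS](bigID (mem S))/= -[leLHS]addr0 lerD//; last first.
    by apply: sumr_ge0 => i _; rewrite ipow_ge0// ltW.
  rewrite -[leRHS]big_filter le_eqVlt; apply/orP; left; apply/eqP; apply: perm_big.
  apply: uniq_perm; rewrite ?filter_uniq ?fset_uniq// => z.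
  rewrite mem_filter; apply/idP/andP => [kS|[]//]; split => //; exact: sub.
rewrite big_cat/= !big_map -{1 2}(subn0 N) -/(index_iota 0 N) !big_mkord.
have -> : 2 / (1 - la) = 1 / (1 - la) + 1 / (1 - la) by rewrite -mulrDl.
apply: lerD => //; apply: le_trans (geo N); apply: ler_sum => i _ /=.
by rewrite exprS ler_piMl ?exprn_ge0 ?ltW.
Qed.

(** A finite set of points lies in the box [S ^ r], with [S] the set of all their coordinates, and
    over a box the sum of products factors into one-dimensional sums. *)
Lemma dominating_ipow la (M : R) : 0 < la -> la < 1 -> 0 <= M ->
  dominating (fun k => M * \prod_i ipow la la (k i)).
Proof.
move=> la0 la1 M0; have p0 k : 0 <= \prod_i ipow la la (k i).
  by apply: prodr_ge0 => i _; rewrite ipow_ge0// ltW.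
split=> [k|]; first by rewrite mulr_ge0.
exists (M * (2 / (1 - la)) ^+ r) => A.
rewrite -mulr_sumr ler_wpM2l//.
pose S : {fset int} := [fset z | z in [seq k i | k : {ffun 'I_r -> int} <- A, i <- enum 'I_r]]%fset.
have kS k i : k \in A -> k i \in S.
  by move=> kA; rewrite !inE/=; apply/allpairsP; exists (k, i); rewrite mem_enum.
pose P (phi : {ffun 'I_r -> S}) : R := \prod_i ipow la la (val (phi i)).
apply: (@le_trans _ _ (\sum_phi P phi)).
  rewrite big_seq_fsetE/=.
  pose f (k : A) : {ffun 'I_r -> S} := [ffun i => FSetSub (kS (val k) i (valP k))].
  have fi : injective f.
    move=> k l kl; apply: val_inj; apply/ffunP => i.
    by have := congr1 (fun z : {ffun 'I_r -> S} => val (z i)) kl; rewrite !ffunE.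
  rewrite [leLHS](_ : _ = \sum_(k : A) P (f k)); last first.
    by apply: eq_bigr => k _; apply: eq_bigr => i _; rewrite ffunE.
  rewrite -(big_imset (A := mem predT) P)/=; last by move=> ? ? _ _ /fi.
  rewrite [leRHS](bigID (mem (imset f (mem predT))))/= lerDl.
  by apply: sumr_ge0 => phi _; apply: prodr_ge0 => i _; rewrite ipow_ge0// ltW.
rewrite /P -(bigA_distr_bigA (fun (_ : 'I_r) (z : S) => ipow la la (val z))).
rewrite prodr_const card_ord lerXn2r// ?nnegrE.
- by apply: sumr_ge0 => z _; rewrite ipow_ge0// ltW.
- by rewrite divr_ge0// subr_ge0 ltW.
- rewrite -(big_seq_fsetE _ _ predT (ipow la la)); exact: sum_ipow_bound.
Qed.

End GeometricDomination.

Section Slices.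
Variables (R : realType) (r : nat).
Implicit Types (k : {ffun 'I_r -> int}) (n : int) (K : 'I_r.+1 -> int).

(* The point of the slice [\sum_j K j = n] of Z^(r+1) whose coordinates
   other than the first are [k]. *)
Definition ext n k : 'I_r.+1 -> int :=
  fun j => if unlift ord0 j is Some i then k i else n - wt k.

Definition incr i K : 'I_r.+1 -> int := fun j => K j + (j == i)%:Z.

Lemma ext0 n k : ext n k ord0 = n - wt k.
Proof. by rewrite /ext unlift_none. Qed.

Lemma ext_lift n k i : ext n k (lift ord0 i) = k i.
Proof. by rewrite /ext liftK. Qed.

Lemma sum_ext n k : \sum_j ext n k j = n.
Proof.
rewrite big_ord_recl ext0 (eq_bigr (fun i => k i)) ?subrK// => i _.
by rewrite ext_lift.
Qed.

Lemma ext_incr0 n k : ext (n + 1) k = incr ord0 (ext n k).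
Proof.
apply/funext => j; rewrite /incr /ext; case: unliftP => [i ->|->].
  by rewrite -[_ == _]/(lift ord0 i == ord0) eq_sym (negbTE (neq_lift _ _)) addr0.
by rewrite eqxx addrAC.
Qed.

Definition unitf (i : 'I_r) : {ffun 'I_r -> int} := [ffun j => (j == i)%:Z].

Lemma ext_incr_lift n k i :
  ext (n + 1) (k + unitf i) = incr (lift ord0 i) (ext n k).
Proof.
apply/funext => j; rewrite /incr /ext; case: unliftP => [l ->|->].
  by rewrite !ffunE (inj_eq lift_inj).
rewrite (negbTE (neq_lift _ _)) addr0 /wt.
under eq_bigr do rewrite !ffunE.
have e : \sum_j0 (j0 == i)%:Z = 1.
  by rewrite (bigD1 i)//= eqxx big1 ?addr0// => j0 /negbTE ->.
rewrite big_split/= e.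
by rewrite opprD addrACA subrr addr0.
Qed.

(** Raising coordinate [i] maps slice [n] bijectively onto slice [n + 1]. In the parametrisation
    [ext] this is the identity for coordinate 0 and a translation by a unit vector otherwise, so
    sums are unchanged. *)
Lemma slice_telescope (D D' : 'I_r.+1 -> ('I_r.+1 -> int) -> R[i]) n i s :
  (forall K, D i K = D' i (incr i K)) ->
  has_sum (fun k => D i (ext n k)) s -> has_sum (fun k => D' i (ext (n + 1) k)) s.
Proof.
have [j ->|->] := unliftP ord0 i => DD' h; last first.
  by apply: has_sum_eq h => k; rewrite ext_incr0 DD'.
have hj := has_sum_reindex (subrK (unitf j)) (addrK (unitf j)) h.
apply: has_sum_eq hj => k /=; rewrite DD' -ext_incr_lift.
by rewrite -addrA addNr addr0.
Qed.

(** On the slice the weights [om ^ K j] multiply to the constant [om ^ n], so only the product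
    [la ^+ 2] of the two ratios matters. What remains of coordinate 0 is at most 1 and is
    dropped. *)
Lemma slice_majorant n (om la M : R) : 0 < om -> 0 < la -> la < 1 -> 0 <= M ->
  exists2 g, dominating g & forall G : ('I_r.+1 -> int) -> R[i],
    (forall K, cabs (G K) <= M * \prod_j ipow (om * la) (la / om) (K j)) ->
    forall k, cabs (G (ext n k)) <= g k.
Proof.
move=> om0 la0 la1 M0.
have Mo : 0 <= M * om ^ n by rewrite mulr_ge0// exprz_ge0// ltW.
exists (fun k => M * om ^ n * \prod_i ipow la la (k i)).
  exact: dominating_ipow.
move=> G hG k.
rewrite (le_trans (hG _))// -mulrA ler_wpM2l//.
under eq_bigr do rewrite [la / om]mulrC ipowM -ipow_exprz.
rewrite big_split/=.
have -> : \prod_j om ^ ext n k j = om ^ n.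
  rewrite -[in RHS](sum_ext n k).
  by rewrite -(big_morph _ (fun i j => expfzDr i j (lt0r_neq0 om0)) (expr0z om)).
apply: ler_wpM2l; first by rewrite exprz_ge0// ltW.
rewrite big_ord_recl.
rewrite [X in _ * X <= _](eq_bigr (fun i => ipow la la (k i))) => [|i _]; last first.
  by rewrite ext_lift.
apply: ler_piMl; last by rewrite ipow_le1 ?ltW.
by apply: prodr_ge0 => i _; rewrite ipow_ge0// ltW.
Qed.

End Slices.

(** * One-step recurrences of the shifted factorials *)

Lemma NegzS1 (n : nat) : Negz n.+1 + 1 = Negz n.
Proof. lia. Qed.

Section Rows.
Variables (R : realType) (q : R[i]).
Hypotheses (q0 : q != 0) (q1 : cabs q < 1).
Implicit Types (x y : R[i]) (k : int).

Lemma qpochS y k : (forall n : nat, y != q ^+ n.+1) ->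
  qpoch q y (k + 1) = qpoch q y k * (1 - y * q ^ k).
Proof.
move=> hy; case: k => n; first by rewrite -PoszD addn1 /= qprodS.
have h : 1 - y / q ^+ n.+1 != 0.
  rewrite subr_eq0 eq_sym; apply: contra (hy n) => /eqP yq.
  by rewrite -[y](divfK (expf_neq0 n.+1 q0)) yq mul1r.
case: n h => [|n] h.
  rewrite -[Negz 0 + 1]/(Posz 0)/= qprod0 big_nat1 mulVf//.
rewrite NegzS1.
rewrite /= [in RHS]big_nat_recr//= invfM -mulrA.
by rewrite (_ : y * q ^ Negz n.+1 = y / q ^+ n.+2)// mulVf ?mulr1.
Qed.

(** Stated for the inverse, which at negative [k] is a plain product without poles; only the factors
    at [k >= 0] have to be kept from vanishing. *)
Lemma qpochVS y k : (forall n : nat, y * q ^+ n != 1) ->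
  (qpoch q y k)^-1 = (qpoch q y (k + 1))^-1 * (1 - y * q ^ k).
Proof.
move=> hy; case: k => n.
  rewrite -PoszD addn1 /= qprodS invfM divfK//.
  by rewrite subr_eq0 eq_sym.
case: n => [|n].
  by rewrite -[Negz 0 + 1]/(Posz 0)/= qprod0 big_nat1 invr1 mul1r invrK.
rewrite NegzS1.
by rewrite /= !invrK [in LHS]big_nat_recr.
Qed.

(** This is [(1 - y) (y q)_k = (y)_k (1 - y q^k)]; it lets a factor [1 - b j * u] absorb the change
    of [b j] into [b j * q]. *)
Lemma qpochV_shift y k : (forall n : nat, y * q ^+ n != 1) ->
  (1 - y * q ^ k) * (qpoch q (y * q) k)^-1 = (1 - y) * (qpoch q y k)^-1.
Proof.
move=> hy; case: k => n /=.
  have e : qprod q y n * (1 - y * q ^+ n) = (1 - y) * qprod q (y * q) n.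
    rewrite -qprodS -[n.+1]add1n qprodD expr1; congr (_ * _).
    by rewrite qprodS qprod0 mul1r expr0 mulr1.
  have h1 : qprod q y n != 0.
    by apply/(qprod_eq0P) => -[j _ /eqP]; rewrite (negbTE (hy j)).
  have h2 : qprod q (y * q) n != 0.
    apply/(qprod_eq0P) => -[j _ /eqP]; rewrite -mulrA -exprS.
    by rewrite (negbTE (hy j.+1)).
  by apply/eqP; rewrite eqr_div// mulrC; apply/eqP.
rewrite !invrK; pose f (j : nat) := 1 - y / q ^+ j.
rewrite -[y * q ^ _]/(y / q ^+ n.+1) -/(f n.+1).
have -> : 1 - y = f 0%N by rewrite /f expr0 divr1.
rewrite [RHS](_ : _ = \prod_(0 <= j < n.+2) f j); last by rewrite [RHS]big_nat_recl//.
rewrite [RHS]big_nat_recr//= [LHS]mulrC; congr (_ * _).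
by apply: eq_bigr => j _; rewrite /f exprS invfM mulrA mulfK.
Qed.

End Rows.

(** * The summand *)

(** Each index [j != i] lies in exactly [r.-1] of the pairs avoiding [i]; this counts the degree of
    [vdm_minor i] in each node. *)
Lemma prod_pairs_avoid (R : comPzRingType) (r : nat) (i : 'I_r.+1) (Y : 'I_r.+1 -> R) :
  \prod_(p : 'I_r.+1 * 'I_r.+1 | (p.1 < p.2)%N && ((p.1 != i) && (p.2 != i)))
    (Y p.1 * Y p.2) = \prod_(j | j != i) Y j ^+ r.-1.
Proof.
rewrite big_split/= [X in _ * X](reindex_inj (h := fun p => (p.2, p.1)))/=; last first.
  by move=> [a b] [c d] /= [-> ->].
rewrite [RHS](eq_bigr (fun a => \prod_(b | (b != i) && (b != a)) Y a)); last first.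
  move=> a ai; rewrite prodr_const; congr (_ ^+ _).
  have -> : #|(fun b => (b != i) && (b != a))| = #|[set~ i] :\ a|.
    by apply: eq_card => b; rewrite !inE andbC.
  have := cardsD1 a [set~ i]; rewrite !inE ai cardsC1 card_ord add1n => h.
  by rewrite -[in LHS](congr1 predn (esym h)).
rewrite (pair_big_dep (fun a => a != i) (fun a b => (b != i) && (b != a))
  (fun a b => Y a))/=.
rewrite [RHS](bigID (fun p : 'I_r.+1 * 'I_r.+1 => (p.1 < p.2)%N))/=.
congr (_ * _); apply: eq_bigl => -[a b] /=.
  by rewrite -[b == a](inj_eq val_inj)/=; case: ltngtP; rewrite ?andbF ?andbT.
by rewrite -[b == a](inj_eq val_inj)/=; case: ltngtP; rewrite ?andbF ?andbT//= andbC.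
Qed.

Section Summand.
Variables (R : realType) (r : nat) (q : R[i]).
Hypotheses (q0 : q != 0) (q1 : cabs q < 1).
Implicit Types (a b p x : 'I_r.+1 -> R[i]) (C : R[i]) (K : 'I_r.+1 -> int).

Definition rho a b (y : R[i]) (k : int) : R[i] :=
  \prod_j (qpoch q (a j * y) k / qpoch q (b j * y) k).

Definition node x K (j : 'I_r.+1) : R[i] := x j * q ^ K j.

Definition sterm a b x K : R[i] := vdm (node x K) * \prod_j rho a b (x j) (K j).

Definition cterm a b x C K : R[i] :=
  sterm a b x K * \prod_j (1 - C * node x K j).

(* The summand of [cterm] split along the partial fraction expansion at the
   poles [u = u_i], [u = node x K]. *)
Definition pfterm a b x C p (e : int) i K : R[i] :=
  vdm_minor i (node x K) * \prod_j rho a b (x j) (K j)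
  * \prod_(j | j != i) (1 - C * node x K j)
  * \prod_j (1 - p j * node x K i) * node x K i ^ e.

Definition a_regular a x := forall i j (n : nat), a j * x i != q ^+ n.+1.
Definition b_regular b x := forall i j (n : nat), b j * x i * q ^+ n != 1.

(* The square leaves room for a weight [om ^ (\sum_j K j)], constant on each
   slice, which turns the bound into a decay in both directions; see
   [slice_majorant]. *)
Definition decay a b x := exists la M : R, [/\ 0 < la, la < 1, 0 <= M &
  forall i k, cabs (rho a b (x i) k) <= M * ipow 1 (la ^+ 2 * cabs q ^+ r.+1) k].

Lemma rhoS a b y k : (forall j (n : nat), a j * y != q ^+ n.+1) ->
  (forall j (n : nat), b j * y * q ^+ n != 1) ->
  rho a b y k * \prod_j (1 - a j * (y * q ^ k)) =
  rho a b y (k + 1) * \prod_j (1 - b j * (y * q ^ k)).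
Proof.
move=> ha hb; rewrite /rho -!big_split; apply: eq_bigr => j _ /=.
rewrite (qpochS q0 k (ha j)) (qpochVS k (hb j)) !mulrA.
ring.
Qed.

Lemma node_incr x i j K :
  node x (incr i K) j = if j == i then node x K j * q else node x K j.
Proof.
rewrite /node /incr; case: eqP => _; last by rewrite addr0.
by rewrite expfzDr// expr1z mulrA.
Qed.

(** The minor and the product over [C] omit node [i]. By [rhoS] the shift of row [i] replaces the
    factors with [a j] by those with [b j], which at the new node [q * u i] are the factors with
    [b j / q]; [q ^ (- e)] compensates the power of the node. *)
Lemma pfterm_incr a b x C e i K : a_regular a x -> b_regular b x ->
  pfterm a b x C a e i K =
  q ^ (- e) * pfterm a b x C (fun j => b j / q) e i (incr i K).
Proof.
move=> ha hb; rewrite /pfterm.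
have -> : vdm_minor i (node x (incr i K)) = vdm_minor i (node x K).
  by apply: eq_vdm_minor => j /negbTE ji; rewrite node_incr ji.
have -> : \prod_(j | j != i) (1 - C * node x (incr i K) j) =
    \prod_(j | j != i) (1 - C * node x K j).
  by apply: eq_bigr => j /negbTE ji; rewrite node_incr ji.
rewrite node_incr eqxx.
have -> : \prod_j (1 - b j / q * (node x K i * q)) =
    \prod_j (1 - b j * node x K i).
  by apply: eq_bigr => j _; congr (1 - _); rewrite mulrCA mulrC divfK// mulrC.
rewrite [(node x K i * q) ^ e]expfzMl.
have qe : q ^ (- e) * q ^ e = 1 by rewrite -expfzDr// addNr expr0z.
have e1 : \prod_j rho a b (x j) (K j) * \prod_j (1 - a j * node x K i) =
    \prod_j rho a b (x j) (incr i K j) * \prod_j (1 - b j * node x K i).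
  rewrite (bigD1 (F := fun j => rho a b (x j) (K j)) i)//=.
  rewrite (bigD1 (F := fun j => rho a b (x j) (incr i K j)) i)//=.
  have -> : incr i K i = K i + 1 by rewrite /incr eqxx.
  have -> : \prod_(j | j != i) rho a b (x j) (incr i K j) =
      \prod_(j | j != i) rho a b (x j) (K j).
    by apply: eq_bigr => j /negbTE ji; rewrite /incr ji addr0.
  have := @rhoS a b (x i) (K i) (ha i) (hb i); rewrite -/(node x K i) => h.
  by rewrite mulrAC h; ring.
transitivity (vdm_minor i (node x K) * (\prod_j rho a b (x j) (K j) *
  \prod_j (1 - a j * node x K i)) * \prod_(j | j != i) (1 - C * node x K j)
  * node x K i ^ e * (q ^ (- e) * q ^ e)); first by rewrite qe; ring.
by rewrite e1; ring.
Qed.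

(** The condition under which the nodes are nonzero and distinct at every lattice point, as the
    partial fractions require. *)
Definition generic x :=
  (forall i, x i != 0) /\ forall i j (k : int), i != j -> x i != x j * q ^ k.

Lemma node_neq0 x K i : generic x -> node x K i != 0.
Proof. by case=> h _; rewrite mulf_neq0// expfz_neq0. Qed.

Lemma node_inj x K : generic x -> injective (node x K).
Proof.
move=> [_ h] i j; rewrite /node => e; apply/eqP; apply: contraT => ij.
have /negP[] := h i j (K j - K i) ij.
by rewrite expfzDr// mulrA -e -mulrA -expfzDr// subrr expr0z mulr1.
Qed.

Lemma prod_node x K : \prod_j node x K j = (\prod_j x j) * q ^ (\sum_j K j).
Proof.
rewrite /node big_split/=; congr (_ * _).
by rewrite -(big_morph _ (fun i j => expfzDr i j q0) (expr0z q)).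
Qed.

(** By [prod_node] the coefficient of [cterm] is constant on each slice, so that summation over a
    slice yields a linear relation between its two sums. *)
Lemma sum_pfterm a b x C p K : generic x ->
  \sum_i pfterm a b x C p (-1) i K =
  \prod_j (C - p j) * sterm a b x K
  - (-1) ^+ r.+1 / \prod_j node x K j * cterm a b x C K.
Proof.
move=> hx; have ui := @node_inj _ K hx; have u0 i := @node_neq0 _ K i hx.
rewrite /cterm; set u := node x K in ui u0 *; pose P := \prod_j rho a b (x j) (K j).
transitivity (vdm u * P * \sum_i (\prod_(j | j != i) ((1 - C * u j) / (u i - u j))
          * \prod_j (1 - p j * u i) / u i)).
  rewrite mulr_sumr; apply: eq_bigr => i _.
  rewrite /pfterm -/u -/P (vdm_minorE i) big_split/= prodfV.
  have h : \prod_(j | j != i) (u i - u j) != 0.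
    by apply/prodf_neq0 => j ji; rewrite subr_eq0 (inj_eq ui) eq_sym.
  rewrite -[u i ^ (-1)]/((u i)^-1); field; by rewrite u0 h.
rewrite partial_fraction// /sterm -/u -/P; ring.
Qed.

Lemma sum_pfterm0 a b x C p K : generic x ->
  C * \sum_i pfterm a b x C p 0 i K =
  \prod_j (C - p j) * sterm a b x K
  - (-1) ^+ r.+1 * \prod_j p j * cterm a b x C K.
Proof.
move=> hx; have ui := @node_inj _ K hx; have u0 i := @node_neq0 _ K i hx.
rewrite /cterm; set u := node x K in ui u0 *; pose P := \prod_j rho a b (x j) (K j).
transitivity (vdm u * P * (C * \sum_i (\prod_(j | j != i) ((1 - C * u j) / (u i - u j))
          * \prod_j (1 - p j * u i)))).
  rewrite [RHS]mulrCA; congr (_ * _); rewrite mulr_sumr; apply: eq_bigr => i _.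
  rewrite /pfterm -/u -/P (vdm_minorE i) big_split/= prodfV.
  have h : \prod_(j | j != i) (u i - u j) != 0.
    by apply/prodf_neq0 => j ji; rewrite subr_eq0 (inj_eq ui) eq_sym.
  rewrite expr0z; field; by rewrite h.
rewrite partial_fraction1// /sterm -/u -/P; ring.
Qed.

End Summand.

(** * Bounds and summability of the terms on a slice *)

Section Majorants.
Variables (R : realType) (r : nat) (q : R[i]).
Hypotheses (q0 : q != 0) (q1 : cabs q < 1).
Implicit Types (a b p x u : 'I_r.+1 -> R[i]) (C : R[i]) (K : 'I_r.+1 -> int).

Let Q := cabs q.
Let Q0 : 0 < Q. Proof. by rewrite cabs_gt0. Qed.
Let Q1 : Q <= 1. Proof. exact: ltW. Qed.
Let QV1 : 1 <= Q^-1. Proof. by rewrite invf_ge1. Qed.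

Lemma cabs_vdm_minor u (Y : 'I_r.+1 -> R) i : (forall j, 0 <= Y j) ->
  (forall j l, cabs (u j - u l) <= Y j * Y l) ->
  cabs (vdm_minor i u) <= \prod_(j | j != i) Y j ^+ r.-1.
Proof.
move=> Y0 hY; rewrite /vdm_minor cabsM cabs_prod big1 ?mul1r; last first.
  by move=> j _; rewrite cabsN cabs1.
rewrite cabs_prod -prod_pairs_avoid; apply: ler_prod => -[j l] _ /=.
by rewrite cabs_ge0 hY.
Qed.

(** The factor 2 keeps the bound at least 2 and twice the modulus of the node. A sum of two halves
    is then at most a product, so each difference of nodes is bounded by a product of one-coordinate
    factors. *)
Definition node_bound x j k : R := 2 * (1 + cabs (x j)) * ipow 1 Q^-1 k.

Lemma ipow1_ge1 (be : R) k : 1 <= be -> 1 <= ipow 1 be k.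
Proof. by move=> h; case: k => n; rewrite /= ?expr1n// exprn_ege1. Qed.

Lemma node_bound_ge2 x j k : 2 <= node_bound x j k.
Proof.
have h := cabs_ge0 (x j); have := ipow1_ge1 k QV1; rewrite /node_bound.
set w := ipow _ _ _ => w1.
by rewrite -[leLHS]mulr1 -[leLHS]mulr1 ler_pM// ?mulr_ge0// ler_wpM2l// lerDl.
Qed.

Lemma node_bound_ge0 x j k : 0 <= node_bound x j k.
Proof. by rewrite (le_trans _ (node_bound_ge2 x j k)). Qed.

Lemma cabs_node x K j : cabs (node q x K j) <= node_bound x j (K j) / 2.
Proof.
have h := cabs_ge0 (x j).
rewrite /node cabsM cabsXz -/Q ipow_exprz /node_bound.
have e1 : ipow Q Q^-1 (K j) <= ipow 1 Q^-1 (K j).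
  by apply: ipow_le; rewrite ?invr_ge0 ?(ltW Q0).
have e2 : 0 <= ipow Q Q^-1 (K j) by rewrite ipow_ge0 ?invr_ge0 ?ltW.
rewrite (_ : 2 * _ * _ / 2 = (1 + cabs (x j)) * ipow 1 Q^-1 (K j)); last by field.
by apply: ler_pM => //; rewrite lerDr.
Qed.

Lemma cabs_node_sub x K j l : cabs (node q x K j - node q x K l) <=
  node_bound x j (K j) * node_bound x l (K l).
Proof.
rewrite (le_trans (cabsB _ _))// (le_trans (lerD (cabs_node _ _ _) (cabs_node _ _ _)))//.
have := node_bound_ge2 x j (K j); have := node_bound_ge2 x l (K l).
by move: (node_bound x j _) (node_bound x l _) => s t; nra.
Qed.

Lemma cabs_1sub_node x K C j :
  cabs (1 - C * node q x K j) <= (1 + cabs C) * node_bound x j (K j).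
Proof.
rewrite (le_trans (cabsB _ _))// cabs1 cabsM.
have := cabs_node x K j; have := node_bound_ge2 x j (K j); have := cabs_ge0 C.
have := cabs_ge0 (node q x K j).
by move: (node_bound _ _ _) (cabs (node _ _ _ _)) (cabs C) => s t v; nra.
Qed.

Lemma node_boundX x j n : exists2 c : R, 0 <= c &
  forall k, node_bound x j k ^+ n = c * ipow 1 (Q^-1 ^+ n) k.
Proof.
exists ((2 * (1 + cabs (x j))) ^+ n).
  by rewrite exprn_ge0// mulr_ge0// addr_ge0// cabs_ge0.
by move=> k; rewrite exprMn -ipowX expr1n.
Qed.

Lemma prod_majorant (B : 'I_r.+1 -> int -> R) n (om la : R) :
  0 < om -> 0 < la -> la < 1 -> (forall j k, 0 <= B j k) ->
  (forall j, exists2 c : R, 0 <= c &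
     forall k, B j k <= c * ipow (om * la) (la / om) k) ->
  exists2 g, dominating g & forall G : ('I_r.+1 -> int) -> R[i],
    (forall K, cabs (G K) <= \prod_j B j (K j)) ->
    forall k, cabs (G (ext n k)) <= g k.
Proof.
move=> om0 la0 la1 B0 hB.
have /choice[c hc] : forall j, exists c : R, 0 <= c /\
    forall k, B j k <= c * ipow (om * la) (la / om) k.
  by move=> j; have [c c0 hc] := hB j; exists c.
have c0 : 0 <= \prod_j c j by apply: prodr_ge0 => j _; case: (hc j).
have [g dg hg] := slice_majorant r n om0 la0 la1 c0.
exists g => // G hG; apply: hg => K.
rewrite -big_split (le_trans (hG K))//; apply: ler_prod => j _ /=.
by rewrite B0 /=; case: (hc j) => _ ->.
Qed.

(** Downwards, each power of the node bound costs [Q^-1] per step, against the [la ^+ 2 * Q ^+ r.+1]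
    supplied by the row. *)
Lemma node_rho_bound a b x (la M : R) n j : 0 <= M -> (n <= r.+1)%N ->
  (forall i k, cabs (rho q a b (x i) k) <= M * ipow 1 (la ^+ 2 * Q ^+ r.+1) k) ->
  exists2 c : R, 0 <= c & forall k,
    node_bound x j k ^+ n * cabs (rho q a b (x j) k) <=
    c * ipow 1 (la ^+ 2 * Q ^+ (r.+1 - n)) k.
Proof.
move=> M0 nr hM; have [c c0 hc] := node_boundX x j n.
exists (c * M) => [|k]; first by rewrite mulr_ge0.
rewrite hc.
have -> : c * M * ipow 1 (la ^+ 2 * Q ^+ (r.+1 - n)) k =
    c * ipow 1 (Q^-1 ^+ n) k * (M * ipow 1 (la ^+ 2 * Q ^+ r.+1) k).
  rewrite mulrACA -ipowM mulr1; congr (_ * ipow _ _ _).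
  by rewrite -[in RHS](subnK nr) exprD exprVn; field; rewrite expf_neq0// gt_eqF.
by apply: ler_wpM2l; rewrite ?hM// mulr_ge0// ipow_ge0// exprn_ge0// invr_ge0 ltW.
Qed.

Lemma cabs_node_exprz x j (e : int) k : (e = -1) \/ (e = 0) ->
  cabs ((x j * q ^ k) ^ e) = cabs (x j ^ e) * ipow (Q ^ e) (Q ^ (- e)) k.
Proof.
case=> ->; last first.
  by rewrite oppr0 !expr0z cabs1 mul1r; case: k => n; rewrite /= expr1n.
rewrite opprK expr1z -[_ ^ (-1)]/(_^-1) -[x j ^ (-1)]/(x j)^-1 -[Q ^ (-1)]/Q^-1.
rewrite !cabsV cabsM cabsXz invfM -/Q; congr (_ * _).
by case: k => n; rewrite /= ?invrK ?exprVn.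
Qed.

(** Degree count: node [i] occurs in the [r.+1] factors [1 - p l * u i]; any other node occurs
    [r.-1] times in the minor and once in the product over [C], hence [r] times. *)
Lemma cabs_pfterm_le a b x C p (e : int) i K : (0 < r)%N ->
  cabs (pfterm q a b x C p e i K) <=
  ((\prod_l (1 + cabs (p l))) * (node_bound x i (K i) ^+ r.+1
     * cabs (rho q a b (x i) (K i))) * cabs (node q x K i ^ e))
  * \prod_(j | j != i) ((1 + cabs C) * (node_bound x j (K j) ^+ r
     * cabs (rho q a b (x j) (K j)))).
Proof.
move=> r0; pose Y j := node_bound x j (K j).
have YE j : Y j ^+ r = Y j * Y j ^+ r.-1 by rewrite -exprS prednK.
have Y0 j : 0 <= Y j by exact: node_bound_ge0.
have h1 := cabs_vdm_minor i Y0 (cabs_node_sub x K).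
have h2 : \prod_(j | j != i) cabs (1 - C * node q x K j) <=
    \prod_(j | j != i) ((1 + cabs C) * Y j).
  by apply: ler_prod => j _; rewrite cabs_ge0 cabs_1sub_node.
have h3 : \prod_l cabs (1 - p l * node q x K i) <=
    (\prod_l (1 + cabs (p l))) * Y i ^+ r.+1.
  have -> : Y i ^+ r.+1 = \prod_(l < r.+1) Y i by rewrite prodr_const card_ord.
  rewrite -big_split; apply: ler_prod => l _.
  by rewrite cabs_ge0 cabs_1sub_node.
have -> : \prod_(j | j != i) ((1 + cabs C) * (Y j ^+ r * cabs (rho q a b (x j) (K j)))) =
    \prod_(j | j != i) Y j ^+ r.-1 * \prod_(j | j != i) cabs (rho q a b (x j) (K j))
    * \prod_(j | j != i) ((1 + cabs C) * Y j).
  rewrite -!big_split; apply: eq_bigr => j _ /=.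
  by rewrite -/(Y j) YE; ring.
have -> : cabs (pfterm q a b x C p e i K) = cabs (vdm_minor i (node q x K))
    * (cabs (rho q a b (x i) (K i)) * \prod_(j | j != i) cabs (rho q a b (x j) (K j)))
    * \prod_(j | j != i) cabs (1 - C * node q x K j)
    * \prod_l cabs (1 - p l * node q x K i) * cabs (node q x K i ^ e).
  have -> : cabs (rho q a b (x i) (K i)) * \prod_(j | j != i) cabs (rho q a b (x j) (K j))
      = \prod_j cabs (rho q a b (x j) (K j)) by rewrite [RHS](bigD1 i).
  by rewrite -3!cabs_prod -4!cabsM.
set A1 := cabs (vdm_minor _ _) in h1 *; set A2 := \prod_(j | j != i) cabs (1 - C * node q x K j) in h2 *.
set A3 := \prod_l cabs (1 - p l * node q x K i) in h3 *.
set r1 := cabs (rho q a b (x i) (K i)).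
set r2 := \prod_(j | j != i) cabs (rho q a b (x j) (K j)).
set N := cabs (node _ _ _ _ ^ _).
set B1 := \prod_(j | _) (Y j ^+ _) in h1 *; set B2 := \prod_(j | _) (_ * Y j) in h2 *.
rewrite -/(Y i).
rewrite [leRHS](_ : _ = B1 * (r1 * r2) * B2 * ((\prod_l (1 + cabs (p l))) * Y i ^+ r.+1) * N); last by ring.
have r10 : 0 <= r1 by exact: cabs_ge0.
have r20 : 0 <= r2 by apply: prodr_ge0 => j _; exact: cabs_ge0.
have A10 : 0 <= A1 by exact: cabs_ge0.
have A20 : 0 <= A2 by apply: prodr_ge0 => j _; exact: cabs_ge0.
have A30 : 0 <= A3 by apply: prodr_ge0 => j _; exact: cabs_ge0.
apply: ler_wpM2r; first exact: cabs_ge0.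
apply: ler_pM => //; first by rewrite !mulr_ge0.
apply: ler_pM => //; first by rewrite !mulr_ge0.
by apply: ler_wpM2r => //; rewrite mulr_ge0.
Qed.

Lemma summable_pfterm a b x C p (e : int) i n : (0 < r)%N -> (forall j, x j != 0) ->
  decay q a b x -> (e = -1) \/ (e = 0) ->
  exists s, has_sum (fun k => pfterm q a b x C p e i (ext n k)) s.
Proof.
move=> r0 x0 [la [M [la0 la1 M0 hM]]] he.
pose B j k : R := if j == i then
    (\prod_l (1 + cabs (p l))) * (node_bound x i k ^+ r.+1
     * cabs (rho q a b (x i) k)) * cabs ((x i * q ^ k) ^ e)
  else (1 + cabs C) * (node_bound x j k ^+ r * cabs (rho q a b (x j) k)).
have p0 : 0 <= \prod_l (1 + cabs (p l)).
  by apply: prodr_ge0 => l _; rewrite addr_ge0// cabs_ge0.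
have C0 : 0 <= 1 + cabs C by rewrite addr_ge0// cabs_ge0.
(* The power [e] of node [i] gives its row the ratios [Q ^ e] upwards and [la ^+ 2 * Q ^ (- e)]
   downwards; this [om] matches them. The other rows, of ratios 1 and [la ^+ 2 * Q], fit under them
   for both values of [e]: the spare [Q] pays for the division by the node. *)
have om0 : 0 < la^-1 * Q ^ e by rewrite mulr_gt0 ?invr_gt0// exprz_gt0.
have lQ : 0 <= la ^+ 2 * Q by rewrite mulr_ge0 ?exprn_ge0 ?ltW.
have omE : la^-1 * Q ^ e * la = Q ^ e by rewrite mulrAC mulVf ?mul1r ?gt_eqF.
have QeV : (Q ^ e)^-1 = Q ^ (- e) by rewrite invr_expz.
have laE : la / (la^-1 * Q ^ e) = la ^+ 2 * Q ^ (- e).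
  by rewrite invfM invrK QeV; ring.
suff /(prod_majorant n om0 la0 la1)[|g dg hg] : forall j, exists2 c : R, 0 <= c &
    forall k, B j k <= c * ipow (la^-1 * Q ^ e * la) (la / (la^-1 * Q ^ e)) k.
- move=> j k; rewrite /B; case: eqP => _; rewrite !mulr_ge0 ?exprn_ge0 ?cabs_ge0//;
    exact: node_bound_ge0.
- apply: (dominated_has_sum dg); apply: hg => K.
  rewrite (le_trans (cabs_pfterm_le a b x C p e i K r0))//.
  rewrite [leRHS](bigD1 i)//= /B eqxx le_eqVlt; apply/orP; left; apply/eqP.
  by congr (_ * _); apply: eq_bigr => j /negbTE ->.
move=> j; rewrite omE laE /B; case: eqP => [_|_].
  have [c c0 hc] := node_rho_bound i M0 (leqnn r.+1) hM.
  exists ((\prod_l (1 + cabs (p l))) * c * cabs (x i ^ e)).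
    by rewrite !mulr_ge0// cabs_ge0.
  move=> k; rewrite cabs_node_exprz//.
  have := hc k; rewrite subnn expr0 mulr1 => hk.
  rewrite [leRHS](_ : _ = (\prod_l (1 + cabs (p l))) * (c * ipow 1 (la ^+ 2) k)
     * (cabs (x i ^ e) * ipow (Q ^ e) (Q ^ (- e)) k)); last first.
    rewrite -{1}[Q ^ e]mul1r ipowM; ring.
  apply: ler_wpM2r; last by apply: ler_wpM2l.
  by rewrite mulr_ge0 ?cabs_ge0// ipow_ge0// exprz_ge0// ltW.
have [c c0 hc] := node_rho_bound j M0 (leqnSn r) hM.
exists ((1 + cabs C) * c); first by rewrite mulr_ge0.
move=> k; rewrite -mulrA; apply: ler_wpM2l => //.
rewrite (le_trans (hc k))// subSnn expr1; apply: ler_wpM2l => //.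
by case: he => ->; apply: ipow_le => //; rewrite ?oppr0 ?opprK ?expr0z ?expr1z//
  ?mulr1 ?ler_piMr ?exprn_ge0 ?ltW.
Qed.

(** The majorant is chosen before [b], so that one function dominates the whole sequence of rescaled
    parameters in the later passage to the limit. *)
Lemma cterm_majorant a x C n (la M : R) : (0 < r)%N ->
  0 < la -> la < 1 -> 0 <= M ->
  exists2 g, dominating g & forall b,
    (forall i k, cabs (rho q a b (x i) k) <= M * ipow 1 (la ^+ 2 * Q ^+ r.+1) k) ->
    forall k, cabs (cterm q a b x C (ext n k)) <= g k.
Proof.
move=> r0 la0 la1 M0.
have w0 k : 0 <= M * ipow 1 (la ^+ 2 * Q ^+ r.+1) k.
  by rewrite mulr_ge0// ipow_ge0// mulr_ge0// exprn_ge0// ltW.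
pose B j k : R := (1 + cabs C) * (node_bound x j k ^+ r.+1
  * (M * ipow 1 (la ^+ 2 * Q ^+ r.+1) k)).
have C0 : 0 <= 1 + cabs C by rewrite addr_ge0// cabs_ge0.
have la0' : 0 < la^-1 by rewrite invr_gt0.
have [||g dg hg] := @prod_majorant B n la^-1 la la0' la0 la1.
- move=> j k; rewrite /B mulr_ge0// mulr_ge0// exprn_ge0//; exact: node_bound_ge0.
- move=> j; have [c c0 hc] := node_boundX x j r.+1.
  exists ((1 + cabs C) * (c * M)); first by rewrite !mulr_ge0.
  move=> k; rewrite /B hc mulVf ?gt_eqF// invrK -expr2.
  have -> : ipow 1 (la ^+ 2) k = ipow 1 (Q^-1 ^+ r.+1) k * ipow 1 (la ^+ 2 * Q ^+ r.+1) k.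
    rewrite -ipowM mulr1; congr ipow.
    by rewrite exprVn; field; rewrite gt_eqF ?exprn_gt0// gt_eqF.
  by rewrite le_eqVlt; apply/orP; left; apply/eqP; ring.
exists g => // b hb; apply: hg => K; pose Y j := node_bound x j (K j).
have YE j : Y j ^+ r = Y j * Y j ^+ r.-1 by rewrite -exprS prednK.
have Y0 j : 0 <= Y j by exact: node_bound_ge0.
have h1 := cabs_vdm_minor ord0 Y0 (cabs_node_sub x K).
have h2 : \prod_(j | j != ord0) cabs (node q x K ord0 - node q x K j) <=
    \prod_(j | j != ord0) (Y ord0 * Y j).
  by apply: ler_prod => j _; rewrite cabs_ge0 cabs_node_sub.
have h3 : \prod_j cabs (1 - C * node q x K j) <= \prod_j ((1 + cabs C) * Y j).
  by apply: ler_prod => j _; rewrite cabs_ge0 cabs_1sub_node.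
have h4 : \prod_j cabs (rho q a b (x j) (K j)) <=
    \prod_j (M * ipow 1 (la ^+ 2 * Q ^+ r.+1) (K j)).
  by apply: ler_prod => j _; rewrite cabs_ge0 hb.
have h12 : cabs (vdm (node q x K)) <= \prod_j Y j ^+ r.
  rewrite (vdm_minorE ord0) cabsM cabs_prod.
  apply: le_trans (ler_pM _ _ h1 h2) _; rewrite ?cabs_ge0//.
    by apply: prodr_ge0 => j _; exact: cabs_ge0.
  rewrite [leRHS](bigD1 ord0)//= -big_split/= le_eqVlt; apply/orP; left; apply/eqP.
  have -> : Y ord0 ^+ r = \prod_(j : 'I_r.+1 | j != ord0) Y ord0.
    by rewrite prodr_const cardC1 card_ord.
  rewrite -big_split; apply: eq_bigr => j _ /=.
  by rewrite YE; ring.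
have -> : cabs (cterm q a b x C K) = cabs (vdm (node q x K))
    * (\prod_j cabs (rho q a b (x j) (K j))) * \prod_j cabs (1 - C * node q x K j).
  by rewrite -2!cabs_prod -2!cabsM.
have -> : \prod_j B j (K j) = (\prod_j Y j ^+ r)
    * (\prod_j (M * ipow 1 (la ^+ 2 * Q ^+ r.+1) (K j)))
    * \prod_j ((1 + cabs C) * Y j).
  by rewrite -!big_split; apply: eq_bigr => j _; rewrite /B -/(Y j) exprS/=; ring.
have p0 (f : 'I_r.+1 -> R[i]) : 0 <= \prod_j cabs (f j).
  by apply: prodr_ge0 => j _; exact: cabs_ge0.
by apply: ler_pM => //; [rewrite mulr_ge0 ?cabs_ge0|apply: ler_pM; rewrite ?cabs_ge0].
Qed.

Lemma summable_cterm a b x C n : (0 < r)%N ->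
  decay q a b x -> exists s, has_sum (fun k => cterm q a b x C (ext n k)) s.
Proof.
move=> r0 [la [M [la0 la1 M0 hM]]].
have [g dg hg] := cterm_majorant a x C n r0 la0 la1 M0.
exact: dominated_has_sum dg (hg b hM).
Qed.

End Majorants.

(** * Contiguous relations *)

Section Contiguity.
Variables (R : realType) (r : nat) (q : R[i]) (a x : 'I_r.+1 -> R[i]).
Hypotheses (q0 : q != 0) (q1 : cabs q < 1) (r0 : (0 < r)%N).
Hypotheses (gx : generic q x) (ax : a_regular q a x) (a0 : forall j, a j != 0).
Implicit Types (b : 'I_r.+1 -> R[i]) (C : R[i]).

Let A := \prod_j a j.
Let X := \prod_j x j.
Let sg : R[i] := (-1) ^+ r.+1.

Let A0 : A != 0. Proof. exact/prodf_neq0. Qed.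
Let X0 : X != 0. Proof. by apply/prodf_neq0 => j _; case: gx. Qed.

(** The i-th expansion term is shifted in coordinate [i]. As the shift differs from term to term,
    the terms are summed separately and added afterwards. *)
Lemma pf_telescope b C (e : int) : b_regular q b x -> decay q a b x ->
  (e = -1) \/ (e = 0) ->
  exists S, has_sum (fun k => \sum_i pfterm q a b x C a e i (ext 0 k)) S /\
    has_sum (fun k => q ^ (- e) *
       \sum_i pfterm q a b x C (fun j => b j / q) e i (ext 1 k)) S.
Proof.
move=> bx dec he.
have /choice[s hs] : forall i, exists s,
    has_sum (fun k => pfterm q a b x C a e i (ext 0 k)) s.
  by move=> i; apply: summable_pfterm => // j; case: gx.
exists (\sum_i s i); split; first exact: has_sum_sum.
have h i : has_sum (fun k => q ^ (- e) *
    pfterm q a b x C (fun j => b j / q) e i (ext (0 + 1) k)) (s i).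
  pose D' i K := q ^ (- e) * pfterm q a b x C (fun j => b j / q) e i K.
  have DD' K : pfterm q a b x C a e i K = D' i (incr i K) by exact: pfterm_incr.
  have T := @slice_telescope _ _ (pfterm q a b x C a e) D' 0 i (s i) DD' (hs i).
  exact: T.
apply: has_sum_eq (has_sum_sum h) => k.
by rewrite add0r mulr_sumr.
Qed.

(** The expansion with [e = -1]. On slice 1 the factor [q] of the shift cancels against
    [\prod_j node q x K j = X * q], so [W0] and [W1] carry the same coefficient. *)
Lemma contiguity_inv b C F0 F1 W0 W1 : b_regular q b x -> decay q a b x ->
  has_sum (fun k => sterm q a b x (ext 0 k)) F0 ->
  has_sum (fun k => sterm q a b x (ext 1 k)) F1 ->
  has_sum (fun k => cterm q a b x C (ext 0 k)) W0 ->
  has_sum (fun k => cterm q a b x C (ext 1 k)) W1 ->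
  \prod_j (C - a j) * F0 - sg / X * W0 =
  q * (\prod_j (C - b j / q) * F1) - sg / X * W1.
Proof.
move=> bx dec hF0 hF1 hW0 hW1.
have [S [h1 h2]] := pf_telescope C bx dec (or_introl (erefl (-1))).
have e1 : S = \prod_j (C - a j) * F0 - sg / X * W0.
  have h := has_sumD (has_sumZ (\prod_j (C - a j)) hF0) (has_sumZ (- (sg / X)) hW0).
  rewrite -mulNr; apply: has_sum_unique h1 (has_sum_eq _ h) => k.
  by rewrite sum_pfterm// prod_node// sum_ext expr0z mulr1 mulNr.
rewrite -e1.
have h := has_sumD (has_sumZ (q * \prod_j (C - b j / q)) hF1) (has_sumZ (- (sg / X)) hW1).
rewrite mulrA -mulNr; apply: has_sum_unique h2 (has_sum_eq _ h) => k.
rewrite sum_pfterm// prod_node// sum_ext opprK !expr1z -/sg -/X.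
by field; rewrite X0 q0.
Qed.

Lemma contiguity0 b C F0 F1 W0 W1 : b_regular q b x -> decay q a b x ->
  has_sum (fun k => sterm q a b x (ext 0 k)) F0 ->
  has_sum (fun k => sterm q a b x (ext 1 k)) F1 ->
  has_sum (fun k => cterm q a b x C (ext 0 k)) W0 ->
  has_sum (fun k => cterm q a b x C (ext 1 k)) W1 ->
  \prod_j (C - a j) * F0 - sg * A * W0 =
  \prod_j (C - b j / q) * F1 - sg * \prod_j (b j / q) * W1.
Proof.
move=> bx dec hF0 hF1 hW0 hW1.
have [S [h1 h2]] := pf_telescope C bx dec (or_intror (erefl 0)).
have e1 : C * S = \prod_j (C - a j) * F0 - sg * A * W0.
  have h := has_sumD (has_sumZ (\prod_j (C - a j)) hF0) (has_sumZ (- (sg * A)) hW0).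
  rewrite -mulNr; apply: has_sum_unique (has_sumZ C h1) (has_sum_eq _ h) => k.
  by rewrite sum_pfterm0// mulNr.
rewrite -e1.
have h := has_sumD (has_sumZ (\prod_j (C - b j / q)) hF1)
  (has_sumZ (- (sg * \prod_j (b j / q))) hW1).
rewrite -mulNr; apply: has_sum_unique (has_sumZ C h2) (has_sum_eq _ h) => k.
by rewrite oppr0 expr0z mul1r sum_pfterm0// mulNr.
Qed.

Lemma cterm0 b K : cterm q a b x 0 K = sterm q a b x K.
Proof. by rewrite /cterm big1 ?mulr1// => j _; rewrite mul0r subr0. Qed.

Lemma summable_sterm b n : decay q a b x ->
  exists s, has_sum (fun k => sterm q a b x (ext n k)) s.
Proof.
move=> dec; have [s hs] := summable_cterm q0 q1 0 n r0 dec.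
by exists s; apply: has_sum_eq hs => k; rewrite cterm0.
Qed.

(* Three linear relations between the sums of [sterm] and [cterm] over the
   slices 0 and 1; eliminating the two sums over the slice 1 leaves this. *)
Lemma cterm_sum b C F W : b_regular q b x -> decay q a b x ->
  has_sum (fun k => sterm q a b x (ext 0 k)) F ->
  has_sum (fun k => cterm q a b x C (ext 0 k)) W ->
  W * (sg * (A - \prod_j (b j / q))) =
  F * ((1 - \prod_j (b j / q) * X) * \prod_j (C - a j)
       - (1 - A * X) * \prod_j (C - b j / q)).
Proof.
move=> bx dec hF hW.
have [F1 hF1] := summable_sterm 1 dec.
have [W1 hW1] := summable_cterm q0 q1 C 1 r0 dec.
have E1 := contiguity_inv bx dec hF hF1 hW hW1.
have E2 := contiguity0 bx dec hF hF1 hW hW1.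
have cF0 : has_sum (fun k => cterm q a b x 0 (ext 0 k)) F.
  by apply: has_sum_eq hF => k; rewrite cterm0.
have cF1 : has_sum (fun k => cterm q a b x 0 (ext 1 k)) F1.
  by apply: has_sum_eq hF1 => k; rewrite cterm0.
(* The third relation: at [C = 0] the sums of [cterm] are those of [sterm], which leaves a relation
   between [F] and [F1] alone. *)
have := contiguity_inv bx dec hF hF1 cF0 cF1.
have p0 (c : 'I_r.+1 -> R[i]) : \prod_j (0 - c j) = sg * \prod_j c j.
  by under eq_bigr do rewrite sub0r; rewrite prodrN card_ord.
rewrite !p0 -/A; move: E1 E2.
set be := \prod_j (b j / q); set Pa := \prod_j (C - a j).
set Pb := \prod_j (C - b j / q) => E1 E2 E3.
have sg2 : sg * sg = 1 by rewrite -expr2 sqrr_sign.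
have sg0 : sg != 0 by rewrite signr_eq0.
(* Left unsolved for [F1]: after the elimination of [W1], [F1] occurs only multiplied by
   [1 - q * be * X]. *)
have E4 : F * (1 - A * X) = F1 * (1 - q * be * X).
  have := congr1 (fun t => - (sg * X) * t) E3.
  rewrite (_ : - (sg * X) * _ = F * (1 - A * X) * (sg * sg)); last by field.
  rewrite (_ : - (sg * X) * _ = F1 * (1 - q * be * X) * (sg * sg)); last by field.
  by rewrite sg2 !mulr1.
have E5 : W1 = W + sg * X * (q * (Pb * F1) - Pa * F).
  have := congr1 (fun t => - (sg * X) * t) E1.
  rewrite (_ : - (sg * X) * _ = sg * sg * W - sg * X * Pa * F); last by field.
  rewrite (_ : - (sg * X) * _ = sg * sg * W1 - sg * X * (q * (Pb * F1))); last by field.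
  rewrite sg2 !mul1r => E.
  transitivity ((W1 - sg * X * (q * (Pb * F1))) + sg * X * (q * (Pb * F1))).
    by rewrite subrK.
  by rewrite -E; ring.
have E6 : sg * (A - be) * W = Pa * F - Pb * F1 + sg * be * (W1 - W).
  have -> : Pb * F1 = Pa * F - sg * A * W + sg * be * W1 by rewrite E2; ring.
  by ring.
have -> : W * (sg * (A - be)) = sg * (A - be) * W by ring.
rewrite E6 E5.
have -> : Pa * F - Pb * F1 + sg * be * (W + sg * X * (q * (Pb * F1) - Pa * F) - W)
  = Pa * F - Pb * F1 + sg * sg * (be * X * (q * (Pb * F1) - Pa * F)) by ring.
rewrite sg2 mul1r.
have -> : Pa * F - Pb * F1 + be * X * (q * (Pb * F1) - Pa * F)
  = F * ((1 - be * X) * Pa) - F1 * (1 - q * be * X) * Pb by ring.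
by rewrite -E4; ring.
Qed.

Definition scale_at (j0 : 'I_r.+1) b (t : R[i]) : 'I_r.+1 -> R[i] :=
  fun j => if j == j0 then b j * t else b j.

Lemma scale_at_regular j0 b n : b_regular q b x ->
  b_regular q (scale_at j0 b (q ^+ n)) x.
Proof.
move=> bx i j l; rewrite /scale_at; case: (j == j0); last exact: bx i j l.
have -> : b j * q ^+ n * x i * q ^+ l = b j * x i * q ^+ (n + l).
  by rewrite exprD; ring.
exact: bx i j (n + l)%N.
Qed.

Lemma prod_scale_at j0 b t : \prod_j scale_at j0 b t j = t * \prod_j b j.
Proof.
rewrite (bigD1 j0)//= [in RHS](bigD1 j0)//= /scale_at eqxx mulrA [t * _]mulrC.
by congr (_ * _); apply: eq_bigr => j /negbTE ->.
Qed.

Lemma cterm_scale_at j0 b K : b_regular q b x ->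
  cterm q a (scale_at j0 b q) x (b j0) K =
  \prod_i (1 - b j0 * x i) * sterm q a b x K.
Proof.
move=> bx; rewrite /cterm /sterm -mulrA [RHS]mulrCA; congr (_ * _).
rewrite mulrC -!big_split; apply: eq_bigr => i _ /=.
rewrite /rho (bigD1 j0)//= [in RHS](bigD1 j0)//= /scale_at eqxx.
rewrite [X in _ * (_ * X)](eq_bigr (fun j =>
  qpoch q (a j * x i) (K i) / qpoch q (b j * x i) (K i))); last first.
  by move=> j /negbTE ->.
set P := \prod_(j | j != j0) _; rewrite /node !mulrA; congr (_ * _).
have h := @qpochV_shift _ q q0 (b j0 * x i) (K i) (bx i j0).
rewrite [b j0 * q * x i]mulrAC -[b j0 * x i * q ^ K i]/(_) mulrAC h.
by rewrite mulrAC.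
Qed.

Lemma sum_scale_step j0 b F F' : b_regular q b x -> decay q a (scale_at j0 b q) x ->
  has_sum (fun k => sterm q a b x (ext 0 k)) F ->
  has_sum (fun k => sterm q a (scale_at j0 b q) x (ext 0 k)) F' ->
  F * \prod_i (1 - b j0 * x i) * (1 - (\prod_j b j) / (q ^+ r * A)) =
  F' * (1 - (\prod_j b j) / q ^+ r * X) * \prod_j (1 - b j0 / a j).
Proof.
move=> bx dec hF hF'.
have bx' : b_regular q (scale_at j0 b q) x.
  by have := scale_at_regular j0 1 bx; rewrite expr1.
have hW : has_sum (fun k => cterm q a (scale_at j0 b q) x (b j0) (ext 0 k))
    (\prod_i (1 - b j0 * x i) * F).
  by apply: has_sum_eq (has_sumZ _ hF) => k; rewrite cterm_scale_at.
have := cterm_sum bx' dec hF' hW.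
have -> : \prod_j (b j0 - scale_at j0 b q j / q) = 0.
  by rewrite (bigD1 j0)//= /scale_at eqxx mulfK// subrr mul0r.
have -> : \prod_j (scale_at j0 b q j / q) = (\prod_j b j) / q ^+ r.
  rewrite big_split/= prod_scale_at prodr_const card_ord exprS exprVn.
  by field; rewrite expf_neq0 ?q0.
have -> : \prod_j (b j0 - a j) = sg * A * \prod_j (1 - b j0 / a j).
  have -> : sg * A = \prod_j (- a j) by rewrite prodrN card_ord.
  rewrite -big_split; apply: eq_bigr => j _ /=; by field.
have qr : q ^+ r != 0 by rewrite expf_neq0.
have sg0 : sg != 0 by rewrite signr_eq0.
move=> h; apply: (mulfI (mulf_neq0 sg0 A0)).
transitivity (\prod_i (1 - b j0 * x i) * F * (sg * (A - (\prod_j b j) / q ^+ r))).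
  by field; rewrite A0 qr.
by rewrite h; ring.
Qed.

End Contiguity.

(** * Letting a denominator parameter tend to zero *)

Section Growth.
Variable R : realType.

Lemma cvg_prod_fin (K : numFieldType) (I : Type) (l : seq I) (P : pred I)
    (u : I -> nat -> K) (v : I -> K) :
  (forall i, u i @ \oo --> v i) ->
  (fun n => \prod_(i <- l | P i) u i n) @ \oo --> (\prod_(i <- l | P i) v i : K).
Proof.
move=> h; elim: l => [|i l ih].
  by rewrite big_nil; under eq_fun do rewrite big_nil; exact: cvg_cst.
rewrite big_cons; under eq_fun do rewrite big_cons.
by case: (P i) => //; exact: (cvgM (h i) ih).
Qed.

(** From some [N] on the factors are at most [tau], so the quotient of the product by [tau ^+ n] no
    longer increases; the sum of its values up to [N] bounds it throughout. *)
Lemma prod_le_geometric (g : nat -> R) (L tau : R) : (forall s, 0 <= g s) ->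
  g @ \oo --> L -> L < tau -> 0 < tau ->
  exists2 M, 0 <= M & forall n, \prod_(s < n) g s <= M * tau ^+ n.
Proof.
move=> g0 gL Lt t0.
have [N _ hN] : \forall s \near \oo, g s <= tau.
  have d0 : 0 < tau - L by rewrite subr_gt0.
  move/cvgrPdist_lt : gL => /(_ _ d0); apply: filterS => s.
  by rewrite ltr_norml => /andP[h _]; lra.
pose u n := \prod_(s < n) g s / tau ^+ n.
have u0 n : 0 <= u n.
  by apply: divr_ge0; [exact: prodr_ge0|rewrite exprn_ge0// ltW].
have uS n : u n.+1 = u n * (g n / tau).
  by rewrite /u big_ord_recr/= exprS invfM; ring.
exists (\sum_(i < N.+1) u i) => [|n]; first exact: sumr_ge0.
suff : u n <= \sum_(i < N.+1) u i.
  by rewrite /u ler_pdivrMr// exprn_gt0.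
have [nN|] := leqP n N.
  rewrite (bigD1 (Ordinal (nN : (n < N.+1)%N)))//= lerDl; exact: sumr_ge0.
move=> /ltnW/subnKC <-; elim: (n - N)%N => [|l ih].
  by rewrite addn0 big_ord_recr/= lerDr sumr_ge0.
apply: le_trans ih; rewrite addnS uS ler_piMr// ler_pdivrMr// mul1r.
by apply: hN; rewrite /= leq_addr.
Qed.

Lemma cvg_cabs (u : nat -> R[i]) (l : R[i]) : u @ \oo --> l ->
  (fun n => cabs (u n)) @ \oo --> cabs l.
Proof.
move/cvg_cabsP => h; apply/cvgrPdist_lt => e /h; apply: filterS => n.
apply: le_lt_trans.
have := cabsD (l - u n) (u n); have := cabsD (u n - l) l; rewrite !subrK.
rewrite [cabs (u n - l)]cabs_distC ler_norml.
by move: (cabs l) (cabs (u n)) (cabs (l - u n)) => s t w *; apply/andP; split; lra.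
Qed.

Lemma cvg_pow0 (q : R[i]) : cabs q < 1 -> (fun n => q ^+ n) @ \oo --> (0 : R[i]).
Proof.
move=> q1; apply/cvg_cabsP => e e0.
have := cabs_pow_lt q1 1 e0; apply: filterS => n.
by rewrite sub0r cabsN cabsX mul1r.
Qed.

End Growth.

(** * Decay of the row factors, uniform under rescaling *)

Section Decay.
Variables (R : realType) (r : nat) (q : R[i]) (a x : 'I_r.+1 -> R[i]).
Hypotheses (q0 : q != 0) (q1 : cabs q < 1).
Hypotheses (x0 : forall j, x j != 0) (ax : a_regular q a x) (a0 : forall j, a j != 0).
Implicit Types (b : 'I_r.+1 -> R[i]).

Let Q := cabs q.
Let Q0 : 0 < Q. Proof. by rewrite cabs_gt0. Qed.

Lemma prod_bounded (I : finType) (T : Type) (f : I -> T -> R) :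
  (forall i t, 0 <= f i t) -> (forall i, exists M, forall t, f i t <= M) ->
  exists M, forall t, \prod_i f i t <= M.
Proof.
move=> f0 /choice[M hM]; exists (\prod_i M i) => t.
by apply: ler_prod => i _; rewrite f0 hM.
Qed.

(** The inverse equals [(y)_n / (y)_(n + l)], a quotient of two bounded sequences, which makes the
    bound uniform in [n]. *)
Lemma qprod_scale_inv_bounded (y : R[i]) : (forall n : nat, y * q ^+ n != 1) ->
  exists M, forall n l : nat, cabs (qprod q (y * q ^+ n) l)^-1 <= M.
Proof.
move=> hy; have y0 := qpochinf_neq0 q1 hy.
have [M1 h1] := qprod_bounded q1 y; have [M2 h2] := qprod_inv_bounded q1 y0.
exists (M1 * M2) => n l.
have -> : (qprod q (y * q ^+ n) l)^-1 = qprod q y n * (qprod q y (n + l))^-1.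
  by rewrite qprodD invfM mulrA mulfV ?mul1r// qprod_neq0.
by rewrite cabsM ler_pM ?cabs_ge0.
Qed.

Lemma rho_pos_bounded j0 b : b_regular q b x ->
  exists M, forall (p : 'I_r.+1 * nat * nat),
    cabs (rho q a (scale_at j0 b (q ^+ p.1.2)) (x p.1.1) (Posz p.2)) <= M.
Proof.
move=> bx.
have h : forall i, exists M, forall p : nat * nat,
    cabs (rho q a (scale_at j0 b (q ^+ p.1)) (x i) (Posz p.2)) <= M.
  move=> i; rewrite /rho; under eq_exists do under eq_forall do rewrite cabs_prod.
  apply: prod_bounded => [j p|j]; first exact: cabs_ge0.
  have [M1 h1] := qprod_bounded q1 (a j * x i).
  have [M2 h2] := @qprod_scale_inv_bounded (b j * x i) (bx i j).
  exists (M1 * M2) => p /=; rewrite cabsM ler_pM ?cabs_ge0//.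
  rewrite /scale_at; case: (j == j0); last by have := h2 0%N p.2; rewrite expr0 mulr1.
  by have := h2 p.1 p.2; rewrite mulrAC.
have [M hM] := choice h; exists (\sum_i `|M i|) => -[[i n] l] /=.
have := hM i (n, l) => /= /le_trans; apply.
rewrite (bigD1 i)//= (le_trans (ler_norm _))// lerDl; apply: sumr_ge0 => j _.
exact: normr_ge0.
Qed.

Lemma rho_negE b y n : rho q a b y (Negz n) =
  \prod_(s < n.+1) \prod_j ((1 - b j * y / q ^+ s.+1) / (1 - a j * y / q ^+ s.+1)).
Proof.
rewrite exchange_big/= /rho; apply: eq_bigr => j _ /=.
by rewrite invrK mulrC !big_mkord big_split/= prodfV.
Qed.

(** The s-th factor in [rho_negE] tends to [\prod_j b j / \prod_j a j]. The numerator
    [Q ^+ s.+1 + cabs (b j * x i)] gives a bound with the same limit in modulus, and it also covers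
    [b j * q ^+ n] because [cabs q < 1]. *)
Lemma rho_neg_bounded j0 b (tau : R) : 0 < tau ->
  cabs (\prod_j b j / \prod_j a j) < tau ->
  exists2 M, 0 <= M & forall (i : 'I_r.+1) (n l : nat),
    cabs (rho q a (scale_at j0 b (q ^+ n)) (x i) (Negz l)) <= M * tau ^+ l.+1.
Proof.
move=> t0 bt.
pose g i (s : nat) : R := \prod_j ((Q ^+ s.+1 + cabs (b j * x i)) / cabs (q ^+ s.+1 - a j * x i)).
have Qs : (fun s => Q ^+ s.+1) @ \oo --> (0 : R).
  have h : (fun s => Q ^+ s) @ \oo --> (0 : R).
    by apply: cvg_expr; rewrite ger0_norm ?cabs_ge0.
  by rewrite (cvg_shiftS (fun s => Q ^+ s)).
have qs : (fun s => q ^+ s.+1) @ \oo --> (0 : R[i]).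
  by rewrite (cvg_shiftS (fun s => q ^+ s)); exact: cvg_pow0.
have gL i : g i @ \oo --> cabs (\prod_j b j / \prod_j a j).
  have -> : cabs (\prod_j b j / \prod_j a j) =
      \prod_j ((0 + cabs (b j * x i)) / cabs (0 - a j * x i)).
    rewrite cabsM cabsV !cabs_prod -prodfV -big_split; apply: eq_bigr => j _ /=.
    rewrite add0r sub0r cabsN !cabsM invfM mulrACA mulfV ?mulr1//.
    by rewrite cabs_eq0.
  apply: cvg_prod_fin => j; apply: cvgM; first by apply: cvgD => //; exact: cvg_cst.
  apply: cvgV; first by rewrite cabs_eq0 sub0r oppr_eq0 mulf_neq0.
  by apply: cvg_cabs; exact: (cvgB qs (cvg_cst _)).
have g0 i s : 0 <= g i s.
  apply: prodr_ge0 => j _; rewrite divr_ge0 ?cabs_ge0// addr_ge0 ?cabs_ge0//.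
  by rewrite exprn_ge0// ltW.
have /choice[M hM] : forall i, exists M, 0 <= M /\
    forall n, \prod_(s < n) g i s <= M * tau ^+ n.
  by move=> i; have [M M0 hM] := prod_le_geometric (g0 i) (gL i) bt t0; exists M.
exists (\sum_i M i) => [|i n l]; first by apply: sumr_ge0 => i _; case: (hM i).
have [Mi0 hMi] := hM i.
apply: (@le_trans _ _ (M i * tau ^+ l.+1)); last first.
  rewrite ler_wpM2r ?exprn_ge0 ?(ltW t0)// (bigD1 i)//= lerDl.
  by apply: sumr_ge0 => j _; case: (hM j).
apply: le_trans (hMi l.+1); rewrite rho_negE cabs_prod.
apply: ler_prod => s _; rewrite cabs_ge0 /= cabs_prod; apply: ler_prod => j _.
rewrite cabs_ge0 /=.
have qs0 : q ^+ s.+1 != 0 by rewrite expf_neq0.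
have -> : (1 - scale_at j0 b (q ^+ n) j * x i / q ^+ s.+1) / (1 - a j * x i / q ^+ s.+1)
    = (q ^+ s.+1 - scale_at j0 b (q ^+ n) j * x i) / (q ^+ s.+1 - a j * x i).
  have h : q ^+ s.+1 - a j * x i != 0 by rewrite subr_eq0 eq_sym ax.
  by field; rewrite qs0 h.
rewrite cabsM cabsV ler_wpM2r ?invr_ge0 ?cabs_ge0// (le_trans (cabsB _ _))//.
rewrite cabsX lerD2l /scale_at; case: (j == j0) => //.
rewrite !cabsM ler_wpM2r ?cabs_ge0// ler_piMr ?cabs_ge0// cabsX.
by rewrite exprn_ile1 ?cabs_ge0// ltW.
Qed.

Lemma decay_uniform j0 b : b_regular q b x ->
  cabs (\prod_j b j / \prod_j a j) < Q ^+ r.+1 ->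
  exists la M : R, [/\ 0 < la, la < 1, 0 <= M & forall (n : nat) i k,
    cabs (rho q a (scale_at j0 b (q ^+ n)) (x i) k) <=
      M * ipow 1 (la ^+ 2 * Q ^+ r.+1) k].
Proof.
move=> bx ba; pose L := cabs (\prod_j b j / \prod_j a j).
have L0 : 0 <= L by exact: cabs_ge0.
have Qr : 0 < Q ^+ r.+1 by rewrite exprn_gt0.
pose t := L / Q ^+ r.+1.
have t0 : 0 <= t by rewrite divr_ge0// ltW.
have t1 : t < 1 by rewrite ltr_pdivrMr// mul1r.
(* Then [la ^+ 2 > t], since [(1 + t)^2 - 4 t = (1 - t)^2 > 0]. *)
pose la := (1 + t) / 2.
have la0 : 0 < la by rewrite /la; lra.
have la1 : la < 1 by rewrite /la; lra.
have tau0 : 0 < la ^+ 2 * Q ^+ r.+1 by rewrite mulr_gt0// exprn_gt0.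
have bt : L < la ^+ 2 * Q ^+ r.+1.
  by rewrite -ltr_pdivrMr// -/t /la; nra.
have [M1 h1] := rho_pos_bounded j0 bx.
have [M2 M20 h2] := rho_neg_bounded j0 tau0 bt.
exists la, (`|M1| + M2); split => // [|n i [l|l]] /=; first by rewrite addr_ge0.
  rewrite expr1n mulr1; have := h1 (i, n, l) => /= /le_trans; apply.
  by rewrite (le_trans (ler_norm _))// lerDl.
rewrite (le_trans (h2 i n l))// ler_wpM2r ?lerDr//.
by rewrite exprn_ge0// ltW.
Qed.

(** Row [i] contains a zero factor at every [Negz l] with [l >= n]. Finitely many negative indices
    remain, so any [la] in the open unit interval serves. *)
Lemma decay_terminating b : b_regular q b x ->
  (forall i, exists j (n : nat), b j * x i = q ^+ n.+1) -> decay q a b x.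
Proof.
move=> bx hb; have Qr : 0 < Q ^+ r.+1 by rewrite exprn_gt0.
pose la : R := 1 / 2; have la0 : 0 < la by rewrite /la; lra.
have la1 : la < 1 by rewrite /la; lra.
pose tau := la ^+ 2 * Q ^+ r.+1.
have tau0 : 0 < tau by rewrite mulr_gt0// exprn_gt0.
have [M1 h1] := rho_pos_bounded ord0 bx.
have /choice[M2 h2] : forall i, exists M, 0 <= M /\
    forall l, cabs (rho q a b (x i) (Negz l)) <= M * tau ^+ l.+1.
  move=> i; have [j [n bq]] := hb i.
  pose u l := cabs (rho q a b (x i) (Negz l)) / tau ^+ l.+1.
  have u0 l : 0 <= u l by rewrite divr_ge0 ?cabs_ge0// exprn_ge0// ltW.
  exists (\sum_(l < n) u l); split; first exact: sumr_ge0.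
  move=> l; rewrite -ler_pdivrMr ?exprn_gt0// -/(u l).
  have [ln|nl] := ltnP l n.
    by rewrite (bigD1 (Ordinal ln))//= lerDl sumr_ge0.
  suff -> : u l = 0 by exact: sumr_ge0.
  rewrite /u rho_negE (bigD1 (Ordinal (nl : (n < l.+1)%N)))//= (bigD1 j)//= bq.
  by rewrite divff ?expf_neq0// subrr !mul0r cabs0 mul0r.
exists la, (`|M1| + \sum_i M2 i); split => //.
  by rewrite addr_ge0//; apply: sumr_ge0 => i _; case: (h2 i).
have s0 : 0 <= \sum_i M2 i by apply: sumr_ge0 => i _; case: (h2 i).
move=> i [l|l] /=.
  rewrite expr1n mulr1; have := h1 (i, 0%N, l) => /=.
  have -> : scale_at ord0 b (q ^+ 0) = b.
    by apply/funext => j; rewrite /scale_at mulr1; case: eqP.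
  by move/le_trans; apply; rewrite (le_trans (ler_norm _))// lerDl.
have [Mi0 hMi] := h2 i; rewrite (le_trans (hMi l))// ler_wpM2r ?exprn_ge0 ?(ltW tau0)//.
apply: ler_wpDl; first exact: normr_ge0.
by rewrite (bigD1 i)//= lerDl; apply: sumr_ge0 => j _; case: (h2 j).
Qed.

End Decay.

Section Limit.
Variables (R : realType) (r : nat) (q : R[i]) (a x : 'I_r.+1 -> R[i]).
Hypotheses (q0 : q != 0) (q1 : cabs q < 1) (r0 : (0 < r)%N).
Hypotheses (gx : generic q x) (ax : a_regular q a x) (a0 : forall j, a j != 0).
Implicit Types (b : 'I_r.+1 -> R[i]) (C : R[i]).

Let A := \prod_j a j.
Let X := \prod_j x j.
Let x0 j : x j != 0. Proof. by case: gx. Qed.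
Let A0 : A != 0. Proof. exact/prodf_neq0. Qed.

Lemma scale_atD j0 b (s t : R[i]) :
  scale_at j0 (scale_at j0 b s) t = scale_at j0 b (s * t).
Proof. by apply/funext => j; rewrite /scale_at; case: eqP => // _; rewrite mulrA. Qed.

Lemma scale_at1 j0 b : scale_at j0 b 1 = b.
Proof. by apply/funext => j; rewrite /scale_at mulr1; case: eqP. Qed.

Lemma sum_scale_steps j0 b n F F' : b_regular q b x ->
  (forall l : nat, decay q a (scale_at j0 b (q ^+ l.+1)) x) ->
  has_sum (fun k => sterm q a b x (ext 0 k)) F ->
  has_sum (fun k => sterm q a (scale_at j0 b (q ^+ n)) x (ext 0 k)) F' ->
  F * \prod_i qprod q (b j0 * x i) n * qprod q ((\prod_j b j) / (q ^+ r * A)) n =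
  F' * qprod q ((\prod_j b j) / q ^+ r * X) n * \prod_j qprod q (b j0 / a j) n.
Proof.
move=> bx dec hF; elim: n F' => [|n ih] F' hF'.
  rewrite expr0 scale_at1 in hF'; rewrite (has_sum_unique hF hF').
  have e (f : 'I_r.+1 -> R[i]) : \prod_i qprod q (f i) 0 = 1.
    by rewrite big1// => i _; exact: qprod0.
  by rewrite !e !qprod0 !mulr1.
have [G hG] : exists G,
    has_sum (fun k => sterm q a (scale_at j0 b (q ^+ n)) x (ext 0 k)) G.
  case: (n) => [|l]; last exact: summable_sterm.
  by exists F; rewrite expr0 scale_at1.
have e : scale_at j0 b (q ^+ n.+1) = scale_at j0 (scale_at j0 b (q ^+ n)) q.
  by rewrite scale_atD exprSr.
have d := dec n; rewrite e in hF' d.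
have := sum_scale_step q0 q1 r0 gx ax a0 (scale_at_regular j0 n bx) d hG hF'.
have -> : scale_at j0 b (q ^+ n) j0 = b j0 * q ^+ n by rewrite /scale_at eqxx.
rewrite prod_scale_at -/A -/X => st.
have := ih _ hG; set B := \prod_j b j in st *.
have -> : \prod_i qprod q (b j0 * x i) n.+1 =
    \prod_i qprod q (b j0 * x i) n * \prod_i (1 - b j0 * q ^+ n * x i).
  by rewrite -big_split; apply: eq_bigr => i _; rewrite qprodS mulrAC.
have -> : \prod_j qprod q (b j0 / a j) n.+1 =
    \prod_j qprod q (b j0 / a j) n * \prod_j (1 - b j0 * q ^+ n / a j).
  by rewrite -big_split; apply: eq_bigr => i _; rewrite qprodS mulrAC.
rewrite !qprodS => ihn.
transitivity (F * \prod_i qprod q (b j0 * x i) n * qprod q (B / (q ^+ r * A)) n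
   * (\prod_i (1 - b j0 * q ^+ n * x i) * (1 - q ^+ n * B / (q ^+ r * A)))).
  by ring.
rewrite ihn.
transitivity (G * \prod_i (1 - b j0 * q ^+ n * x i) * (1 - q ^+ n * B / (q ^+ r * A))
  * (qprod q (B / q ^+ r * X) n * \prod_j qprod q (b j0 / a j) n)); first by ring.
by rewrite st; ring.
Qed.

Lemma qpoch_scale_inv_cvg (y : R[i]) k : (forall n : nat, y * q ^+ n != 1) ->
  (fun n => (qpoch q (y * q ^+ n) k)^-1) @ \oo --> ((qpoch q 0 k)^-1 : R[i]).
Proof.
move=> hy.
have lin (t : R[i]) : (fun n : nat => 1 - y * q ^+ n * t) @ \oo --> (1 - 0 * t : R[i]).
  rewrite -[0](mulr0 y).
  exact: (cvgB (cvg_cst _) (cvgM (cvgM (cvg_cst _) (cvg_pow0 q1)) (cvg_cst _))).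
case: k => l /=; last first.
  rewrite invrK; under eq_fun do rewrite invrK.
  by apply: cvg_prod_fin => j; exact: lin.
apply: cvgV; last by apply: cvg_prod_fin => j; exact: lin.
by rewrite /qprod big1 ?oner_eq0// => j _; rewrite mul0r subr0.
Qed.

Lemma sum_scale_limit j0 b F : b_regular q b x ->
  (forall l : nat, decay q a (scale_at j0 b (q ^+ l.+1)) x) ->
  has_sum (fun k => sterm q a b x (ext 0 k)) F ->
  exists2 F', has_sum (fun k => sterm q a (scale_at j0 b 0) x (ext 0 k)) F' &
  F * \prod_i qpochinf q (b j0 * x i) * qpochinf q ((\prod_j b j) / (q ^+ r * A)) =
  F' * qpochinf q ((\prod_j b j) / q ^+ r * X) * \prod_j qpochinf q (b j0 / a j).
Proof.
move=> bx dec hF.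
(* The product of the parameters need not be small at the start, as in the terminating case; [N]
   rescalings make [decay_uniform] applicable without affecting the limit. *)
have [N hN] : exists N : nat, cabs (\prod_j scale_at j0 b (q ^+ N) j / A) < cabs q ^+ r.+1.
  have e0 : 0 < cabs q ^+ r.+1 by rewrite exprn_gt0// cabs_gt0.
  have [N _ /(_ _ (leqnn N))/= h] := cabs_pow_lt q1 (cabs (\prod_j b j / A)) e0.
  by exists N; rewrite prod_scale_at -mulrA cabsM cabsX mulrC.
have [la [M [la0 la1 M0 hM]]] :=
  decay_uniform q0 q1 x0 ax a0 j0 (scale_at_regular j0 N bx) hN.
have [g dg hg] := cterm_majorant q0 q1 a x 0 0 r0 la0 la1 M0.
pose bn n := scale_at j0 b (q ^+ (n + N)).
have bnE n : bn n = scale_at j0 (scale_at j0 b (q ^+ N)) (q ^+ n).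
  by rewrite scale_atD -exprD addnC.
have /choice[Fn hFn] : forall n, exists s, has_sum (fun k => sterm q a (bn n) x (ext 0 k)) s.
  move=> n; rewrite /bn; case: (n + N)%N => [|l]; last exact: summable_sterm.
  by exists F; rewrite expr0 scale_at1.
have gbound n k : cabs (sterm q a (bn n) x (ext 0 k)) <= g k.
  by rewrite -cterm0 bnE; apply: hg.
have ptw k : (fun n => sterm q a (bn n) x (ext 0 k)) @ \oo -->
    (sterm q a (scale_at j0 b 0) x (ext 0 k) : R[i]).
  apply: (cvgM (cvg_cst _)); apply: cvg_prod_fin => i; apply: cvg_prod_fin => j.
  apply: (cvgM (cvg_cst _)); rewrite /bn /scale_at; case: (j == j0); last exact: cvg_cst.
  have := @qpoch_scale_inv_cvg (b j * x i) (ext 0 k i) (bx i j).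
  rewrite -(cvg_shiftn N) mulr0 mul0r; apply: cvg_trans.
  apply: near_eq_cvg; apply: nearW => n; by rewrite mulrAC.
have [F' hF' FF'] := has_sum_cvg dg gbound ptw hFn.
exists F' => //.
have st n := sum_scale_steps bx dec hF (hFn n).
set B := \prod_j b j in st *.
have c1 : (fun n => F * \prod_i qprod q (b j0 * x i) (n + N)
    * qprod q (B / (q ^+ r * A)) (n + N)) @ \oo -->
    (F * \prod_i qpochinf q (b j0 * x i) * qpochinf q (B / (q ^+ r * A)) : R[i]).
  rewrite (cvg_shiftn N (fun n => F * \prod_i qprod q (b j0 * x i) n
    * qprod q (B / (q ^+ r * A)) n)).
  have h : (fun n => \prod_i qprod q (b j0 * x i) n) @ \oo -->
      (\prod_i qpochinf q (b j0 * x i) : R[i]).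
    by apply: cvg_prod_fin => i; exact: qpochinf_cvg.
  exact: (cvgM (cvgM (cvg_cst F) h) (@qpochinf_cvg _ q q1 (B / (q ^+ r * A)))).
have c2 : (fun n => Fn n * qprod q (B / q ^+ r * X) (n + N)
    * \prod_j qprod q (b j0 / a j) (n + N)) @ \oo -->
    (F' * qpochinf q (B / q ^+ r * X) * \prod_j qpochinf q (b j0 / a j) : R[i]).
  have h1 : (fun n => qprod q (B / q ^+ r * X) (n + N)) @ \oo -->
      (qpochinf q (B / q ^+ r * X) : R[i]).
    by rewrite (cvg_shiftn N (qprod q (B / q ^+ r * X))); exact: qpochinf_cvg.
  have h2 : (fun n => \prod_j qprod q (b j0 / a j) (n + N)) @ \oo -->
      (\prod_j qpochinf q (b j0 / a j) : R[i]).
    apply: cvg_prod_fin => j; rewrite (cvg_shiftn N (qprod q (b j0 / a j))).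
    exact: qpochinf_cvg.
  exact: (cvgM (cvgM FF' h1) h2).
have e : (fun n => F * \prod_i qprod q (b j0 * x i) (n + N)
    * qprod q (B / (q ^+ r * A)) (n + N)) = (fun n => Fn n * qprod q (B / q ^+ r * X) (n + N)
    * \prod_j qprod q (b j0 / a j) (n + N)) by apply/funext => n; exact: st.
by rewrite e in c1; exact: (cvg_unique (@norm_hausdorff _ _) c1 c2).
Qed.

End Limit.

(** * Gustafson's sum *)

Section Gustafson.
Variables (R : realType) (r : nat) (q : R[i]) (a x : 'I_r.+1 -> R[i]).
Hypotheses (q0 : q != 0) (q1 : cabs q < 1) (r0 : (0 < r)%N).
Hypotheses (gx : generic q x) (ax : a_regular q a x) (a0 : forall j, a j != 0).
Implicit Types (b : 'I_r.+1 -> R[i]) (C : R[i]).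

Let A := \prod_j a j.
Let X := \prod_j x j.
Let x0 j : x j != 0. Proof. by case: gx. Qed.
Let A0 : A != 0. Proof. exact/prodf_neq0. Qed.
Let X0 : X != 0. Proof. exact/prodf_neq0. Qed.

Definition zero_below l b : 'I_r.+1 -> R[i] := fun j => if (j < l)%N then 0 else b j.

Lemma sum_zero_limit b F : b_regular q b x ->
  (forall j0 (l : nat), decay q a (scale_at j0 b (q ^+ l.+1)) x) ->
  has_sum (fun k => sterm q a b x (ext 0 k)) F ->
  exists2 F', has_sum (fun k => sterm q a (fun=> 0) x (ext 0 k)) F' &
  F * \prod_j \prod_i qpochinf q (b j * x i)
    * qpochinf q ((\prod_j b j) / (q ^+ r * A)) =
  F' * qpochinf q ((\prod_j b j) / q ^+ r * X)
    * \prod_j \prod_l qpochinf q (b j / a l).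
Proof.
move=> bx dec hF.
pose P1 l := \prod_(j < r.+1 | (j < l)%N) \prod_i qpochinf q (b j * x i).
pose P2 l := \prod_(j < r.+1 | (j < l)%N) \prod_i qpochinf q (b j / a i).
have PS (f : 'I_r.+1 -> R[i]) (l : 'I_r.+1) :
    \prod_(j < r.+1 | (j < l.+1)%N) f j = f l * \prod_(j < r.+1 | (j < l)%N) f j.
  rewrite (bigD1 l)//=; congr (_ * _); apply: eq_bigl => j.
  by rewrite ltnS leq_eqVlt -(inj_eq val_inj)/=; case: ltngtP.
have step (l : 'I_r.+1) : scale_at l (zero_below l b) 0 = zero_below l.+1 b.
  apply/funext => j; rewrite /scale_at /zero_below.
  have -> : (j < l.+1)%N = (j == l) || (j < l)%N by rewrite ltnS leq_eqVlt.
  by case: (j == l); rewrite //= mulr0.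
have z_reg l : b_regular q (zero_below l b) x.
  move=> i j n; rewrite /zero_below; case: ifP => _; last exact: bx.
  by rewrite !mul0r eq_sym oner_eq0.
have main l : (l < r.+1)%N ->
    exists2 F', has_sum (fun k => sterm q a (zero_below l.+1 b) x (ext 0 k)) F' &
    F * P1 l.+1 * qpochinf q ((\prod_j b j) / (q ^+ r * A)) =
    F' * qpochinf q ((\prod_j b j) / q ^+ r * X) * P2 l.+1.
  elim: l => [|l ih] lr.
    have [F' hF' e] := sum_scale_limit q0 q1 r0 gx ax a0 bx (dec (Ordinal lr)) hF.
    exists F'; last by rewrite /P1 /P2 !(PS _ (Ordinal lr)) ![\prod_(_ < _ | (_ < 0)%N) _]big_pred0_eq !mulr1.
    rewrite -(step (Ordinal lr)); apply: has_sum_eq hF' => k.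
    by congr (sterm q a (scale_at _ _ _) x _); apply/funext.
  have [G hG e] := ih (ltnW lr).
  (* One parameter is already zero, so the condition of [decay_uniform] is automatic and both
     infinite products in [\prod_j b j] are 1: they enter only at the first parameter. *)
  have z0 : \prod_j zero_below l.+1 b j = 0.
    by rewrite (bigD1 (Ordinal (ltnW lr : (l < r.+1)%N)))//= /zero_below ltnSn mul0r.
  have dl n : decay q a (scale_at (Ordinal lr) (zero_below l.+1 b) (q ^+ n.+1)) x.
    have [|la [M [la0 la1 M0 hM]]] :=
      decay_uniform q0 q1 x0 ax a0 (Ordinal lr) (z_reg l.+1).
      by rewrite z0 mul0r cabs0 exprn_gt0// cabs_gt0.
    by exists la, M; split => // i k; exact: hM.
  have [F' hF' e'] := sum_scale_limit q0 q1 r0 gx ax a0 (z_reg l.+1) dl hG.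
  exists F'; first by rewrite -(step (Ordinal lr)).
  move: e'; rewrite z0 !mul0r qpochinf0 !mulr1 {1 2}/zero_below/= ltnn => e'.
  rewrite /P1 /P2 !(PS _ (Ordinal lr)) -/(P1 l.+1) -/(P2 l.+1).
  transitivity (F * P1 l.+1 * qpochinf q ((\prod_j b j) / (q ^+ r * A))
    * \prod_i qpochinf q (b (Ordinal lr) * x i)); first by ring.
  rewrite e; transitivity (G * \prod_i qpochinf q (b (Ordinal lr) * x i)
    * qpochinf q ((\prod_j b j) / q ^+ r * X) * P2 l.+1); first by ring.
  by rewrite e'; ring.
have [F' hF' e] := main r (ltnSn r).
have bl (f : 'I_r.+1 -> R[i]) : \prod_(j < r.+1 | (j < r.+1)%N) f j = \prod_j f j.
  by apply: eq_bigl => j; rewrite ltn_ord.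
rewrite [P1 _]bl [P2 _]bl in e; exists F'; last exact: e.
have <- : zero_below r.+1 b = fun=> 0; last exact: hF'.
by apply/funext => j; rewrite /zero_below ltn_ord.
Qed.

Lemma q_expn_neq1 (n : nat) : q ^+ n.+1 != 1.
Proof.
apply/eqP => /(congr1 (@cabs R)); rewrite cabs1 cabsX => e.
have : cabs q ^+ n.+1 < 1 by rewrite exprn_ilt1 ?cabs_ge0.
by rewrite e ltxx.
Qed.

(* For [b j = q / x j] only the term [K = 0] of the slice 0 survives. *)
Lemma sum_terminating :
  has_sum (fun k => sterm q a (fun j => q / x j) x (ext 0 k)) (vdm x).
Proof.
have e0 j : ext 0 0 j = 0.
  rewrite /ext; case: unlift => [i|]; first by rewrite ffunE.
  by rewrite /wt big1 ?subr0// => i _; rewrite ffunE.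
have -> : vdm x = sterm q a (fun j => q / x j) x (ext 0 0).
  rewrite /sterm [X in _ * X]big1 ?mulr1 => [|j _].
    by congr vdm; apply/funext => j; rewrite /node e0 expr0z mulr1.
  by rewrite e0 /rho big1// => l _; rewrite /= !qprod0 divr1.
apply: has_sum_single => k k0.
(* Coordinates summing to zero and not all zero include a negative one; in its row the denominator
   parameter [q / x i * x i = q] gives the factor [1 / (q; q)_k = 0]. *)
have [i i0] : exists i, ext 0 k i < 0.
  apply: contrapT => /forallNP h; move/negP: k0; apply.
  have kge i : 0 <= k i by have /negP := h (lift ord0 i); rewrite ext_lift -leNgt.
  have /negP := h ord0; rewrite ext0 sub0r oppr_lt0 -leNgt => w0.
  apply/eqP/ffunP => i; rewrite ffunE; apply/eqP; rewrite eq_le kge andbT.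
  apply: le_trans w0; rewrite /wt (bigD1 i)//= lerDl; exact: sumr_ge0.
case e : (ext 0 k i) i0 => [n|n] // _.
have rho0 : rho q a (fun j => q / x j) (x i) (Negz n) = 0.
  rewrite rho_negE; apply/eqP/prodf_eq0; exists ord0 => //.
  apply/prodf_eq0; exists i => //.
  by rewrite divfK// expr1 divff// subrr mul0r.
by rewrite /sterm [X in _ * X](bigD1 i)//= e rho0 mul0r mulr0.
Qed.

Lemma terminating_regular : b_regular q (fun j => q / x j) x.
Proof.
move=> i j n; have [->|ij] := eqVneq i j.
  by rewrite divfK// -exprS q_expn_neq1.
have := gx.2 j i (Posz n.+1); rewrite eq_sym => /(_ ij).
apply: contra => /eqP e; apply/eqP.
by rewrite -[LHS]mulr1 -e -exprnP exprS; field.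
Qed.

Lemma gustafson_6psi6 b F : b_regular q b x ->
  cabs (\prod_j b j / A) < cabs q ^+ r.+1 ->
  has_sum (fun k => sterm q a b x (ext 0 k)) F ->
  F * (\prod_j \prod_i qpochinf q (b j * x i))
    * qpochinf q ((\prod_j b j) / (q ^+ r * A))
    * (qpochinf q q * \prod_j \prod_l qpochinf q (q / (x j * a l))) =
  vdm x * (\prod_j \prod_i qpochinf q (q * x i / x j)) * qpochinf q (q / (A * X))
    * (qpochinf q ((\prod_j b j) / q ^+ r * X)
    * \prod_j \prod_l qpochinf q (b j / a l)).
Proof.
move=> bx ba hF.
have dec j0 (l : nat) : decay q a (scale_at j0 b (q ^+ l.+1)) x.
  have [la [M [la0 la1 M0 hM]]] := decay_uniform q0 q1 x0 ax a0 j0 bx ba.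
  by exists la, M; split => // i k; exact: hM.
have [G hG e] := sum_zero_limit bx dec hF.
have tx := terminating_regular.
have dect j0 (l : nat) : decay q a (scale_at j0 (fun j => q / x j) (q ^+ l.+1)) x.
  apply: decay_terminating => //; first exact: scale_at_regular.
  move=> i; exists i; rewrite /scale_at; case: (i == j0).
    by exists l.+1; rewrite [RHS]exprS; field.
  by exists 0%N; rewrite divfK.
have [G' hG' e'] := sum_zero_limit tx dect sum_terminating.
rewrite (has_sum_unique hG' hG) in e'.
have Bt : \prod_j (q / x j) = q ^+ r.+1 / X.
  by rewrite big_split/= prodr_const card_ord prodfV.
move: e'; rewrite Bt.
have -> : q ^+ r.+1 / X / (q ^+ r * A) = q / (A * X).
  by rewrite exprS; field; rewrite A0 X0 expf_neq0.
have -> : q ^+ r.+1 / X / q ^+ r * X = q.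
  by rewrite exprS; field; rewrite X0 expf_neq0.
have -> : \prod_j \prod_i qpochinf q (q / x j * x i) =
    \prod_j \prod_i qpochinf q (q * x i / x j).
  by apply: eq_bigr => j _; apply: eq_bigr => i _; rewrite mulrAC.
have -> : \prod_j \prod_l qpochinf q (q / x j / a l) =
    \prod_j \prod_l qpochinf q (q / (x j * a l)).
  by apply: eq_bigr => j _; apply: eq_bigr => i _; rewrite -mulrA -invfM mulrC.
move=> e'; rewrite e e'; ring.
Qed.

Lemma gustafson_cterm b C : b_regular q b x ->
  cabs (\prod_j b j / A) < cabs q ^+ r.+1 ->
  exists2 F, has_sum (fun k => sterm q a b x (ext 0 k)) F &
  exists2 W, has_sum (fun k => cterm q a b x C (ext 0 k)) W &
  W * ((-1) ^+ r.+1 * (A - \prod_j (b j / q))) =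
  F * ((1 - \prod_j (b j / q) * X) * \prod_j (C - a j)
       - (1 - A * X) * \prod_j (C - b j / q)).
Proof.
move=> bx ba.
have dec : decay q a b x.
  have [la [M [la0 la1 M0 hM]]] := decay_uniform q0 q1 x0 ax a0 ord0 bx ba.
  exists la, M; split => // i k; have := hM 0%N i k.
  by rewrite expr0 scale_at1.
have [F hF] := summable_sterm q0 q1 r0 0 dec.
have [W hW] := summable_cterm q0 q1 C 0 r0 dec.
exists F => //; exists W => //; exact: cterm_sum hF hW.
Qed.

End Gustafson.

(** Up to the sign [c], independent of the nodes, [vdm] is a Vandermonde determinant, two of whose
    columns are exchanged. *)
Lemma vdm_tperm (K : comUnitRingType) (m : nat) (u : 'I_m -> K) (i j : 'I_m) :
  i != j -> vdm (fun l => u (tperm i j l)) = - vdm u.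
Proof.
move=> ij; pose c : K := \prod_(i0 < m) \prod_(j0 < m | (i0 < j0)%N) -1.
have vE (v : 'I_m -> K) : vdm v = c * \det (Vandermonde m (\row_l v l)).
  rewrite det_Vandermonde /c -big_split; apply: eq_bigr => i0 _ /=.
  rewrite -big_split; apply: eq_bigr => j0 _ /=.
  by rewrite !mxE mulN1r opprB.
rewrite !vE -mulrN; congr (_ * _).
have -> : Vandermonde m (\row_l u (tperm i j l)) =
    col_perm (tperm i j) (Vandermonde m (\row_l u l)).
  by apply/matrixP => k l; rewrite !mxE.
by rewrite col_permE det_mulmx det_perm odd_permV odd_tperm ij expr1 mulrN1.
Qed.

(** * Antisymmetry when two nodes can coincide *)

Section Degenerate.
Variables (R : realType) (r : nat) (q : R[i]) (a b x : 'I_r.+1 -> R[i]) (C : R[i]).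
Hypotheses (q0 : q != 0) (ax : a_regular q a x) (bx : b_regular q b x).
Variables (i0 j0 : 'I_r.+1) (s : int).
Hypotheses (ij : i0 != j0) (xij : x i0 = x j0 * q ^ s).

(** Both sides satisfy the first-order recurrence of [rhoS] and agree at 0. Regularity makes [pb]
    nonzero at [k >= 0] and [pa] nonzero at [k < 0], so induction runs in both directions. *)
Lemma rho_shift k : rho q a b (x j0) (k + s) = rho q a b (x j0) s * rho q a b (x i0) k.
Proof.
pose f k := rho q a b (x j0) (k + s); pose g k := rho q a b (x i0) k.
pose pa k := \prod_j (1 - a j * (x i0 * q ^ k)).
pose pb k := \prod_j (1 - b j * (x i0 * q ^ k)).
have fS l : f l * pa l = f (l + 1) * pb l.
  have := rhoS q0 (l + s) (ax j0) (bx j0).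
  by rewrite /f /pa /pb xij -mulrA -expfzDr// [s + l]addrC addrAC.
have gS l : g l * pa l = g (l + 1) * pb l by exact: rhoS (ax i0) (bx i0).
have pb0 (n : nat) : pb n != 0.
  by apply/prodf_neq0 => j _; rewrite mulrA subr_eq0 eq_sym -exprnP; exact: bx.
have pa0 (n : nat) : pa (- n.+1%:Z) != 0.
  apply/prodf_neq0 => j _; rewrite subr_eq0 eq_sym mulrA.
  apply: contra (ax i0 j n) => /eqP e.
  rewrite -[_ * _]mulr1 -(expr0z q) -(addNr n.+1%:Z) expfzDr// mulrA e mul1r.
  by rewrite exprnP.
have g0 : g 0 = 1 by rewrite /g /rho big1// => j _; rewrite /= !qprod0 divr1.
have f0 : f 0 = rho q a b (x j0) s by rewrite /f add0r.
rewrite -/(f k) -/(g k) -f0; elim/int_rec: k => [|n ih|n ih].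
- by rewrite g0 mulr1.
- apply: (mulIf (pb0 n)); rewrite -addn1 PoszD -fS ih -mulrA gS; ring.
- apply: (mulIf (pa0 n)).
  have e : - n.+1%:Z + 1 = - n%:Z by lia.
  by rewrite fS -mulrA gS e ih; ring.
Qed.

(** The offset [s] makes this the exchange of the nodes [i0] and [j0], not of the bare
    coordinates. *)
Definition swap (K : 'I_r.+1 -> int) : 'I_r.+1 -> int := fun j =>
  if j == i0 then K j0 - s else if j == j0 then K i0 + s else K j.

Lemma swapK : involutive swap.
Proof.
move=> K; apply/funext => j; rewrite /swap eqxx [j0 == i0]eq_sym (negbTE ij) eqxx.
by case: eqP => [->|_]; [rewrite addrK|case: eqP => [->|//]; rewrite subrK].
Qed.

Lemma node_swap K : node q x (swap K) = (fun j => node q x K (tperm i0 j0 j)).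
Proof.
apply/funext => j; rewrite /node /swap; case: tpermP => [->|->|/eqP/negbTE-> /eqP/negbTE->//].
  by rewrite eqxx xij -mulrA -expfzDr// addrC subrK.
by rewrite eq_sym (negbTE ij) eqxx xij -mulrA -expfzDr// [s + _]addrC.
Qed.

Lemma cterm_swap K : cterm q a b x C (swap K) = - cterm q a b x C K.
Proof.
rewrite /cterm /sterm node_swap (vdm_tperm _ ij) !mulNr; congr (- (_ * _ * _)).
  have ji : j0 != i0 by rewrite eq_sym.
  rewrite (bigD1 i0)//= (bigD1 j0)//= [RHS](bigD1 i0)//= [in RHS](bigD1 j0)//=.
  rewrite !mulrA; congr (_ * _).
    rewrite /swap eqxx (negbTE ji) eqxx rho_shift.
    by rewrite -{2}(subrK s (K j0)) rho_shift; ring.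
  by apply: eq_bigr => j /andP[/negbTE h /negbTE h']; rewrite /swap h h'.
by rewrite [RHS](reindex_inj (perm_inj (s := tperm i0 j0))).
Qed.

Lemma sum_swap K : \sum_j swap K j = \sum_j K j.
Proof.
have ji : j0 != i0 by rewrite eq_sym.
rewrite (bigD1 i0)//= (bigD1 j0)//= [RHS](bigD1 i0)//= [X in _ = _ + X](bigD1 j0)//=.
rewrite /swap eqxx (negbTE ji) eqxx !addrA; congr (_ + _); first by ring.
by apply: eq_bigr => j /andP[/negbTE h /negbTE h']; rewrite /swap h h'.
Qed.

Definition restr (K : 'I_r.+1 -> int) : {ffun 'I_r -> int} :=
  [ffun i => K (lift ord0 i)].

Lemma ext_restr K : ext (\sum_j K j) (restr K) = K.
Proof.
apply/funext => j; rewrite /ext; case: unliftP => [i ->|->]; first by rewrite ffunE.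
have -> : wt (restr K) = \sum_i K (lift ord0 i).
  by apply: eq_bigr => i _; rewrite ffunE.
by rewrite big_ord_recl addrK.
Qed.

Lemma restr_ext n k : restr (ext n k) = k.
Proof. by apply/ffunP => i; rewrite ffunE ext_lift. Qed.

(* Swapping the two coordinates reverses the sign of the Vandermonde product
   and preserves the other factors. *)
Lemma cterm_sum_degenerate n W :
  has_sum (fun k => cterm q a b x C (ext n k)) W -> W = 0.
Proof.
move=> hW; pose h k := restr (swap (ext n k)).
have eh k : ext n (h k) = swap (ext n k).
  by rewrite -[RHS]ext_restr sum_swap sum_ext.
have hK : cancel h h by move=> k; rewrite {1}/h eh swapK restr_ext.
have h1 := has_sum_reindex hK hK hW.
have h2 : has_sum (fun k => cterm q a b x C (ext n (h k))) (-1 * W).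
  by apply: has_sum_eq (has_sumZ (-1) hW) => k; rewrite eh cterm_swap mulN1r.
have /eqP := has_sum_unique h1 h2; rewrite mulN1r -subr_eq0 opprK -mulr2n.
by rewrite mulrn_eq0 => /eqP.
Qed.

End Degenerate.

(** * Closed form of the sum with the linear factor *)

Section GustafsonC.
Variables (R : realType) (r : nat) (q : R[i]) (a b x : 'I_r.+1 -> R[i]) (C : R[i]).
Hypotheses (q0 : q != 0) (q1 : cabs q < 1) (r0 : (0 < r)%N).
Hypotheses (x0 : forall j, x j != 0) (a0 : forall j, a j != 0).
Hypothesis qxa : forall i j, qpochinf q (q / (x i * a j)) != 0.
Hypothesis qbx : forall i j, qpochinf q (b j * x i) != 0.

Let A := \prod_j a j.
Let X := \prod_j x j.
Let be := \prod_j (b j / q).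

Hypothesis conv : cabs (be / A) < 1.

Lemma gustafson_c :
  has_sum (fun k => cterm q a b x C (ext 0 k))
    (vdm x * (((1 - be * X) * \prod_j (C - a j) - (1 - A * X) * \prod_j (C - b j / q))
              / ((-1) ^+ r.+1 * (A - be)))
     * ((\prod_j \prod_i qpochinf q (q * x i / x j)) * qpochinf q (q / (A * X))
         * qpochinf q (q * be * X) * (\prod_j \prod_l qpochinf q (b j / a l))
       / (qpochinf q q * (\prod_j \prod_i qpochinf q (b j * x i))
         * qpochinf q (q * be / A) * \prod_j \prod_l qpochinf q (q / (x j * a l))))).
Proof.
have A0 : A != 0 by exact/prodf_neq0.
have X0 : X != 0 by exact/prodf_neq0.
have ax : a_regular q a x.
  move=> i j n; apply: contra (qpochinf_factor q1 (qxa i j) n) => /eqP e.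
  have h : x i * a j != 0 by rewrite mulf_neq0.
  by rewrite mulrAC -exprS -e [a j * _]mulrC mulfV.
have bx : b_regular q b x by move=> i j n; exact: (qpochinf_factor q1 (qbx i j) n).
have beE : be = (\prod_j b j) / q ^+ r.+1.
  by rewrite /be big_split/= prodr_const card_ord exprVn.
have qr : q ^+ r.+1 != 0 by rewrite expf_neq0.
have ba : cabs (\prod_j b j / A) < cabs q ^+ r.+1.
  rewrite -cabsX -[ltRHS]mul1r -ltr_pdivrMr ?cabs_gt0// -cabsV -cabsM.
  by rewrite (_ : _ / _ / _ = be / A)// beE; field; rewrite qr A0.
have qn0 : qpochinf q q != 0 by exact: qpochinf_small_neq0.
have qt0 : qpochinf q (q * be / A) != 0.
  apply: qpochinf_small_neq0 => //; rewrite -mulrA cabsM.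
  by rewrite (le_lt_trans _ conv)// ler_piMl ?cabs_ge0// ltW.
have P10 : \prod_j \prod_i qpochinf q (b j * x i) != 0.
  by apply/prodf_neq0 => j _; apply/prodf_neq0 => i _; exact: qbx.
have P20 : \prod_j \prod_l qpochinf q (q / (x j * a l)) != 0.
  by apply/prodf_neq0 => j _; apply/prodf_neq0 => i _; exact: qxa.
have [gx|ngx] := pselect (generic q x).
  have [F hF [W hW e]] := gustafson_cterm q0 q1 r0 gx ax a0 C bx ba.
  have := gustafson_6psi6 q0 q1 r0 gx ax a0 bx ba hF; rewrite -/A -/X.
  have -> : (\prod_j b j) / (q ^+ r * A) = q * be / A.
    by rewrite beE exprS; field; rewrite q0 A0 expf_neq0.
  have -> : (\prod_j b j) / q ^+ r * X = q * be * X.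
    by rewrite beE exprS; field; rewrite q0 expf_neq0.
  move: e; rewrite -/A -/X -/be; move: P10 P20 qn0 qt0.
  set P1 := \prod_j \prod_i qpochinf q (b j * x i).
  set P2 := \prod_j \prod_l qpochinf q (q / (x j * a l)).
  set P3 := \prod_j \prod_i qpochinf q (q * x i / x j).
  set P4 := \prod_j \prod_l qpochinf q (b j / a l).
  set Q1 := qpochinf q q; set Q2 := qpochinf q (q * be / A).
  set Q3 := qpochinf q (q / (A * X)); set Q4 := qpochinf q (q * be * X).
  set S := (1 - be * X) * \prod_j (C - a j) - (1 - A * X) * \prod_j (C - b j / q).
  move=> P10 P20 Q10 Q20 eW eF.
  have Ab : A - be != 0.
    rewrite subr_eq0; apply/eqP => Abe.
    by move: conv; rewrite -Abe divff// cabs1 ltxx.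
  have sg0 : (-1) ^+ r.+1 != 0 :> R[i] by rewrite signr_eq0.
  set sg : R[i] := (-1) ^+ r.+1 in eW sg0 *.
  have FE : F = vdm x * P3 * Q3 * (Q4 * P4) / (P1 * Q2 * (Q1 * P2)).
    by rewrite -eF; field; rewrite P10 P20 Q10 Q20.
  have WE : W = F * S / (sg * (A - be)).
    by rewrite -eW mulfK// mulf_neq0.
  rewrite [X in has_sum _ X](_ : _ = W)//.
  by rewrite WE FE; field; rewrite P10 P20 Q10 Q20 Ab sg0.
have [i [j [s [ij xij]]]] : exists i j s, i != j /\ x i = x j * q ^ s.
  apply: contrapT => h; apply: ngx; split => // i j s ij; apply/eqP => e.
  by apply: h; exists i, j, s.
have [la [M [la0 la1 M0 hM]]] := decay_uniform q0 q1 x0 ax a0 ord0 bx ba.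
have dec : decay q a b x.
  exists la, M; split => // l k; have := hM 0%N l k.
  by rewrite expr0 scale_at1.
have [W hW] := summable_cterm q0 q1 C 0 r0 dec.
rewrite [X in has_sum _ X](_ : _ = W)//.
rewrite (cterm_sum_degenerate q0 ax bx ij xij hW).
have qs (n : nat) : qpochinf q (q * q ^ (- n.+1%:Z)) = 0.
  apply/eqP/(qpochinf_eq0P q1); exists n.
  by rewrite mulrAC -exprS -exprnN mulfV// expf_neq0.
have P3z (k l : 'I_r.+1) : qpochinf q (q * x k / x l) = 0 ->
    \prod_j \prod_i qpochinf q (q * x i / x j) = 0.
  by move=> h; rewrite (bigD1 l)//= (bigD1 k)//= h !mul0r.
(* The closed form vanishes as well: for [s = 0] through [vdm x], for [s > 0] through
   [(q x_j / x_i)_oo], for [s < 0] through [(q x_i / x_j)_oo]. *)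
case: s xij => [[|n]|n] xij.
- have -> : vdm x = 0; last by rewrite !mul0r.
  by rewrite (vdm_minorE i) (bigD1 j) 1?eq_sym//= xij expr0z mulr1 subrr mul0r mulr0.
- rewrite (P3z j i) ?mul0r ?mulr0//.
  rewrite xij -(qs n) -exprnN; congr qpochinf.
  by rewrite -exprnP; field; rewrite x0 expf_neq0.
- rewrite (P3z i j) ?mul0r ?mulr0//.
  rewrite xij -(qs n) NegzE; congr qpochinf.
  by rewrite -exprnN; field; rewrite x0 expf_neq0.
Qed.

End GustafsonC.

(** * The r-dimensional form *)

Section Reflection.
Variables (R : realType) (q : R[i]).
Hypothesis q0 : q != 0.
Implicit Types (y : R[i]) (w : int).

(** This is [(-1)^w q^(w (w + 1) / 2)] for either sign of [w], written as a product to match [qpoch]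
    factor by factor; it cancels in [qpoch_reflect]. *)
Definition refl_const w : R[i] :=
  match w with
  | Posz n => \prod_(0 <= j < n) - q ^+ j.+1
  | Negz n => \prod_(0 <= j < n.+1) - q ^+ j
  end.

Lemma refl_const_neq0 w : refl_const w != 0.
Proof.
by case: w => n; rewrite /= big_mkord; apply/prodf_neq0 => j _;
  rewrite oppr_eq0 expf_neq0.
Qed.

Lemma qpochN y w : y != 0 ->
  qpoch q y (- w) = refl_const w * y ^ (- w) * (qpoch q (q / y) w)^-1.
Proof.
move=> y0; have yn (n : nat) : y ^+ n = \prod_(0 <= j < n) y.
  by rewrite big_mkord prodr_const card_ord.
case: w => [[|n]|n].
- by rewrite oppr0 /= !qprod0 big_geq// invr1 !mulr1.
- rewrite -[- Posz n.+1]/(Negz n) /= -[y ^ _]/((y ^+ n.+1)^-1) yn.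
  rewrite -[LHS]prodfV -[X in _ * X * _]prodfV -[X in _ * X]prodfV.
  rewrite -!big_split; apply: eq_bigr => j _ /=.
  have qj : q ^+ j != 0 by rewrite expf_neq0.
  rewrite -[- q ^+ j.+1]invrK -!invfM; congr (_^-1).
  by rewrite exprS; field; rewrite q0 y0 qj.
- rewrite -[- Negz n]/(Posz n.+1) /= invrK -exprnP yn -!big_split.
  apply: eq_bigr => j _ /=; have qj : q ^+ j != 0 by rewrite expf_neq0.
  by rewrite exprS; field; rewrite q0 y0 qj.
Qed.

Lemma qpoch_reflect y y' w : y != 0 -> y' != 0 ->
  qpoch q y (- w) / qpoch q y' (- w) =
  (y' / y) ^ w * (qpoch q (q / y') w / qpoch q (q / y) w).
Proof.
move=> y0 y'0; rewrite !qpochN// expfzMl exprz_inv -[y' ^ (- w)]invr_expz.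
rewrite !invfM !invrK -[RHS]mul1r -(divff (refl_const_neq0 w)); ring.
Qed.

End Reflection.

Section Cons.
Variables (K : comUnitRingType) (r : nat).

Definition ucons (v0 : K) (v : 'I_r -> K) : 'I_r.+1 -> K :=
  fun j => if unlift ord0 j is Some i then v i else v0.

Lemma ucons0 v0 v : ucons v0 v ord0 = v0.
Proof. by rewrite /ucons unlift_none. Qed.

Lemma uconsS v0 v i : ucons v0 v (lift ord0 i) = v i.
Proof. by rewrite /ucons liftK. Qed.

Lemma vdm_recl (u : 'I_r.+1 -> K) : vdm u =
  \prod_j (u ord0 - u (lift ord0 j)) *
  \prod_(i < r) \prod_(j < r | (i < j)%N) (u (lift ord0 i) - u (lift ord0 j)).
Proof.
rewrite /vdm big_ord_recl big_mkcond big_ord_recl/= mul1r; congr (_ * _).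
apply: eq_bigr => i _; rewrite big_mkcond big_ord_recl/= mul1r [RHS]big_mkcond.
by apply: eq_bigr => j _.
Qed.

End Cons.

Section Translation.
Variables (R : realType) (r : nat) (q a c f g : R[i]) (b e z : 'I_r -> R[i]).
Hypotheses (q0 : q != 0) (a0 : a != 0) (c0 : c != 0) (f0 : f != 0) (g0 : g != 0).
Hypotheses (b0 : forall i, b i != 0) (e0 : forall i, e i != 0) (z0 : forall i, z i != 0).

Let B := \prod_i b i.
Let E := \prod_i e i.

(* The factors of the summand which depend on [|k|] are those attached to the
   coordinate [k_0 = - |k|], up to the reflection [qpoch_reflect]. *)
Definition nodes := ucons a^-1 z.
(** In row 0 reflection exchanges the roles: the upper parameters give the denominators [a q / f]
    and [a z_j q / e_j], the lower ones the numerators [g] and [b_j z_j]. *)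
Definition upper_params := ucons f (fun j => e j / z j).
Definition lower_params := ucons (a * q / g) (fun j => a * q / (b j * z j)).

Lemma node_ext0 (k : {ffun 'I_r -> int}) : node q nodes (ext 0 k) ord0 = a^-1 * q ^ (- wt k).
Proof. by rewrite /node ext0 sub0r /nodes ucons0. Qed.

Lemma node_extS (k : {ffun 'I_r -> int}) i :
  node q nodes (ext 0 k) (lift ord0 i) = z i * q ^ k i.
Proof. by rewrite /node ext_lift /nodes uconsS. Qed.

Lemma rho_extS i n : rho q upper_params lower_params (z i) n =
  qpoch q (f * z i) n / qpoch q (a * z i * q / g) n *
  \prod_(j < r) (qpoch q (e j * z i / z j) n / qpoch q (a * z i * q / (b j * z j)) n).
Proof.
rewrite /rho big_ord_recl /upper_params /lower_params !ucons0; congr (_ / qpoch _ _ _ * _).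
  by ring.
apply: eq_bigr => j _; rewrite !uconsS; congr (qpoch _ _ _ / qpoch _ _ _).
  by ring.
by ring.
Qed.

Lemma rho_ext0 n : rho q upper_params lower_params a^-1 (- n) =
  (a ^+ r.+1 / (B * E * f * g)) ^ n * q ^ n * (q ^ n) ^+ r *
  (qpoch q g n / qpoch q (a * q / f) n *
  \prod_(j < r) (qpoch q (b j * z j) n / qpoch q (a * z j * q / e j) n)).
Proof.
rewrite /rho big_ord_recl /upper_params /lower_params !ucons0.
rewrite qpoch_reflect ?mulf_neq0 ?invr_neq0//.
have -> : q / (a * q / g / a) = g by field; rewrite g0 q0 a0.
have -> : q / (f / a) = a * q / f by field; rewrite f0 a0.
have -> : \prod_(i < r) (qpoch q (ucons f (fun j => e j / z j) (lift ord0 i) / a) (- n)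
     / qpoch q (ucons (a * q / g) (fun j => a * q / (b j * z j)) (lift ord0 i) / a) (- n)) =
  (\prod_(j < r) (a * q / (b j * e j))) ^ n *
  \prod_(j < r) (qpoch q (b j * z j) n / qpoch q (a * z j * q / e j) n).
  have <- : \prod_(j < r) ((a * q / (b j * e j)) ^ n) = (\prod_(j < r) (a * q / (b j * e j))) ^ n.
    by rewrite (big_morph (fun u : R[i] => u ^ n) (fun u v => expfzMl u v n) (exp1rz _ n)).
  rewrite -big_split; apply: eq_bigr => j _ /=; rewrite !uconsS.
  rewrite qpoch_reflect ?mulf_neq0 ?invr_neq0// ?mulf_neq0//.
  congr (_ * (_ / _)); [congr (_ ^ _)|congr qpoch|congr qpoch].
  - by field; rewrite ?e0 ?b0 ?a0 ?z0.
  - by field; rewrite ?e0 ?b0 ?a0 ?z0 ?q0.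
  - by field; rewrite ?e0 ?b0 ?a0 ?z0 ?q0.
have -> : (a ^+ r.+1 / (B * E * f * g)) ^ n * q ^ n * (q ^ n) ^+ r =
    (a ^+ r.+1 / (B * E * f * g) * q * q ^+ r) ^ n.
  rewrite !expfzMl; congr (_ * _).
  by have := exprzAC q n (Posz r).
have -> : a ^+ r.+1 / (B * E * f * g) * q * q ^+ r =
    a * q / g / a / (f / a) * \prod_(j < r) (a * q / (b j * e j)).
  rewrite big_split/= prodr_const card_ord prodfV big_split/= -/B -/E exprMn exprS.
  have B0 : B != 0 by exact/prodf_neq0.
  have E0 : E != 0 by exact/prodf_neq0.
  by field; rewrite B0 E0 f0 g0 a0.
by rewrite [in RHS]expfzMl; ring.
Qed.

(** The prefactor is the inverse of [cterm] at [k = 0]: the denominators of the summand normalise it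
    to 1 there. *)
Lemma summandE (k : {ffun 'I_r -> int}) :
  (forall i j : 'I_r, (i < j)%N -> z i - z j != 0) ->
  (forall i, 1 - a * z i != 0) ->
  (forall i, 1 - a * z i * q / c != 0) ->
  1 - c / q != 0 ->

       (\prod_(i < r) \prod_(j < r | (i < j)%N)
          ((z i * q ^ k i - z j * q ^ k j) / (z i - z j)))
     * (\prod_(i < r) ((1 - a * z i * q ^ (k i + wt k)) / (1 - a * z i)))
     * (\prod_(i < r) \prod_(j < r)
          (qpoch q (e j * z i / z j) (k i)
           / qpoch q (a * z i * q / (b j * z j)) (k i)))
     * (\prod_(i < r)
          (qpoch q (b i * z i) (wt k) * qpoch q (f * z i) (k i)
           / (qpoch q (a * z i * q / e i) (wt k)
              * qpoch q (a * z i * q / g) (k i))))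
     * (qpoch q g (wt k) / qpoch q (a * q / f) (wt k))
     * ((1 - c * q ^ (wt k - 1)) / (1 - c / q))
     * (\prod_(i < r)
          ((1 - a * z i * q ^ (k i + 1) / c) / (1 - a * z i * q / c)))
     * (a ^+ r.+1 / (B * E * f * g)) ^ wt k
  = (vdm nodes * \prod_j (1 - a * q / c * nodes j))^-1 * cterm q upper_params lower_params nodes (a * q / c) (ext 0 k).
Proof.
move=> zz az azc cq; set w := wt k; set C := a * q / c.
pose Q := q ^ w; have Q0 : Q != 0 by rewrite expfz_neq0.
have QN : q ^ (- w) = Q^-1 by rewrite invr_expz.
rewrite /cterm /sterm !vdm_recl.
have exs0 : nodes ord0 = a^-1 by rewrite /nodes ucons0.
have exsS i : nodes (lift ord0 i) = z i by rewrite /nodes uconsS.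
have h1 : \prod_(i < r) \prod_(j < r | (i < j)%N) (node q nodes (ext 0 k) (lift ord0 i)
      - node q nodes (ext 0 k) (lift ord0 j)) =
    \prod_(i < r) \prod_(j < r | (i < j)%N) (nodes (lift ord0 i) - nodes (lift ord0 j)) *
    \prod_(i < r) \prod_(j < r | (i < j)%N)
       ((z i * q ^ k i - z j * q ^ k j) / (z i - z j)).
  rewrite -big_split; apply: eq_bigr => i _ /=; rewrite -big_split.
  apply: eq_bigr => j ij /=; rewrite !node_extS !exsS.
  by rewrite [RHS]mulrC divfK// zz.
have h2 : \prod_(j < r) (node q nodes (ext 0 k) ord0 - node q nodes (ext 0 k) (lift ord0 j)) =
    Q^-1 ^+ r * \prod_(j < r) (nodes ord0 - nodes (lift ord0 j)) *
    \prod_(i < r) ((1 - a * z i * q ^ (k i + w)) / (1 - a * z i)).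
  have -> : Q^-1 ^+ r = \prod_(j < r) Q^-1 by rewrite prodr_const card_ord.
  rewrite -!big_split; apply: eq_bigr => j _ /=.
  rewrite node_ext0 node_extS exs0 exsS QN expfzDr// -/Q.
  by field; rewrite az Q0 a0.
have h3 : \prod_(j < r.+1) rho q upper_params lower_params (nodes j) (ext 0 k j) =
    rho q upper_params lower_params a^-1 (- w) *
    (\prod_(i < r) (qpoch q (f * z i) (k i) / qpoch q (a * z i * q / g) (k i)) *
     \prod_(i < r) \prod_(j < r)
          (qpoch q (e j * z i / z j) (k i)
           / qpoch q (a * z i * q / (b j * z j)) (k i))).
  rewrite big_ord_recl exs0 ext0 sub0r -/w -big_split; congr (_ * _).
  by apply: eq_bigr => i _; rewrite exsS ext_lift rho_extS.
have h5 : 1 - C * node q nodes (ext 0 k) ord0 =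
    (1 - C * nodes ord0) * Q^-1 * ((1 - c * q ^ (w - 1)) / (1 - c / q)).
  rewrite node_ext0 exs0 QN expfzDr// -/Q -[q ^ (-1)]/(q^-1) /C.
  have qc : q - c != 0.
    have -> : q - c = (1 - c / q) * q by field.
    by rewrite mulf_neq0.
  by field; rewrite ?mulN1r ?Q0 ?a0 ?c0 ?q0 ?qc.
have h6 : \prod_(i < r) (1 - C * node q nodes (ext 0 k) (lift ord0 i)) =
    \prod_(i < r) (1 - C * nodes (lift ord0 i)) *
    \prod_(i < r) ((1 - a * z i * q ^ (k i + 1) / c) / (1 - a * z i * q / c)).
  rewrite -big_split; apply: eq_bigr => i _ /=; rewrite node_extS exsS expfzDr// expr1z /C.
  have -> : 1 - a * q / c * z i = 1 - a * z i * q / c by ring.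
  by rewrite [RHS]mulrC divfK//; ring.
have h7 : \prod_(i < r) (qpoch q (b i * z i) w * qpoch q (f * z i) (k i)
           / (qpoch q (a * z i * q / e i) w * qpoch q (a * z i * q / g) (k i))) =
    \prod_(i < r) (qpoch q (b i * z i) w / qpoch q (a * z i * q / e i) w) *
    \prod_(i < r) (qpoch q (f * z i) (k i) / qpoch q (a * z i * q / g) (k i)).
  by rewrite -big_split; apply: eq_bigr => i _ /=; rewrite invfM; ring.
have n1 : \prod_(i < r) \prod_(j < r | (i < j)%N) (nodes (lift ord0 i) - nodes (lift ord0 j)) != 0.
  by apply/prodf_neq0 => i _; apply/prodf_neq0 => j ij; rewrite !exsS zz.
have n2 : \prod_(j < r) (nodes ord0 - nodes (lift ord0 j)) != 0.
  apply/prodf_neq0 => j _; rewrite exs0 exsS.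
  have -> : a^-1 - z j = a^-1 * (1 - a * z j) by field.
  by rewrite mulf_neq0// invr_neq0.
have n3 : 1 - C * nodes ord0 != 0.
  have -> : 1 - C * nodes ord0 = - (q / c) * (1 - c / q).
    by rewrite exs0 /C; field; rewrite a0 c0 q0.
  by rewrite mulf_neq0// oppr_eq0 mulf_neq0// invr_neq0.
have n4 : \prod_(i < r) (1 - C * nodes (lift ord0 i)) != 0.
  apply/prodf_neq0 => i _; rewrite exsS.
  have -> : 1 - C * z i = 1 - a * z i * q / c by rewrite /C; ring.
  exact: azc.
have eD : \prod_(j < r.+1) (1 - C * nodes j) = (1 - C * nodes ord0) *
  \prod_(i < r) (1 - C * nodes (lift ord0 i)) by rewrite big_ord_recl.
have eN : \prod_(j < r.+1) (1 - C * node q nodes (ext 0 k) j) =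
  (1 - C * node q nodes (ext 0 k) ord0) *
  \prod_(i < r) (1 - C * node q nodes (ext 0 k) (lift ord0 i)) by rewrite big_ord_recl.
rewrite eD eN h1 h2 h3 h5 h6 h7 rho_ext0 -/Q.
move: n1 n2 n3 n4.
set D1 := \prod_(i < r) \prod_(j < r | _) (nodes _ - nodes _).
set D2 := \prod_(j < r) (nodes _ - nodes _).
set D3 := 1 - C * nodes ord0.
set D4 := \prod_(i < r) (1 - C * _).
move=> n1 n2 n3 n4.
set T1 := \prod_(i < r) \prod_(j < r | _) (_ / _).
set T2 := \prod_(i < r) ((1 - _ * q ^ _) / _).
set T3 := \prod_(i < r) \prod_(j < r) _.
set T4 := \prod_(i < r) (_ / _).
set T5 := \prod_(i < r) (_ / _).
set T6 := \prod_(i < r) (_ / _).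
set G1 := qpoch q g w / _.
set G2 := (1 - c * _) / _.
set tw := (_ / _) ^ w.
have Qr0 : Q ^+ r != 0 by rewrite expf_neq0.
rewrite exprVn.
by field; rewrite ?n1 ?n2 ?n3 ?n4 ?Q0 ?Qr0.
Qed.

End Translation.

(** * The identity in the original parameters *)

Lemma vdm_nodes_neq0 (R : realType) (r : nat) (a : R[i]) (z : 'I_r -> R[i]) :
  a != 0 -> (forall i j : 'I_r, (i < j)%N -> z i - z j != 0) ->
  (forall i, 1 - a * z i != 0) -> vdm (nodes a z) != 0.
Proof.
move=> a0 zz az; rewrite vdm_recl; apply: mulf_neq0.
  apply/prodf_neq0 => j _; rewrite /nodes ucons0 uconsS.
  have -> : a^-1 - z j = a^-1 * (1 - a * z j) by field.
  by rewrite mulf_neq0// invr_neq0.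
by apply/prodf_neq0 => i _; apply/prodf_neq0 => j ij; rewrite /nodes !uconsS zz.
Qed.

Lemma prod2_ord_recl (R : comPzRingType) (r : nat) (F : 'I_r.+1 -> 'I_r.+1 -> R) :
  \prod_i \prod_j F i j =
  F ord0 ord0 * \prod_(j < r) F ord0 (lift ord0 j)
  * \prod_(i < r) F (lift ord0 i) ord0
  * \prod_(j < r) \prod_(i < r) F (lift ord0 i) (lift ord0 j).
Proof.
have e (i : 'I_r) : \prod_j F (lift ord0 i) j = F (lift ord0 i) ord0 *
    \prod_(j < r) F (lift ord0 i) (lift ord0 j) by rewrite big_ord_recl.
rewrite big_ord_recl (eq_bigr _ (fun i _ => e i)) big_split/= mulrA big_ord_recl.
by congr (_ * _); rewrite exchange_big.
Qed.

Theorem theorem3p4 (R : realType) (r : nat) (q a c f g : R[i])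
    (b e z : 'I_r -> R[i]) :
  let B := \prod_i b i in
  let E := \prod_i e i in
  (1 <= r)%N ->
  `|q| < 1 ->
  `|a ^+ r.+1 / (B * E * f * g)| < 1 ->
  (* None of the denominators vanishes.  The conditions on infinite products
     also cover the shifted factorials of the summand: those on
     a z_i q / (b_j z_j), a z_i q / e_i, a z_i q / g, a q / f for k >= 0, and
     those on z_i q / (e_i z_j), q / (b_i z_i), q / (f z_i), q / g for the
     poles of the numerators at k < 0. *)
  q != 0 -> a != 0 -> c != 0 -> f != 0 -> g != 0 ->
  (forall i, [&& b i != 0, e i != 0 & z i != 0]) ->
  (forall i j : 'I_r, (i < j)%N -> z i - z j != 0) ->
  (forall i, 1 - a * z i != 0) ->
  (forall i, 1 - a * z i * q / c != 0) ->
  1 - c / q != 0 ->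
  1 - c / (g * q) != 0 ->
  1 - E * f / a != 0 ->
  (forall i, 1 - c / (b i * z i * q) != 0) ->
  (forall i, 1 - c / (a * z i * q) != 0) ->
  qpochinf q (a ^+ r.+1 / (B * E * f * g)) != 0 ->
  qpochinf q (a * q / f) != 0 ->
  qpochinf q (q / g) != 0 ->
  (forall i j, qpochinf q (a * z i * q / (b j * z j)) != 0) ->
  (forall i j, qpochinf q (z i * q / (e i * z j)) != 0) ->
  (forall i, qpochinf q (a * z i * q / e i) != 0) ->
  (forall i, qpochinf q (a * z i * q / g) != 0) ->
  (forall i, qpochinf q (q / (b i * z i)) != 0) ->
  (forall i, qpochinf q (q / (f * z i)) != 0) ->
  has_sum
    (fun k : {ffun 'I_r -> int} =>
       (\prod_(i < r) \prod_(j < r | (i < j)%N)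
          ((z i * q ^ k i - z j * q ^ k j) / (z i - z j)))
     * (\prod_(i < r) ((1 - a * z i * q ^ (k i + wt k)) / (1 - a * z i)))
     * (\prod_(i < r) \prod_(j < r)
          (qpoch q (e j * z i / z j) (k i)
           / qpoch q (a * z i * q / (b j * z j)) (k i)))
     * (\prod_(i < r)
          (qpoch q (b i * z i) (wt k) * qpoch q (f * z i) (k i)
           / (qpoch q (a * z i * q / e i) (wt k)
              * qpoch q (a * z i * q / g) (k i))))
     * (qpoch q g (wt k) / qpoch q (a * q / f) (wt k))
     * ((1 - c * q ^ (wt k - 1)) / (1 - c / q))
     * (\prod_(i < r)
          ((1 - a * z i * q ^ (k i + 1) / c) / (1 - a * z i * q / c)))
     * (a ^+ r.+1 / (B * E * f * g)) ^ wt k)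
    ((1 - (1 - a ^+ r / (B * g)) * (1 - c * f / (a * q))
            / ((1 - c / (g * q)) * (1 - E * f / a))
          * \prod_(i < r)
              ((1 - c * e i / (a * z i * q)) / (1 - c / (b i * z i * q))))
     * (\prod_(i < r) ((1 - c / (b i * z i * q)) / (1 - c / (a * z i * q))))
     * ((1 - c / (g * q)) / (1 - c / q))
     * (qpochinf q (a / (E * f)) * qpochinf q (a * q / (f * g))
          * qpochinf q (a ^+ r * q / (B * g))
        / (qpochinf q (a ^+ r.+1 / (B * E * f * g)) * qpochinf q (a * q / f)
           * qpochinf q (q / g)))
     * (\prod_(i < r) \prod_(j < r)
          (qpochinf q (q * z i / z j)
             * qpochinf q (a * z i * q / (b j * e i * z j))
           / (qpochinf q (a * z i * q / (b j * z j))
              * qpochinf q (z i * q / (e i * z j)))))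
     * (\prod_(i < r)
          (qpochinf q (a * z i * q) * qpochinf q (q / (a * z i))
             * qpochinf q (a * z i * q / (e i * g))
             * qpochinf q (a * q / (b i * f * z i))
           / (qpochinf q (a * z i * q / e i) * qpochinf q (a * z i * q / g)
              * qpochinf q (q / (b i * z i)) * qpochinf q (q / (f * z i)))))).
Proof.
move=> B E r0 nq nt q0 a0 c0 f0 g0 bez zz az azc cq cgq Efa cb ca qt qaf qg qab qze qae qag qb qf.
have b0 i : b i != 0 by have /and3P[] := bez i.
have e0 i : e i != 0 by have /and3P[] := bez i.
have z0 i : z i != 0 by have /and3P[] := bez i.
have q1 : cabs q < 1 by rewrite -ltcR -normE.
have t1 : cabs (a ^+ r.+1 / (B * E * f * g)) < 1 by rewrite -ltcR -normE.
have B0 : B != 0 by exact/prodf_neq0.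
have E0 : E != 0 by exact/prodf_neq0.
pose Z := \prod_i z i; have Z0 : Z != 0 by exact/prodf_neq0.
pose x := nodes a z; pose u := upper_params f e z; pose v := lower_params q a g b z.
have x_0 : x ord0 = a^-1 by rewrite /x /nodes ucons0.
have x_S i : x (lift ord0 i) = z i by rewrite /x /nodes uconsS.
have u_0 : u ord0 = f by rewrite /u /upper_params ucons0.
have u_S i : u (lift ord0 i) = e i / z i by rewrite /u /upper_params uconsS.
have v_0 : v ord0 = a * q / g by rewrite /v /lower_params ucons0.
have v_S i : v (lift ord0 i) = a * q / (b i * z i) by rewrite /v /lower_params uconsS.
have x0 j : x j != 0.
  by case: (unliftP ord0 j) => [i ->|->]; rewrite ?x_S ?x_0 ?invr_neq0.
have u0 j : u j != 0.
  by case: (unliftP ord0 j) => [i ->|->]; rewrite ?u_S ?u_0 ?mulf_neq0 ?invr_neq0.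
have AE : \prod_j u j = f * E / Z.
  rewrite big_ord_recl u_0 -mulrA; congr (_ * _); rewrite /E /Z -prodfV -big_split.
  by apply: eq_bigr => i _; rewrite u_S.
have XE : \prod_j x j = Z / a.
  rewrite big_ord_recl x_0 mulrC; congr (_ * _).
  by apply: eq_bigr => i _; rewrite x_S.
pose ar := a ^+ r; have ar0 : ar != 0 by rewrite expf_neq0.
have beE : \prod_j (v j / q) = a * ar / (g * B * Z).
  rewrite big_ord_recl v_0.
  have -> : \prod_(i < r) (v (lift ord0 i) / q) = ar / (B * Z).
    have -> : ar = \prod_(i < r) a by rewrite prodr_const card_ord.
    rewrite /B /Z -big_split -prodfV -big_split; apply: eq_bigr => i _ /=.
    by rewrite v_S; field; rewrite q0 b0 z0.
  by field; rewrite q0 g0 B0 Z0.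
have tE : a ^+ r.+1 / (B * E * f * g) = a * ar / (B * E * f * g) by rewrite exprS.
rewrite tE in t1 qt *.
have conv : cabs ((\prod_j (v j / q)) / \prod_j u j) < 1.
  rewrite beE AE [X in cabs X](_ : _ = a * ar / (B * E * f * g))//.
  by field; rewrite B0 E0 f0 g0 Z0.
(* Separating index 0 in [i] and in [j] gives four blocks here and four in [qvx], one for each of
   eight families of nonvanishing infinite products. *)
have qxu i j : qpochinf q (q / (x i * u j)) != 0.
  case: (unliftP ord0 i) => [i' ->|->]; case: (unliftP ord0 j) => [j' ->|->];
    rewrite ?x_S ?x_0 ?u_S ?u_0.
  - by rewrite (_ : q / _ = z j' * q / (e j' * z i')) ?qze//; field; rewrite z0 e0 z0.
  - by rewrite [z i' * f]mulrC qf.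
  - by rewrite (_ : q / _ = a * z j' * q / e j') ?qae//; field; rewrite a0 z0 e0.
  - by rewrite (_ : q / _ = a * q / f) ?qaf//; field; rewrite a0 f0.
have qvx i j : qpochinf q (v j * x i) != 0.
  case: (unliftP ord0 i) => [i' ->|->]; case: (unliftP ord0 j) => [j' ->|->];
    rewrite ?x_S ?x_0 ?v_S ?v_0.
  - have -> : a * q / (b j' * z j') * z i' = a * z i' * q / (b j' * z j') by ring.
    exact: qab.
  - have -> : a * q / g * z i' = a * z i' * q / g by ring.
    exact: qag.
  - have -> : a * q / (b j' * z j') / a = q / (b j' * z j').
      by field; rewrite a0 z0 b0.
    exact: qb.
  - have -> : a * q / g / a = q / g by field; rewrite a0 g0.
    exact: qg.
pose C := a * q / c.
have main := @gustafson_c _ _ q u v x C q0 q1 r0 x0 u0 qxu qvx conv.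
have V0 := vdm_nodes_neq0 a0 zz az; rewrite -/x in V0.
have := has_sumZ (vdm x * \prod_j (1 - C * x j))^-1 main.
rewrite AE XE beE.
set RHS := (X in _ -> has_sum _ X).
set LHS := (X in has_sum _ X -> _).
suff -> : LHS = RHS.
  by apply: has_sum_eq => k; rewrite -tE -summandE// tE.
rewrite {}/LHS {}/RHS.
(* [gustafson_c] has infinite products at [t * q] and [a / (E * f) * q], where the goal has [t] and
   [a / (E * f)]. Up to monomials, the first factors split off here match [A - be] and
   [1 - A * X]. *)
have inf1 y : qpochinf q y = (1 - y) * qpochinf q (y * q).
  by rewrite (qpochinf_split q1 y 1) qprodS qprod0 mul1r expr0 mulr1 expr1.
have C0 : C != 0 by rewrite /C mulf_neq0 ?invr_neq0 ?mulf_neq0.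
pose Cr := C ^+ r; have Cr0 : Cr != 0 by rewrite expf_neq0.
have CrE : Cr = \prod_(i < r) C by rewrite prodr_const card_ord.
pose sr : R[i] := (-1) ^+ r; have sr2 : sr * sr = 1 by rewrite -expr2 sqrr_sign.
have srE : sr = \prod_(i < r) -1 by rewrite prodr_const card_ord.
pose pz := \prod_(i < r) (1 - c / (a * z i * q)).
pose pb := \prod_(i < r) (1 - c / (b i * z i * q)).
pose pe := \prod_(i < r) (1 - c * e i / (a * z i * q)).
have eC1 : \prod_j (1 - C * x j) = - (C / a) * (1 - c / q) * (sr * Cr * Z * pz).
  rewrite big_ord_recl x_0; congr (_ * _).
    by rewrite /C; field; rewrite a0 c0 q0.
  rewrite srE CrE /Z /pz -!big_split; apply: eq_bigr => i _ /=.
  by rewrite x_S /C; field; rewrite a0 c0 q0 z0.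
have eC2 : \prod_j (C - u j) = C * (1 - c * f / (a * q)) * (Cr * pe).
  rewrite big_ord_recl u_0; congr (_ * _).
    by rewrite /C; field; rewrite a0 c0 q0.
  rewrite CrE /pe -big_split; apply: eq_bigr => i _ /=.
  by rewrite u_S /C; field; rewrite a0 c0 q0 z0.
have eC3 : \prod_j (C - v j / q) = C * (1 - c / (g * q)) * (Cr * pb).
  rewrite big_ord_recl v_0; congr (_ * _).
    by rewrite /C; field; rewrite g0 c0 q0.
  rewrite CrE /pb -big_split; apply: eq_bigr => i _ /=.
  by rewrite v_S /C; field; rewrite b0 c0 q0 z0.
pose p1 := \prod_(i < r) \prod_(j < r) qpochinf q (q * z i / z j).
pose p2 := \prod_(i < r) \prod_(j < r) qpochinf q (a * z i * q / (b j * e i * z j)).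
pose p3 := \prod_(i < r) \prod_(j < r) qpochinf q (a * z i * q / (b j * z j)).
pose p4 := \prod_(i < r) \prod_(j < r) qpochinf q (z i * q / (e i * z j)).
pose s1 := \prod_(i < r) qpochinf q (a * z i * q).
pose s2 := \prod_(i < r) qpochinf q (q / (a * z i)).
pose s3 := \prod_(i < r) qpochinf q (a * z i * q / (e i * g)).
pose s4 := \prod_(i < r) qpochinf q (a * q / (b i * f * z i)).
pose s5 := \prod_(i < r) qpochinf q (a * z i * q / e i).
pose s6 := \prod_(i < r) qpochinf q (a * z i * q / g).
pose s7 := \prod_(i < r) qpochinf q (q / (b i * z i)).
pose s8 := \prod_(i < r) qpochinf q (q / (f * z i)).
(* The block of index 0 contributes [(q; q)_oo], cancelling the one in the denominator of
   [gustafson_c]. *)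
have eP1 : \prod_j \prod_i qpochinf q (q * x i / x j) = qpochinf q q * s1 * s2 * p1.
  rewrite prod2_ord_recl x_0 mulfK ?invr_neq0//; congr (_ * _ * _ * _).
  - apply: eq_bigr => i _; rewrite x_S; congr qpochinf; by field.
  - apply: eq_bigr => i _; rewrite x_S; congr qpochinf; by field; rewrite z0 a0.
  - by apply: eq_bigr => i _; apply: eq_bigr => j _; rewrite !x_S.
have eP2 : \prod_j \prod_i qpochinf q (v j * x i) = qpochinf q (q / g) * s6 * s7 * p3.
  rewrite prod2_ord_recl x_0 v_0; congr (_ * _ * _ * _).
  - congr qpochinf; by field; rewrite a0 g0.
  - apply: eq_bigr => i _; rewrite x_S; congr qpochinf; by field.
  - apply: eq_bigr => i _; rewrite v_S; congr qpochinf; by field; rewrite z0 a0 b0.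
  - apply: eq_bigr => i _; apply: eq_bigr => j _; rewrite x_S v_S.
    congr qpochinf; by field; rewrite z0 b0.
have eP3 : \prod_j \prod_l qpochinf q (q / (x j * u l)) =
    qpochinf q (a * q / f) * s5 * s8 * p4.
  rewrite prod2_ord_recl x_0 u_0; congr (_ * _ * _ * _).
  - congr qpochinf; by field; rewrite a0 f0.
  - apply: eq_bigr => i _; rewrite u_S; congr qpochinf; by field; rewrite a0 z0 e0.
  - by apply: eq_bigr => i _; rewrite x_S [z i * f]mulrC.
  - apply: eq_bigr => i _; apply: eq_bigr => j _; rewrite x_S u_S.
    congr qpochinf; by field; rewrite !z0 e0.
have eP4 : \prod_j \prod_l qpochinf q (v j / u l) =
    qpochinf q (a * q / (f * g)) * s3 * s4 * p2.
  rewrite prod2_ord_recl v_0 u_0; congr (_ * _ * _ * _).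
  - congr qpochinf; by field; rewrite g0 f0.
  - apply: eq_bigr => i _; rewrite u_S; congr qpochinf; by field; rewrite g0 z0 e0.
  - apply: eq_bigr => i _; rewrite v_S; congr qpochinf; by field; rewrite z0 b0 f0.
  - apply: eq_bigr => i _; apply: eq_bigr => j _; rewrite v_S u_S.
    congr qpochinf; by field; rewrite !z0 e0 b0.
have nzprod (F : 'I_r -> R[i]) : (forall i, F i != 0) -> \prod_(i < r) F i != 0.
  by move=> h; apply/prodf_neq0 => i _.
have s50 : s5 != 0 by exact: nzprod.
have s60 : s6 != 0 by exact: nzprod.
have s70 : s7 != 0 by exact: nzprod.
have s80 : s8 != 0 by exact: nzprod.
have p30 : p3 != 0 by apply: (nzprod _) => i; apply: nzprod => j; exact: qab.
have p40 : p4 != 0 by apply: (nzprod _) => i; apply: nzprod => j; exact: qze.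
have pz0 : pz != 0 by exact: nzprod.
have pb0 : pb != 0 by exact: nzprod.
have Tp : \prod_(i < r) \prod_(j < r) (qpochinf q (q * z i / z j)
             * qpochinf q (a * z i * q / (b j * e i * z j))
           / (qpochinf q (a * z i * q / (b j * z j))
              * qpochinf q (z i * q / (e i * z j)))) = p1 * p2 / (p3 * p4).
  rewrite /p1 /p2 /p3 /p4 -!big_split -prodfV -big_split; apply: eq_bigr => i _ /=.
  by rewrite -!big_split -prodfV -big_split.
have Ts : \prod_(i < r) (qpochinf q (a * z i * q) * qpochinf q (q / (a * z i))
             * qpochinf q (a * z i * q / (e i * g))
             * qpochinf q (a * q / (b i * f * z i))
           / (qpochinf q (a * z i * q / e i) * qpochinf q (a * z i * q / g)
              * qpochinf q (q / (b i * z i)) * qpochinf q (q / (f * z i)))) =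
    s1 * s2 * s3 * s4 / (s5 * s6 * s7 * s8).
  by rewrite /s1 /s2 /s3 /s4 /s5 /s6 /s7 /s8 -!big_split -prodfV -big_split.
have Te : \prod_(i < r) ((1 - c * e i / (a * z i * q)) / (1 - c / (b i * z i * q))) = pe / pb.
  by rewrite /pe /pb -prodfV -big_split.
have Tb : \prod_(i < r) ((1 - c / (b i * z i * q)) / (1 - c / (a * z i * q))) = pb / pz.
  by rewrite /pb /pz -prodfV -big_split.
have sr0 : sr != 0 by rewrite signr_eq0.
have srV : sr^-1 = sr by apply: (mulfI sr0); rewrite mulfV.
(* The sign [sr] occurs twice in the denominator; with one copy written as [sr^-1] they cancel
   without an appeal to [sr * sr = 1]. *)
rewrite -srV in eC1.
rewrite Tp Ts Te Tb eC1 eC2 eC3 eP1 eP2 eP3 eP4 -/ar.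
pose t := a * ar / (B * E * f * g).
have -> : f * E / Z * (Z / a) = E * f / a by field; rewrite a0 Z0.
have -> : a * ar / (g * B * Z) * (Z / a) = ar / (B * g).
  by field; rewrite a0 Z0 B0 g0.
have -> : q / (E * f / a) = a / (E * f) * q by field; rewrite E0 f0 a0.
have -> : q * (a * ar / (g * B * Z)) * (Z / a) = ar * q / (B * g).
  by field; rewrite a0 Z0 B0 g0.
have -> : q * (a * ar / (g * B * Z)) / (f * E / Z) = t * q.
  by rewrite /t; field; rewrite E0 f0 Z0 B0 g0.
have -> : f * E / Z - a * ar / (g * B * Z) = f * E / Z * (1 - t).
  by rewrite /t; field; rewrite E0 f0 Z0 B0 g0.
rewrite -/t (inf1 t) (inf1 (a / (E * f))).
have : (1 - t) * qpochinf q (t * q) != 0 by rewrite -inf1.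
rewrite mulf_eq0 negb_or => /andP[t0 tq0].
rewrite exprS mulN1r -/sr -/Cr.
have qq0 : qpochinf q q != 0 by exact: qpochinf_small_neq0.
clearbody t p1 p2 p3 p4 s1 s2 s3 s4 s5 s6 s7 s8 pz pb pe sr Cr C Z ar B E.
move: (qpochinf q q) (qpochinf q (t * q)) (qpochinf q (q / g)) (qpochinf q (a * q / f))
  qq0 tq0 qg qaf => w1 w2 w3 w4 w10 w20 w30 w40.
move: (qpochinf q (a / (E * f) * q)) (qpochinf q (ar * q / (B * g)))
  (qpochinf q (a * q / (f * g))) (vdm x) V0 => w5 w6 w7 V V0.
have qc : q - c != 0.
  by rewrite (_ : q - c = (1 - c / q) * q) ?mulf_neq0//; field.
have aEf : a - E * f != 0.
  by rewrite (_ : a - E * f = (1 - E * f / a) * a) ?mulf_neq0//; field.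
have gqc : g * q - c != 0.
  by rewrite (_ : g * q - c = (1 - c / (g * q)) * (g * q)) ?mulf_neq0//; field; rewrite g0 q0.
field.
by rewrite s80 s70 s60 s50 p40 p30 w30 w40 w20 t0 f0 E0 q0 qc g0 pz0 pb0 a0 aEf gqc B0 w10
  Z0 sr0 Cr0 C0 V0.
Qed.
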